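(* The fundamental pointed quandle is invariant under Reidemeister moves and the spherical move: if $L$ and $L'$ are ordered oriented $n$-linkoid diagrams related by a Reidemeister move or a spherical move (respecting the ordering of open components), then $P(L)$ and $P(L')$ are isomorphic $2n$-pointed quandles.
   Context: A quandle is a set $X$ with a binary operation $\triangleright$ such that (1) $x\triangleright x=x$ for all $x$; (2) for every $y$ the map $\beta_y:X\to X$, $\beta_y(x)=x\triangleright y$, is bijective; (3) $(x\triangleright y)\triangleright z=(x\triangleright z)\triangleright(y\triangleright z)$ for all $x,y,z$. Write $x\triangleright^{-1}y=\beta_y^{-1}(x)$ and $\triangleright^{1}=\triangleright$. An $m$-pointed quandle $(X,x_1,\dots,x_m)$ is a quandle $X$ together with an ordered list of $m$ elements (basepoints) of $X$. A homomorphism $(X,x_1,\dots,x_m)\to(Y,y_1,\dots,y_m)$ is a quandle homomorphism $\varphi:X\to Y$ with $\varphi(x_i)=y_i$ for all $i$; it is an isomorphism if it is bijective. An oriented $n$-linkoid diagram ($n\ge 0$) is a generic immersion into $S^2$ of $n$ unit intervals $[0,1]$ (oriented from $0$ to $1$; the open components) and a number of oriented circles (the closed components), with finitely many transverse double points (crossings), each endowed with over/under information. The image of $0$ in an open component is its leg and the image of $1$ its head; these are the endpoints. It is ordered if an ordering of the open components is given. The Reidemeister moves are R0 (isotopy) and the oriented moves R1, R2, R3, all taking place away from the endpoints (no endpoint is moved over or under a strand); the spherical move passes a strand around the sphere $S^2$ (isotopy in $S^2$ across the point at infinity). An arc of a diagram is a maximal piece of a component containing no passage under a crossing (arcs end at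 undercrossings or endpoints). If $A(L)$ is the set of arcs of $L$, the fundamental quandle $Q(L)$ is the quandle presented by generators $A(L)$ and one relation $r_\tau$ for each crossing $\tau$: if $y$ is the over-arc, $x$ the incoming under-arc, $z$ the outgoing under-arc and $\varepsilon\in\{1,-1\}$ the sign of the crossing, then $r_\tau$ is $z=x\triangleright^{\varepsilon}y$. The fundamental pointed quandle of an ordered $n$-linkoid diagram $L$ is the $2n$-pointed quandle $P(L)=(Q(L),l_1,h_1,\dots,l_n,h_n)$, where $l_i$ and $h_i$ are the generators corresponding to the arcs adjacent to the leg and head of the $i$-th open component. *)

(* Defs.v *)
From HB Require Import structures.
From mathcomp Require Import all_boot all_order all_algebra perm.
From mathcomp Require Import all_classical all_reals all_analysis.

Set Implicit Arguments.
Unset Strict Implicit.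
Unset Printing Implicit Defensive.

Import Order.TTheory GRing.Theory Num.Theory.
Import numFieldNormedType.Exports.

Local Open Scope classical_set_scope.
Local Open Scope ring_scope.

Record quandle := Quandle {
  qcar :> Type;
  qop : qcar -> qcar -> qcar;
  qop_idem : forall x, qop x x = x;
  qop_bij : forall y, bijective (qop^~ y);
  qop_dist : forall x y z, qop (qop x y) z = qop (qop x z) (qop y z) }.

Record pointed_quandle (m : nat) := PointedQuandle {
  pq_quandle :> quandle;
  basepoint : 'I_m -> pq_quandle }.

Definition quandle_hom (X Y : quandle) (f : X -> Y) :=
  forall x y, f (qop x y) = qop (f x) (f y).

Definition pointed_hom m (X Y : pointed_quandle m) (f : X -> Y) :=
  quandle_hom f /\ forall i, f (basepoint X i) = basepoint Y i.

Definition pointed_isomorphic m (X Y : pointed_quandle m) :=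
  exists f : X -> Y, pointed_hom f /\ bijective f.

(* Quandles presented by generators and relations are formal words in the two
    operations, modulo the congruence generated by the quandle axioms and the
    relations. *)

Inductive qword (A : Type) :=
  | Gen of A
  | Op of qword A & qword A
  | OpInv of qword A & qword A.

Section Presentation.
Variables (A : Type) (rel : qword A -> qword A -> Prop).

Inductive qcong : qword A -> qword A -> Prop :=
  | qcong_refl u : qcong u u
  | qcong_sym u v : qcong u v -> qcong v u
  | qcong_trans u v w : qcong u v -> qcong v w -> qcong u w
  | qcong_op u u' v v' : qcong u u' -> qcong v v' -> qcong (Op u v) (Op u' v')
  | qcong_opinv u u' v v' :
      qcong u u' -> qcong v v' -> qcong (OpInv u v) (OpInv u' v')
  | qcong_idem u : qcong (Op u u) u
  | qcong_opK u v : qcong (OpInv (Op u v) v) u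
  | qcong_opinvK u v : qcong (Op (OpInv u v) v) u
  | qcong_dist u v w :
      qcong (Op (Op u v) w) (Op (Op u w) (Op v w))
  | qcong_rel u v : rel u v -> qcong u v.

Definition presented_carrier := {C : set (qword A) | exists u, C = qcong u}.

Definition qclass (u : qword A) : presented_carrier :=
  exist _ (qcong u : set (qword A)) (ex_intro _ u erefl).

Definition qrepr (C : presented_carrier) : qword A := sval (cid (svalP C)).

Lemma qclassP u v : qclass u = qclass v <-> qcong u v.
Proof.
split=> [[E]|uv]; first by rewrite E; exact: qcong_refl.
apply/eq_exist; apply/predeqP => w; split.
- exact/qcong_trans/qcong_sym.
- exact/qcong_trans.
Qed.

Lemma qreprK C : qclass (qrepr C) = C.
Proof.
case: C => C HC; apply/eq_exist; rewrite /qrepr /=.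
by case: cid => u /= ->.
Qed.

Lemma qclass_reprP u : qcong (qrepr (qclass u)) u.
Proof. by apply/qclassP; exact: qreprK. Qed.

Definition presented_op (C D : presented_carrier) :=
  qclass (Op (qrepr C) (qrepr D)).

Definition presented_opinv (C D : presented_carrier) :=
  qclass (OpInv (qrepr C) (qrepr D)).

Lemma presented_idem C : presented_op C C = C.
Proof. by rewrite -[RHS]qreprK; apply/qclassP; exact: qcong_idem. Qed.

Lemma presented_bij D : bijective (presented_op^~ D).
Proof.
exists (presented_opinv^~ D) => C; rewrite -[RHS]qreprK; apply/qclassP.
- apply: qcong_trans (qcong_opK _ (qrepr D)).
  by apply: qcong_opinv; [exact: qclass_reprP|exact: qcong_refl].
- apply: qcong_trans (qcong_opinvK _ (qrepr D)).
  by apply: qcong_op; [exact: qclass_reprP|exact: qcong_refl].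
Qed.

Lemma presented_dist C D E : presented_op (presented_op C D) E =
  presented_op (presented_op C E) (presented_op D E).
Proof.
apply/qclassP.
apply: (@qcong_trans _ (Op (Op (qrepr C) (qrepr D)) (qrepr E))).
  by apply: qcong_op; [exact: qclass_reprP|exact: qcong_refl].
apply: qcong_trans (qcong_dist _ _ _) _.
by apply: qcong_op; apply/qcong_sym; exact: qclass_reprP.
Qed.

Definition presented_quandle : quandle :=
  Quandle presented_idem presented_bij presented_dist.

End Presentation.

Section Geometry.
Variable R : realType.

(* C^oo: every iterated directional derivative is (Frechet) differentiable. *)
Definition smooth (V W : normedModType R) (f : V -> W) :=
  forall (vs : seq V) (x : V),
    differentiable (foldr (fun v (g : V -> W) => fun y => 'D_v g y) f vs) x.

Definition dot m (u v : 'rV[R]_m) : R := \sum_i u 0 i * v 0 i.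

Definition on_sphere (x : 'rV[R]_3) := dot x x = 1.

Definition on_disc (x : 'rV[R]_2) := dot x x <= 1.

Definition on_circle (x : 'rV[R]_2) := dot x x = 1.

Definition infinity_pt : 'rV[R]_3 := delta_mx 0 2.

(* For tangent vectors u, v of S^2 at x, the sign of [triple u v x] is the
   orientation of (u, v), S^2 being oriented by its outward normal x. *)
Definition triple (u v w : 'rV[R]_3) : R :=
  \det (\matrix_(i < 3) nth 0 [:: u; v; w] i).

(* An orientation-preserving smooth embedding of the closed unit disc into the
   sphere; only the values on the disc matter, [phi] extends them to R^2. *)
Definition disc_embedding (phi : 'rV[R]_2 -> 'rV[R]_3) :=
  [/\ smooth phi,
      forall x, on_disc x -> on_sphere (phi x),
      forall x y, on_disc x -> on_disc y -> phi x = phi y -> x = y &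
      forall x, on_disc x ->
        0 < triple ('D_(delta_mx 0 0) phi x) ('D_(delta_mx 0 1) phi x) (phi x)].

(* An ambient isotopy of the sphere, parametrised by [0, 1]; only the values
   at times in [0, 1] and points of the sphere matter. *)
Definition ambient_isotopy (Phi : R^o * 'rV[R]_3 -> 'rV[R]_3) :=
  [/\ smooth Phi,
      forall x, on_sphere x -> Phi (0, x) = x,
      forall t, 0 <= t <= 1 ->
        set_bij on_sphere on_sphere (fun x => Phi (t, x)) &
      forall t x u, 0 <= t <= 1 -> on_sphere x -> dot u x = 0 -> u != 0 ->
        'D_u (fun y => Phi (t, y)) x != 0].

End Geometry.

Section Diagrams.
Variables (R : realType) (n k : nat).

(* [inl i] is the i-th open component, [inr j] the j-th closed one. *)
Definition component : Type := 'I_n + 'I_k.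

(* A point of the source of the immersion: a component and a parameter.  The
   parameter ranges over [0, 1] on an open component and over R, taken modulo
   Z, on a closed one. *)
Definition source_pt : Type := component * R.

Definition valid (p : source_pt) : Prop :=
  match p.1 with inl _ => 0 <= p.2 <= 1 | inr _ => True end.

Definition same_point (p q : source_pt) : Prop :=
  p.1 = q.1 /\
  match p.1 with
  | inl _ => p.2 = q.2
  | inr _ => exists m : int, q.2 = p.2 + m%:~R
  end.

(* A parameter domain in which a point has exactly one representative. *)
Definition reduced (p : source_pt) : Prop :=
  match p.1 with inl _ => 0 <= p.2 <= 1 | inr _ => 0 <= p.2 < 1 end.

Definition is_endpoint (p : source_pt) : Prop :=
  match p.1 with inl _ => p.2 = 0 \/ p.2 = 1 | inr _ => False end.

Definition double_point (f : component -> R -> 'rV[R]_3) (p q : source_pt) :=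
  [/\ valid p, valid q, ~ same_point p q & f p.1 p.2 = f q.1 q.2].

(* [strand (inl i)] is only meaningful on [0, 1].  [is_over p q], meaning that
   the passage at p is over the one at q, is only meaningful at double points. *)
Record diagram := Diagram {
  strand : component -> R -> 'rV[R]_3;
  is_over : source_pt -> source_pt -> Prop;
  strand_smooth : forall c, smooth (strand c : R^o -> 'rV[R]_3);
  strand_sphere : forall p, valid p -> on_sphere (strand p.1 p.2);
  strand_period : forall j t, strand (inr j) (t + 1) = strand (inr j) t;
  strand_immersion : forall p, valid p -> (strand p.1)^`()%classic p.2 != 0;
  double_finite : finite_set [set pq : source_pt * source_pt |
    [/\ double_point strand pq.1 pq.2, reduced pq.1 & reduced pq.2]];
  double_transverse : forall p q, double_point strand p q ->
    triple ((strand p.1)^`()%classic p.2) ((strand q.1)^`()%classic q.2)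
      (strand p.1 p.2) != 0;
  no_triple_point : forall p q r, double_point strand p q ->
    double_point strand q r -> double_point strand p r -> False;
  endpoint_not_double : forall p q, double_point strand p q -> ~ is_endpoint p;
  over_asym : forall p q, double_point strand p q ->
    is_over p q <-> ~ is_over q p;
  over_same : forall p p' q q', double_point strand p q ->
    same_point p p' -> same_point q q' -> is_over p q -> is_over p' q' }.

Section Arcs.
Variable L : diagram.

Definition position (p : source_pt) : 'rV[R]_3 := strand L p.1 p.2.

Definition velocity (p : source_pt) : 'rV[R]_3 :=
  (strand L p.1)^`()%classic p.2.

(* A crossing, with over-passage p and under-passage q. *)
Definition crossing (p q : source_pt) :=
  double_point (strand L) p q /\ is_over L p q.

(* Seen from outside the sphere, a crossing is positive when the over-strand
   has to turn counterclockwise (by less than a half-turn) to the under-one. *)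
Definition positive (p q : source_pt) : bool :=
  0 < triple (velocity p) (velocity q) (position p).

Definition under (q : source_pt) := exists p, crossing p q.

(* The points reached from p inside its component without meeting any
   undercrossing. *)
Definition arc_of (p : source_pt) : set source_pt :=
  [set q | exists q', [/\ same_point q q', valid q', p.1 = q'.1 &
     forall t, Num.min p.2 q'.2 <= t <= Num.max p.2 q'.2 -> ~ under (p.1, t)]].

Definition diag_arc : Type :=
  {a : set source_pt | exists p, [/\ valid p, ~ under p & a = arc_of p]}.

(* The arc a ends, resp. starts, at the undercrossing q. *)
Definition arc_into (a : diag_arc) (q : source_pt) : Prop :=
  \forall t \near q.2^'-, sval a (q.1, t).

Definition arc_from (a : diag_arc) (q : source_pt) : Prop :=
  \forall t \near q.2^'+, sval a (q.1, t).

Definition crossing_relation (u v : qword diag_arc) : Prop :=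
  exists p q (x y z : diag_arc), [/\ crossing p q, sval y p, arc_into x q,
    arc_from z q &
    u = Gen z /\
    v = if positive p q then Op (Gen x) (Gen y) else OpInv (Gen x) (Gen y)].

Definition fundamental_quandle : quandle :=
  presented_quandle crossing_relation.

Definition generator (a : diag_arc) : fundamental_quandle :=
  qclass crossing_relation (Gen a).

Lemma endpoint_arc (p : source_pt) : is_endpoint p ->
  exists p0, [/\ valid p0, ~ under p0 & arc_of p = arc_of p0].
Proof.
move=> ep; exists p; split=> //.
- by case: p ep => -[i|j] t; rewrite /is_endpoint /valid //= => -[] ->;
     rewrite ?lexx ?ler01.
- case=> q [[vq vp ns E] _]; apply: (@endpoint_not_double L p q) ep.
  split=> // -[E1 E2]; apply: ns; split; first by rewrite E1.
  rewrite -E1; case: p.1 E2 => [i ->//|j [m ->]].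
  by exists (- m); rewrite -addrA -intrD subrr addr0.
Qed.

Definition leg_arc (i : 'I_n) : diag_arc :=
  exist _ (arc_of (inl i, 0))
    (@endpoint_arc (inl i, 0) (or_introl erefl)).

Definition head_arc (i : 'I_n) : diag_arc :=
  exist _ (arc_of (inl i, 1))
    (@endpoint_arc (inl i, 1) (or_intror erefl)).

Lemma half_ord_proof (j : 'I_n.*2) : (j./2 < n)%N.
Proof. by rewrite ltn_half_double. Qed.

(* The basepoints, in the order l_1, h_1, ..., l_n, h_n. *)
Definition fundamental_pointed_quandle : pointed_quandle n.*2 :=
  @PointedQuandle n.*2 fundamental_quandle (fun j =>
    let i := Ordinal (half_ord_proof j) in
    generator (if odd j then head_arc i else leg_arc i)).

End Arcs.

(* Equality of diagrams as unparametrised oriented curves, the closed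
   components being unordered: [L1] is [L] reparametrised by an
   orientation-preserving [rho] and with its closed components permuted. *)
Definition same_diagram (L L1 : diagram) : Prop :=
  exists (pi : {perm 'I_k}) (rho : component -> R -> R),
    let rename (c : component) : component :=
      match c with inl i => inl i | inr j => inr (pi j) end in
    let move_pt (p : source_pt) : source_pt := (rename p.1, rho p.1 p.2) in
    [/\ forall c, smooth (rho c : R^o -> R^o),
        forall p, valid p -> 0 < (rho p.1)^`()%classic p.2,
        forall i, rho (inl i) 0 = 0 /\ rho (inl i) 1 = 1,
        forall j t, rho (inr j) (t + 1) = rho (inr j) t + 1 &
        (forall p, valid p -> position L1 p = position L (move_pt p)) /\
        (forall p q, double_point (strand L1) p q ->
           is_over L1 p q <-> is_over L (move_pt p) (move_pt q))].

Definition carried_by (Phi : R^o * 'rV[R]_3 -> 'rV[R]_3) (L1 L' : diagram) :=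
  (forall p, valid p -> position L' p = Phi (1, position L1 p)) /\
  (forall p q, double_point (strand L') p q ->
     is_over L' p q <-> is_over L1 p q).

Definition R0_move (L L' : diagram) : Prop :=
  exists L1 Phi, [/\ same_diagram L L1, ambient_isotopy Phi &
    carried_by Phi L1 L'].

Definition avoids_infinity (L : diagram) :=
  forall p, valid p -> position L p <> infinity_pt R.

(* An isotopy on the sphere between two diagrams drawn in the plane
   (the sphere minus the point at infinity), in the course of which a strand
   is pushed across the point at infinity. *)
Definition spherical_move (L L' : diagram) : Prop :=
  [/\ avoids_infinity L, avoids_infinity L' &
    exists L1 Phi, [/\ same_diagram L L1, ambient_isotopy Phi,
      carried_by Phi L1 L' &
      exists t p, [/\ 0 <= t <= 1, valid p &
        Phi (t, position L1 p) = infinity_pt R]]].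

(* r disjoint pieces of components, the i-th one being the interval
   [lo i, hi i] of the component [cc i], away from the endpoints. *)
Section Pieces.
Variables (r : nat) (cc : 'I_r -> component) (lo hi : 'I_r -> R).

Definition in_piece (i : 'I_r) (p : source_pt) : Prop :=
  exists2 t, lo i <= t <= hi i & same_point (cc i, t) p.

Definition outside (p : source_pt) : Prop :=
  valid p /\ forall i, ~ in_piece i p.

Definition good_pieces : Prop :=
  (forall i, lo i < hi i /\
     match cc i with inl _ => 0 < lo i /\ hi i < 1
                   | inr _ => hi i < lo i + 1 end) /\
  (forall i j p, in_piece i p -> in_piece j p -> i = j).

(* The part of [L] in the disc [phi] consists of these r pieces; [phi]
   identifies the i-th one with the curve [sigma i] : [-1, 1] -> disc,
   traversed backwards when [back i]; and whenever two different pieces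
   cross, the one with the greater height is over. *)
Definition tangle_in_disc (L : diagram) (phi : 'rV[R]_2 -> 'rV[R]_3)
    (sigma : 'I_r -> R -> 'rV[R]_2) (back : 'I_r -> bool)
    (height : 'I_r -> nat) : Prop :=
  [/\ forall i, exists theta : R -> R,
        [/\ smooth (theta : R^o -> R^o),
            theta (lo i) = - (-1) ^+ back i,
            theta (hi i) = (-1) ^+ back i,
            forall t, lo i <= t <= hi i ->
              0 < (-1) ^+ back i * theta^`()%classic t &
            forall t, lo i <= t <= hi i ->
              strand L (cc i) t = phi (sigma i (theta t))],
      forall p, outside p -> forall x, on_disc x -> position L p <> phi x &
      forall i j p q, in_piece i p -> in_piece j q -> i <> j ->
        double_point (strand L) p q ->
          is_over L p q <-> (height j < height i)%N].

End Pieces.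

(* [L1] and [L'] agree outside a disc; inside, the tangle with underlying
   curves [sigma] is replaced by the one with underlying curves [sigma'].
   The two identifications of the disc with the standard one agree along its
   boundary, but may differ inside, and may be precomposed with
   reparametrisations: the curves are prescribed up to isotopy of the disc.
   All orientations of the pieces ([back]), and all assignments of heights,
   are allowed. *)
Definition local_replacement r (sigma sigma' : 'I_r -> R -> 'rV[R]_2)
    (L1 L' : diagram) : Prop :=
  exists (cc : 'I_r -> component) (lo hi : 'I_r -> R)
         (phi phi' : 'rV[R]_2 -> 'rV[R]_3)
         (back : 'I_r -> bool) (height : 'I_r -> nat),
    [/\ [/\ good_pieces cc lo hi & injective height],
        [/\ disc_embedding phi, disc_embedding phi',
            phi @` @on_disc R = phi' @` @on_disc R &
            forall x, on_circle x -> phi x = phi' x],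
        tangle_in_disc cc lo hi L1 phi sigma back height,
        tangle_in_disc cc lo hi L' phi' sigma' back height &
        (forall p, outside cc lo hi p -> position L1 p = position L' p) /\
        (forall p q, outside cc lo hi p -> outside cc lo hi q ->
           double_point (strand L1) p q -> is_over L1 p q <-> is_over L' p q)].

Definition local_move r (sigma sigma' : 'I_r -> R -> 'rV[R]_2)
    (L L' : diagram) : Prop :=
  exists2 L1, same_diagram L L1 & local_replacement sigma sigma' L1 L'.

Definition vec2 (x y : R) : 'rV[R]_2 := \row_i nth 0 [:: x; y] i.

(* Standard curves [-1, 1] -> disc for the moves, with ends on the circle. *)

Definition R1_line (i : 'I_1) (t : R) := vec2 t 0.

(* A nodal cubic, crossing itself exactly at t = -1/2 and t = 1/2.  The loop
   lies on the left of the strand; traversing it backwards gives the loop on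
   the right. *)
Definition R1_kink (i : 'I_1) (t : R) :=
  vec2 (t * (4 * t ^+ 2 - 1) / 3) ((1 - t ^+ 2) / 2).

Definition R2_apart (i : 'I_2) (t : R) :=
  vec2 (4 / 5 * t) (if i == 0 then - (3 / 5) else 3 / 5).

(* Two parabolas, crossing exactly at t = -1/2 and t = 1/2. *)
Definition R2_overlap (i : 'I_2) (t : R) :=
  vec2 (4 / 5 * t)
    (if i == 0 then (1 - 4 * t ^+ 2) / 5 else - ((1 - 4 * t ^+ 2) / 5)).

(* Two diameters, crossing at the centre, and a parabola passing below,
   resp. above, the centre. *)
Definition R3_below (i : 'I_3) (t : R) :=
  match val i with
  | 0%N => vec2 t (- ((1 - t ^+ 2) / 2))
  | 1%N => vec2 (3 / 5 * t) (4 / 5 * t)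
  | _ => vec2 (3 / 5 * t) (- (4 / 5 * t))
  end.

Definition R3_above (i : 'I_3) (t : R) :=
  match val i with
  | 0%N => vec2 t ((1 - t ^+ 2) / 2)
  | 1%N => vec2 (3 / 5 * t) (4 / 5 * t)
  | _ => vec2 (3 / 5 * t) (- (4 / 5 * t))
  end.

Definition R1_move (L L' : diagram) : Prop :=
  local_move R1_line R1_kink L L' \/ local_move R1_kink R1_line L L'.

Definition R2_move (L L' : diagram) : Prop :=
  local_move R2_apart R2_overlap L L' \/ local_move R2_overlap R2_apart L L'.

Definition R3_move (L L' : diagram) : Prop :=
  local_move R3_below R3_above L L' \/ local_move R3_above R3_below L L'.

Definition reidemeister_move (L L' : diagram) : Prop :=
  [\/ R0_move L L', R1_move L L', R2_move L L' | R3_move L L'].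

End Diagrams.

(* Main.v *)
Require Import Defs.
From mathcomp Require Import all_boot all_order all_algebra perm.
From mathcomp Require Import all_classical all_reals all_analysis.
From mathcomp Require Import ring lra zify.

Set Implicit Arguments.
Unset Strict Implicit.
Unset Printing Implicit Defensive.

Import Order.TTheory GRing.Theory Num.Theory.
Import numFieldNormedType.Exports.

Local Open Scope classical_set_scope.
Local Open Scope ring_scope.

(** A homomorphism from the fundamental quandle of a diagram to a quandle X is the
    same thing as a coloring of the diagram by X: a function on the points that is
    constant along the components as long as no undercrossing is met, and that
    changes at an undercrossing by the action of the color of the over-passage.  By
    Yoneda's argument ([iso_by_transfer]) two diagrams have isomorphic pointed
    quandles if their colorings correspond one to one, naturally in X, with equal
    colors at the endpoints.

    Reparametrising a diagram or carrying it along by an ambient isotopy identifies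
    the points of the two diagrams and preserves the crossings; what has to be seen
    is that the signs of the crossings are preserved.  For an isotopy this holds
    because the tangent frame at a crossing stays nondegenerate during the motion,
    so that its orientation cannot change ([isotopy_orientation]).  A spherical move
    is an isotopy of the sphere.

    In the other moves the two diagrams have the same points outside of some pieces
    of components, namely those drawn in a disc.  A coloring of the first diagram
    restricts to a coloring of the tangle in the disc; it suffices to exchange that
    for a coloring of the other tangle with the same colors at the ends, in a unique
    way, and to glue the result to the unchanged part ([glued_coloring],
    [coloring_unique], [tangle_replacement_isomorphic]).  Signs in the disc can be
    computed from the standard curves, since the disc is embedded with its
    orientation ([disc_positive]).  The direction in which an under-strand is
    traversed is irrelevant, as reversing it exchanges the two sides and changes the
    sign; hence only the directions of the over-strands, recorded in the signs of
    the action, remain.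

    What is left is algebra on at most three strands.  For a kink it is idempotence
    ([kink_equivalent]), for two overlapping strands the invertibility of the action
    ([overlap_equivalent]), and for a triangle the distributivity law, which is
    uniform in the signs ([qactD], [triangle_extend]).  In the last case the top,
    middle and bottom strands are named after the heights, so that all the
    assignments of heights and directions are treated at once. *)

(** * Quandles *)

Lemma qinv_exists (X : quandle) (y : X) :
  exists g : X -> X, cancel (fun x => qop x y) g /\ cancel g (fun x => qop x y).
Proof. by case: (qop_bij y) => g gK Kg; exists g. Qed.

(** The two operations as one family indexed by a sign, so that the quandle
    axioms take a form that is uniform in the signs of the crossings. *)
Definition qact (X : quandle) (e : bool) (x y : X) : X :=
  if e then qop x y else sval (cid (qinv_exists y)) x.
Arguments qact : simpl never.

Section SignedOperation.
Variable X : quandle.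
Implicit Types (x y z : X) (e d : bool).

Lemma qactK e x y : qact (~~ e) (qact e x y) y = x.
Proof. by case: e; rewrite /qact /=; case: cid => g /= []. Qed.

Lemma qactNK e x y : qact e (qact (~~ e) x y) y = x.
Proof. by case: e; [exact: (qactK false)|exact: (qactK true)]. Qed.

Lemma qact_inj e y : injective (fun x => qact e x y).
Proof. by move=> x z /(congr1 (fun u => qact (~~ e) u y)); rewrite !qactK. Qed.

Lemma qact_idem e x : qact e x x = x.
Proof.
by case: e; [exact: qop_idem|apply: (@qact_inj true x); rewrite qactNK /qact qop_idem].
Qed.

Lemma qact_eqV e x y z : qact e x y = z -> x = qact (~~ e) z y.
Proof. by move=> <-; rewrite qactK. Qed.

(** Acting by [z], with either sign, is an automorphism of the quandle, hence
    commutes with both operations. *)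
Lemma qactD d e x y z :
  qact d (qact e x y) z = qact e (qact d x z) (qact d y z).
Proof.
have D2 f x' y' : qact true (qact f x' y') z =
    qact f (qact true x' z) (qact true y' z).
  case: f; first exact: qop_dist.
  apply: (@qact_inj true (qact true y' z)); rewrite qactNK.
  by rewrite -[LHS](qop_dist (qact false x' y') y' z) -/(qact true _ y') qactNK.
case: d; first exact: D2.
by apply: (@qact_inj true z); rewrite qactNK D2 !qactNK.
Qed.

End SignedOperation.

Lemma quandle_hom_qact (X Y : quandle) (f : X -> Y) : quandle_hom f ->
  forall e x y, f (qact e x y) = qact e (f x) (f y).
Proof.
move=> fM [] x y; first exact: fM.
by apply: (@qact_inj _ true (f y)); rewrite qactNK -[LHS]fM -/(qact true _ y) qactNK.
Qed.

Section PresentedQuandle.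
Variables (A : Type) (rel : qword A -> qword A -> Prop).
Local Notation Q := (presented_quandle rel).
Local Notation "[ w ]" := (qclass rel w : Q).

Lemma qclass_ind (P : Q -> Prop) : (forall w, P [w]) -> forall C, P C.
Proof. by move=> Pw C; rewrite -(qreprK C). Qed.

Lemma qclass_Op u v : [Op u v] = qact true [u] [v].
Proof.
by apply/qclassP/qcong_sym/qcong_op; exact: qclass_reprP.
Qed.

Lemma qclass_OpInv u v : [OpInv u v] = qact false [u] [v].
Proof.
apply: (@qact_inj _ true [v]); rewrite qactNK -qclass_Op.
exact/qclassP/qcong_opinvK.
Qed.

Lemma qclass_rel u v : rel u v -> [u] = [v].
Proof. by move=> uv; apply/qclassP/qcong_rel. Qed.

Section Eval.
Variables (X : quandle) (c : A -> X).

Fixpoint word_eval (w : qword A) : X :=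
  match w with
  | Gen a => c a
  | Op u v => qact true (word_eval u) (word_eval v)
  | OpInv u v => qact false (word_eval u) (word_eval v)
  end.

Hypothesis c_rel : forall u v, rel u v -> word_eval u = word_eval v.

Lemma word_eval_cong u v : qcong rel u v -> word_eval u = word_eval v.
Proof.
elim=> {u v} //=.
- by move=> u v w _ -> _ ->.
- by move=> u u' v v' _ -> _ ->.
- by move=> u u' v v' _ -> _ ->.
- by move=> u; rewrite qact_idem.
- by move=> u v; rewrite (qactK true).
- by move=> u v; rewrite (qactNK true).
- by move=> u v w; rewrite qactD.
Qed.

Definition presented_lift (C : Q) : X := word_eval (qrepr C).

Lemma presented_lift_class w : presented_lift [w] = word_eval w.
Proof. exact/word_eval_cong/qclass_reprP. Qed.

Lemma presented_lift_hom : quandle_hom presented_lift.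
Proof.
apply: qclass_ind => u; apply: qclass_ind => v.
by rewrite -[qop _ _]qclass_Op !presented_lift_class.
Qed.

End Eval.

Lemma presented_hom_unique (X : quandle) (f g : Q -> X) :
  quandle_hom f -> quandle_hom g ->
  (forall a, f [Gen a] = g [Gen a]) -> f =1 g.
Proof.
move=> fM gM fg; apply: qclass_ind; elim=> [//|u IHu v IHv|u IHu v IHv].
- by rewrite qclass_Op !quandle_hom_qact // IHu IHv.
- by rewrite qclass_OpInv !quandle_hom_qact // IHu IHv.
Qed.

End PresentedQuandle.

Lemma pointed_isomorphic_trans m (X Y Z : pointed_quandle m) :
  pointed_isomorphic X Y -> pointed_isomorphic Y Z -> pointed_isomorphic X Z.
Proof.
move=> [f [[fM fb] fbij]] [g [[gM gb] gbij]]; exists (g \o f); split.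
  by split=> [x y|i] /=; rewrite ?fM ?fb.
exact: bij_comp.
Qed.

(** * Neighbourhoods on the line *)

Section RealLemmas.
Variable R : realType.
Implicit Types (x s t e : R).

Lemma at_left_ball x (P : set R) :
  (\forall t \near x^'-, P t) <->
  exists2 e, 0 < e & forall t, x - e < t < x -> P t.
Proof.
split=> [/nbhs_ballP[e /= e0 H]|[e e0 H]].
  exists e => // t /andP[t1 t2]; apply: H => //=.
  by rewrite /ball /= ltr_norml; apply/andP; split; lra.
apply/nbhs_ballP; exists e => //= t; rewrite /ball /= ltr_norml => /andP[t1 t2] t3.
by apply: H; apply/andP; split; lra.
Qed.

Lemma at_right_ball x (P : set R) :
  (\forall t \near x^'+, P t) <->
  exists2 e, 0 < e & forall t, x < t < x + e -> P t.
Proof.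
split=> [/nbhs_ballP[e /= e0 H]|[e e0 H]].
  exists e => // t /andP[t1 t2]; apply: H => //=.
  by rewrite /ball /= ltr_norml; apply/andP; split; lra.
apply/nbhs_ballP; exists e => //= t; rewrite /ball /= ltr_norml => /andP[t1 t2] t3.
by apply: H; apply/andP; split; lra.
Qed.

Lemma finite_set_isolated x (V : set R) : finite_set V ->
  exists2 e, 0 < e & forall v, V v -> 0 < `|v - x| -> e <= `|v - x|.
Proof.
case/finite_seqP => s ->; elim: s => [|v s [e e0 IH]]; first by exists 1.
have [->|vx] := eqVneq v x.
  exists e => // w; rewrite /= inE => /orP[/eqP -> |/IH]//.
  by rewrite subrr normr0 ltxx.
have d0 : 0 < `|v - x| by rewrite normr_gt0 subr_eq0.
exists (Num.min e `|v - x|); first by rewrite lt_min e0.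
move=> w; rewrite /= inE ge_min => /orP[/eqP -> |/IH H /H ->]//.
by rewrite lexx orbT.
Qed.

(** An interval is connected: the supremum of the points up to which [f] keeps
    its initial value has to be the right end. *)
Lemma locally_constant (T : Type) (f : R -> T) s t : s <= t ->
  (forall u, s <= u <= t -> exists2 e, 0 < e &
     forall v, `|v - u| < e -> s <= v <= t -> f v = f u) ->
  f s = f t.
Proof.
move=> st loc; pose A := [set u | s <= u <= t /\ f u = f s].
have As : A s by split; rewrite ?lexx.
have Aub : ubound A t by move=> u [/andP[]].
have sx : s <= sup A by apply: ub_le_sup => //; exists t.
have xt : sup A <= t by apply: ge_sup => //; exists s.
have [|e e0 He] := loc (sup A); first by rewrite sx.
have [|u [/andP[su ut] fu] xu] := @sup_adherent _ A _ e0.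
  by split; [exists s|exists t].
have ux : u <= sup A by apply: ub_le_sup; [exists t|split; rewrite ?su].
have fx : f (sup A) = f s.
  by rewrite -fu; apply/esym/He; [rewrite ltr_norml; apply/andP; split; lra|rewrite su].
have [E|xt'] := eqVneq (sup A) t; first by rewrite -fx E.
have {}xt : sup A < t by rewrite lt_neqAle xt'.
pose v := Num.min t (sup A + e / 2).
have xv : sup A < v by rewrite lt_min xt /=; lra.
have vt : v <= t by rewrite ge_min lexx.
have ve : v <= sup A + e / 2 by rewrite ge_min lexx orbT.
have sv : s <= v by lra.
have Av : A v.
  split; first by rewrite sv.
  by rewrite -fx; apply: He; [rewrite ltr_norml; apply/andP; split; lra|rewrite sv].
by have := ub_le_sup (ex_intro _ t Aub) Av; rewrite leNgt xv.
Qed.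

End RealLemmas.

(** * Points of a diagram *)

Section Points.
Variables (R : realType) (n k : nat).
Local Notation pt := (source_pt R n k).
Implicit Types (p q r : pt) (a : component n k) (s t : R).

Lemma same_point_refl p : same_point p p.
Proof. by split=> //; case: p => -[i|j] t //; exists 0; rewrite addr0. Qed.

Lemma same_point_sym p q : same_point p q -> same_point q p.
Proof.
case: p q => [a s] [b t] [/= <-]; case: a => [i ->|j [m ->]]; split=> //=.
by exists (- m); rewrite -addrA -intrD subrr addr0.
Qed.

Lemma same_point_trans p q r :
  same_point p q -> same_point q r -> same_point p r.
Proof.
case: p q r => [a s] [b t] [c u] [/= <-]; case: a => [i -> []//|j [m ->]].
move=> [/= <-] [l ->]; split=> //=; exists (m + l).
by rewrite intrD addrA.
Qed.

Lemma same_point_comp p q : same_point p q -> p.1 = q.1.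
Proof. by case. Qed.

Lemma same_point_valid p q : same_point p q -> valid p -> valid q.
Proof. by case: p q => [a s] [b t] [/= <-]; case: a => [i ->|]. Qed.

Lemma same_point_inr (j : 'I_k) (m : int) t :
  same_point (inr j : component n k, t) (inr j, t + m%:~R).
Proof. by split=> //=; exists m. Qed.

(** Two names of a point differ by a translation, which carries neighbouring
    points to neighbouring points. *)
Lemma same_point_shift p q : same_point p q ->
  forall t, same_point (p.1, t) (q.1, t - p.2 + q.2).
Proof.
case: p q => [a s] [b u] [/= <-]; case: a => [i -> t|j [m ->] t].
  by rewrite subrK; exact: same_point_refl.
split=> //=; exists m; ring.
Qed.

Lemma valid_convex a s t u :
  valid (a, s) -> valid (a, t) -> s <= u <= t -> valid (a, u).
Proof.
case: a => //= i; rewrite /valid /=; lra.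
Qed.

Lemma reduced_exists p : valid p -> exists2 q, same_point p q & reduced q.
Proof.
case: p => [[i|j] t] vp; first by exists (inl i, t) => //; exact: same_point_refl.
exists (inr j, t + (- Num.floor t)%:~R); first exact: same_point_inr.
rewrite /reduced /= rmorphN /=.
have := floor_le_tmp t; have := floorD1_gt t; rewrite intrD; lra.
Qed.

Variable L : diagram R n k.

Lemma strand_periodZ j t (m : int) :
  strand L (inr j) (t + m%:~R) = strand L (inr j) t.
Proof.
have pos (l : nat) u : strand L (inr j) (u + l%:R) = strand L (inr j) u.
  by elim: l => [|l IH]; rewrite ?addr0 // -natr1 addrA strand_period.
case: m => l; first exact: pos.
by rewrite NegzE rmorphN /= -pmulrn -(pos l.+1) subrK.
Qed.

Lemma position_same p q : same_point p q -> position L p = position L q.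
Proof.
case: p q => [a s] [b t] [/= <-]; rewrite /position /=.
by case: a => [i ->//|j [m ->]]; rewrite strand_periodZ.
Qed.

Lemma velocity_same p q : same_point p q -> velocity L p = velocity L q.
Proof.
case: p q => [a s] [b t] [/= <-]; rewrite /velocity /=.
case: a => [i ->//|j [m ->]]; rewrite /derive1.
by under [in RHS]eq_fun do rewrite addrA !strand_periodZ.
Qed.

Lemma positive_same p p' q q' : same_point p p' -> same_point q q' ->
  positive L p q = positive L p' q'.
Proof.
by move=> pp qq; rewrite /positive (velocity_same pp) (velocity_same qq) (position_same pp).
Qed.

Lemma double_point_sym p q :
  double_point (strand L) p q -> double_point (strand L) q p.
Proof. by case=> vp vq pq e; split=> // qp; apply/pq/same_point_sym. Qed.

Lemma double_point_same p p' q q' : same_point p p' -> same_point q q' ->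
  double_point (strand L) p q -> double_point (strand L) p' q'.
Proof.
move=> pp qq [vp vq pq e]; split.
- exact: same_point_valid vp.
- exact: same_point_valid vq.
- move=> pq'; apply: pq; apply: (same_point_trans pp).
  exact/(same_point_trans pq')/same_point_sym.
- by move: e; rewrite -!/(position L _) (position_same pp) (position_same qq).
Qed.

Lemma crossing_same p p' q q' : same_point p p' -> same_point q q' ->
  crossing L p q -> crossing L p' q'.
Proof.
by move=> pp qq [d o]; split; [exact: double_point_same d|exact: over_same o].
Qed.

Lemma crossing_valid p q : crossing L p q -> valid p /\ valid q.
Proof. by case=> [[]]. Qed.

Lemma under_same p q : same_point p q -> under L p -> under L q.
Proof. by move=> pq [r rp]; exists r; apply: crossing_same rp => //; exact: same_point_refl. Qed.

Lemma crossing_not_endpoint p q :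
  crossing L p q -> ~ is_endpoint p /\ ~ is_endpoint q.
Proof.
move=> [d _]; split; first exact: endpoint_not_double d.
exact/endpoint_not_double/double_point_sym/d.
Qed.

(** Otherwise three passages would meet at one point, or each of the two passages
    at a double point would be over the other. *)
Lemma over_not_under p q : crossing L p q -> ~ under L p.
Proof.
move=> [dpq opq] [r [drp orp]].
have [rq|rq] := pselect (same_point r q).
  have := over_same drp rq (same_point_refl p) orp.
  exact: (over_asym dpq).1 opq.
apply: (no_triple_point drp dpq).
by case: dpq drp => [_ vq _ E] [vr _ _ E']; split; rewrite ?E'.
Qed.

(** Near a real number only finitely many translates of the finitely many
    reduced double points can occur. *)
Lemma under_isolated a x : exists2 e : R, 0 < e &
  forall t, 0 < `|t - x| < e -> ~ under L (a, t).
Proof.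
pose U := (fun pq : pt * pt => pq.2.2) @` [set pq : pt * pt |
    [/\ double_point (strand L) pq.1 pq.2, reduced pq.1 & reduced pq.2]].
have finU : finite_set U by apply: finite_image; exact: double_finite.
pose f := Num.floor x.
pose shifts (m : int) := (fun v => v + m%:~R) @` U.
have fin_shifts m : finite_set (shifts m) by exact: finite_image.
pose V := U `|` (shifts (f - 1)%R `|` (shifts f `|` shifts (f + 1)%R)).
have finV : finite_set V.
  by rewrite !finite_setU; split=> //; split=> //; split.
have [e e0 He] := finite_set_isolated x finV.
exists (Num.min e 1); first by rewrite lt_min e0 ltr01.
move=> t; rewrite lt_min => /and3P[t0 te t1] [p [dpt _]].
suff /He/(_ t0) : V t by rewrite leNgt te.
have [vp vt _ _] := dpt.
have [p' pp' rp'] := reduced_exists vp.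
have [[b u] tu ru] := reduced_exists vt.
have Uu : U u.
  exists (p', (b, u)) => //; split=> //; exact: double_point_same dpt.
case: tu => /= ab; rewrite -{}ab in ru Uu; case: a dpt vt ru => [i|j] dpt vt ru.
  by move->; left.
move=> [m um]; right.
have tE : t = u + (- m)%:~R by rewrite um rmorphN addrK.
have [||] : [\/ (- m = f - 1)%R, - m = f | (- m = f + 1)%R].
- have xf := floor_le_tmp x; have xf1 := floorD1_gt x.
  rewrite -/f intrD in xf xf1; move: ru t1; rewrite /reduced /= => ru.
  rewrite ltr_norml tE => t1.
  have : (f - 2 < - m)%R by rewrite -(ltr_int R) intrB; lra.
  have : (- m < f + 2)%R by rewrite -(ltr_int R) intrD; lra.
  clear; case: (ltgtP (- m) f); [constructor 1|constructor 3|constructor 2]; lia.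
- by move=> <-; left; exists u.
- by move=> <-; right; left; exists u.
- by move=> <-; right; right; exists u.
Qed.

Lemma nonunder_exists a : exists t : R, valid (a, t) /\ ~ under L (a, t).
Proof.
have [e e0 He] := under_isolated a 0; exists (Num.min e 1 / 2).
have m0 : 0 < Num.min e 1 by rewrite lt_min e0 ltr01.
have me : Num.min e 1 <= e by rewrite ge_min lexx.
have m1 : Num.min e 1 <= 1 by rewrite ge_min lexx orbT.
split; first by case: a {He} => //= i; rewrite /valid /=; lra.
apply: He; rewrite subr0 gtr0_norm; lra.
Qed.

(** ** Colorings *)

Definition under_free a s t :=
  forall u, s <= u <= t -> valid (a, u) /\ ~ under L (a, u).

(** A coloring assigns elements of a quandle to the points, not to the arcs:
    it can then be compared with a coloring of another diagram that has the
    same points but other arcs.  The values at undercrossings and at invalid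
    points are junk.  Taking any two points [s] and [t] around an undercrossing
    that have no other one between them avoids one-sided limits. *)
Record coloring (X : quandle) (c : pt -> X) : Prop := Coloring {
  color_same : forall p q, valid p -> ~ under L p -> same_point p q -> c p = c q;
  color_const : forall a s t, s <= t -> under_free a s t -> c (a, s) = c (a, t);
  color_cross : forall p q s t, crossing L p q -> s < q.2 < t ->
    (forall u, s <= u <= t ->
       valid (q.1, u) /\ (under L (q.1, u) -> u = q.2)) ->
    c (q.1, t) = qact (positive L p q) (c (q.1, s)) (c p) }.

Lemma coloring_hom (X Y : quandle) (f : X -> Y) (c : pt -> X) :
  quandle_hom f -> coloring c -> coloring (f \o c).
Proof.
move=> fM [cs cc cx]; split=> /=.
- by move=> p q vp up pq; rewrite (cs p q).
- by move=> a s t st /(cc _ _ _ st) ->.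
- by move=> p q s t pq st H; rewrite (cx p q s t) // quandle_hom_qact.
Qed.

Lemma under_free_near p : valid p -> ~ under L p -> exists2 e : R, 0 < e &
  forall t, `|t - p.2| < e -> valid (p.1, t) ->
    under_free p.1 (Num.min t p.2) (Num.max t p.2).
Proof.
case: p => a x /= vx ux; have [e e0 He] := under_isolated a x.
exists e => // t te vt u.
have vu : Num.min t x <= u <= Num.max t x -> valid (a, u).
  by case: (leP t x) => _; exact: valid_convex.
move=> uI; split; first exact: vu.
have [->//|ux'] := eqVneq u x.
apply: He; rewrite normr_gt0 subr_eq0 ux' /=.
move: uI te; rewrite !ltr_norml; case: (leP t x) => tx; lra.
Qed.

Lemma coloring_near (X : quandle) (c : pt -> X) p : coloring c ->
  valid p -> ~ under L p -> exists2 e : R, 0 < e &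
    forall t, `|t - p.2| < e -> valid (p.1, t) -> c (p.1, t) = c p.
Proof.
move=> cc vp up; have [e e0 He] := under_free_near vp up; exists e => // t te vt.
have := He t te vt; case: p {vp up He te vt} => a x /=.
by case: (leP t x) => tx H; [|apply/esym]; apply: (color_const cc) => //; exact: ltW.
Qed.

Lemma valid_near p : valid p -> ~ is_endpoint p ->
  exists2 e : R, 0 < e & forall t, `|t - p.2| < e -> valid (p.1, t).
Proof.
case: p => [[i|j] x]; last by exists 1.
rewrite /valid /is_endpoint /= => /andP[x0 x1] /not_orP[/eqP nx0 /eqP nx1].
have {}x0 : 0 < x by rewrite lt_neqAle eq_sym nx0.
have {}x1 : x < 1 by rewrite lt_neqAle nx1.
exists (Num.min x (1 - x)); first by rewrite lt_min x0 subr_gt0.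
by move=> t; rewrite lt_min !ltr_norml; lra.
Qed.

Lemma crossing_near p q : crossing L p q -> exists2 e : R, 0 < e &
  forall s t, q.2 - e < s < q.2 -> q.2 < t < q.2 + e ->
  forall u, s <= u <= t -> valid (q.1, u) /\ (under L (q.1, u) -> u = q.2).
Proof.
move=> pq; have [_ vq] := crossing_valid pq.
have [_ eq] := crossing_not_endpoint pq.
have [e e0 He] := under_isolated q.1 q.2.
have [d d0 Hd] := valid_near vq eq.
exists (Num.min e d); first by rewrite lt_min e0.
have me : Num.min e d <= e by rewrite ge_min lexx.
have md : Num.min e d <= d by rewrite ge_min lexx orbT.
move=> s t sq qt u su; split; first by apply: Hd; rewrite ltr_norml; lra.
move=> uu; apply/eqP; apply: contrapT => /negP uq; apply: He uu.
by rewrite normr_gt0 subr_eq0 uq ltr_norml /=; lra.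
Qed.

(** By connectedness of intervals, local conditions suffice.  This is the form
    in which pieces of two colorings can be glued. *)
Lemma coloring_local (X : quandle) (c : pt -> X) :
  (forall p q, valid p -> ~ under L p -> same_point p q -> c p = c q) ->
  (forall p, valid p -> ~ under L p -> exists2 e : R, 0 < e &
     forall t, `|t - p.2| < e -> valid (p.1, t) -> c (p.1, t) = c p) ->
  (forall p q, crossing L p q -> exists2 e : R, 0 < e &
     forall s t, q.2 - e < s < q.2 -> q.2 < t < q.2 + e ->
       c (q.1, t) = qact (positive L p q) (c (q.1, s)) (c p)) ->
  coloring c.
Proof.
move=> cs cl cx.
have cc a s t : s <= t -> under_free a s t -> c (a, s) = c (a, t).
  move=> st H; apply: (@locally_constant _ _ (fun t => c (a, t))) => // u uI.
  have [vu uu] := H u uI; have [e e0 He] := cl _ vu uu.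
  by exists e => // v ve vI; apply: He => //; have [] := H v vI.
split=> // p q s t pq /andP[sq qt] H.
have [e e0 He] := cx _ _ pq.
pose s' := Num.max s (q.2 - e / 2); pose t' := Num.min t (q.2 + e / 2).
have ss : s <= s' by rewrite le_max lexx.
have es : q.2 - e / 2 <= s' by rewrite le_max lexx orbT.
have sq' : s' < q.2 by rewrite gt_max sq /=; lra.
have tt : t' <= t by rewrite ge_min lexx.
have te : t' <= q.2 + e / 2 by rewrite ge_min lexx orbT.
have tq' : q.2 < t' by rewrite lt_min qt /=; lra.
have -> : c (q.1, s) = c (q.1, s').
  apply: cc => // u uI; have [|vu uu] := H u; first by lra.
  by split=> // /uu; lra.
have <- : c (q.1, t') = c (q.1, t).
  apply: cc => // u uI; have [|vu uu] := H u; first by lra.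
  by split=> // /uu; lra.
by apply: He; lra.
Qed.

End Points.

(** * Colorings are homomorphisms from the fundamental quandle *)

Lemma min_max_between (R : realType) (x y u : R) :
  Num.min x y <= u <= Num.max x y <-> x <= u <= y \/ y <= u <= x.
Proof. by case: (leP x y) => xy; split; [left|case|right|case] => //; lra. Qed.

Section ArcColorings.
Variables (R : realType) (n k : nat) (L : diagram R n k).
Local Notation pt := (source_pt R n k).
Local Notation Q := (fundamental_quandle L).
Implicit Types (p q r : pt) (a : component n k) (s t : R) (b : diag_arc L).

Lemma arc_of_sub p q : p.1 = q.1 ->
  (forall u, Num.min p.2 q.2 <= u <= Num.max p.2 q.2 -> ~ under L (p.1, u)) ->
  arc_of L p `<=` arc_of L q.
Proof.
case: p q => [a s] [b t] /= <- H z [z' [zz' vz' /= az' Hz']].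
exists z'; split=> //= u /min_max_between uI.
have [us|us] := leP u s; have [uz|uz] := leP u z'.2.
- case: uI => uI; last by apply: Hz'; apply/min_max_between; right; lra.
  by apply: H; apply/min_max_between; right; lra.
- by apply: Hz'; apply/min_max_between; right; lra.
- by apply: Hz'; apply/min_max_between; left; lra.
- case: uI => uI; last by apply: H; apply/min_max_between; left; lra.
  by move: uI; lra.
Qed.

Lemma arc_of_under_free a s t : s <= t -> under_free L a s t ->
  arc_of L (a, s) = arc_of L (a, t).
Proof.
move=> st H; apply/seteqP; split; apply: arc_of_sub => //= u.
- by move=> /min_max_between uI; have [|//] := H u; case: uI; lra.
- by move=> /min_max_between uI; have [|//] := H u; case: uI; lra.
Qed.

Lemma arc_of_same_sub p q : same_point p q -> arc_of L p `<=` arc_of L q.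
Proof.
move=> pq z [z' [zz' vz' pz' H]].
have pq1 := same_point_comp pq.
have shift u := same_point_shift pq u.
have zS : same_point z' (q.1, z'.2 - p.2 + q.2).
  by rewrite [z']surjective_pairing -pz'; exact: shift.
exists (q.1, z'.2 - p.2 + q.2); split=> //.
- exact: same_point_trans zS.
- exact: same_point_valid vz'.
move=> u /min_max_between /= uI uu.
apply: (H (u - q.2 + p.2)).
  by apply/min_max_between; case: uI => ?; [left|right]; lra.
apply: under_same uu; apply/same_point_sym.
have := shift (u - q.2 + p.2).
by congr (same_point _ (_, _)); ring.
Qed.

Lemma arc_of_same p q : same_point p q -> arc_of L p = arc_of L q.
Proof.
move=> pq; apply/seteqP; split; apply: arc_of_same_sub => //.
exact: same_point_sym.
Qed.

Lemma arc_of_self p : valid p -> ~ under L p -> arc_of L p p.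
Proof.
move=> vp up; exists p; split=> //; first exact: same_point_refl.
by case: p vp up => a s _ up t; rewrite minxx maxxx -eq_le => /eqP <-.
Qed.

Definition arc_through p (vp : valid p) (up : ~ under L p) : diag_arc L :=
  exist _ (arc_of L p) (ex_intro _ p (And3 vp up erefl)).

Lemma diag_arc_eq b b' : sval b = sval b' -> b = b'.
Proof. by case: b b' => [x Hx] [y Hy] /= xy; exact/eq_exist. Qed.

(** The universal coloring.  The quandle of an empty diagram has no elements, so
    the junk value at an undercrossing is a generator from its component. *)
Definition arc_coloring p : Q :=
  match pselect (valid p /\ ~ under L p) with
  | left h => generator (arc_through h.1 h.2)
  | right _ =>
      let h := svalP (cid (nonunder_exists L p.1)) in
      generator (arc_through h.1 h.2)
  end.

Lemma arc_coloringE p b : valid p -> ~ under L p -> sval b = arc_of L p ->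
  arc_coloring p = generator b.
Proof.
move=> vp up E; rewrite /arc_coloring; case: pselect => [h|[]//].
by congr generator; apply: diag_arc_eq.
Qed.

Lemma arc_coloring_eq p q : valid p -> ~ under L p -> valid q -> ~ under L q ->
  arc_of L p = arc_of L q -> arc_coloring p = arc_coloring q.
Proof.
move=> vp up vq uq E.
by rewrite (@arc_coloringE p (arc_through vq uq)) // (@arc_coloringE q (arc_through vq uq)).
Qed.

Lemma arc_coloringP : coloring L arc_coloring.
Proof.
apply: coloring_local.
- move=> p q vp up pq; apply: arc_coloring_eq => //.
  + exact: same_point_valid vp.
  + by move=> /(under_same (same_point_sym pq)).
  + exact: arc_of_same.
- move=> p vp up; have [e e0 He] := under_free_near vp up; exists e => // t te vt.
  have := He t te vt; case: p vp up te vt {He} => a x /= vx ux te vt.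
  case: (leP t x) => tx H; [|apply/esym];
    (apply: arc_coloring_eq; try apply: arc_of_under_free) => //; try exact: ltW.
  + by have [|] := H t; rewrite ?lexx.
  + by have [|] := H t; rewrite ?lexx ?(ltW tx).
- move=> p q pq; have [e e0 He] := crossing_near pq; exists e => // s t sq qt.
  have [vp vq] := crossing_valid pq; have up := over_not_under pq.
  have H := He s t sq qt.
  have [|vs us0] := H s; first by lra.
  have [|vt ut0] := H t; first by lra.
  have us : ~ under L (q.1, s) by move/us0 => ?; lra.
  have ut : ~ under L (q.1, t) by move/ut0 => ?; lra.
  rewrite (@arc_coloringE (q.1, s) (arc_through vs us)) //.
  rewrite (@arc_coloringE (q.1, t) (arc_through vt ut)) //.
  rewrite (@arc_coloringE p (arc_through vp up)) //.
  transitivity (qclass (crossing_relation (L := L))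
    (if positive L p q then Op (Gen (arc_through vs us)) (Gen (arc_through vp up))
     else OpInv (Gen (arc_through vs us)) (Gen (arc_through vp up)))).
    apply: qclass_rel; exists p, q, (arc_through vs us), (arc_through vp up),
      (arc_through vt ut); split=> //.
    + exact: arc_of_self.
    + apply/at_left_ball; exists e => // u uq /=.
      have [|vu uu0] := He u t uq qt u; first by lra.
      have uu : ~ under L (q.1, u) by move/uu0 => ?; lra.
      have clr x y : q.2 - e < x -> y < q.2 -> under_free L q.1 x y.
        move=> ex yq w wI; have wq : q.2 - e < w < q.2 by lra.
        have [|vw uw] := He w t wq qt w; first by lra.
        by split=> // /uw; lra.
      suff -> : arc_of L (q.1, s) = arc_of L (q.1, u) by exact: arc_of_self.
      case: (leP s u) => su; [|apply/esym]; (apply: arc_of_under_free; [|apply: clr]); lra.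
    + apply/at_right_ball; exists e => // u uq /=.
      have [|vu uu0] := He s u sq uq u; first by lra.
      have uu : ~ under L (q.1, u) by move/uu0 => ?; lra.
      have clr x y : q.2 < x -> y < q.2 + e -> under_free L q.1 x y.
        move=> ex yq w wI; have wq : q.2 < w < q.2 + e by lra.
        have [|vw uw] := He s w sq wq w; first by lra.
        by split=> // /uw; lra.
      suff -> : arc_of L (q.1, t) = arc_of L (q.1, u) by exact: arc_of_self.
      case: (leP t u) => su; [|apply/esym]; (apply: arc_of_under_free; [|apply: clr]); lra.
  by case: positive; [exact: qclass_Op|exact: qclass_OpInv].
Qed.

Section Induced.
Variables (X : quandle) (c : pt -> X).
Hypothesis colc : coloring L c.

Definition color_of_arc b : X := c (sval (cid (svalP b))).

(** An arc is connected, so the color does not depend on the chosen point. *)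
Lemma color_of_arcE b p : valid p -> ~ under L p -> sval b p ->
  color_of_arc b = c p.
Proof.
rewrite /color_of_arc; case: cid => q /= [vq uq ->] vp up [p' [pp' vp' qp' H]].
rewrite (color_same colc vp up pp').
case: q p' {pp'} vq uq vp' qp' H => [a s] [a' t] /= vs us vt ea H; subst a'.
case: (leP s t) H => st H.
  apply: (color_const colc st) => u uI; split; last exact: H.
  exact: valid_convex vs vt uI.
apply/esym/(color_const colc (ltW st)) => u uI; split; last exact: H.
exact: valid_convex vt vs uI.
Qed.

Lemma color_of_arc_rel u v : crossing_relation u v ->
  word_eval color_of_arc u = word_eval color_of_arc v.
Proof.
move=> [p [q [x [y [z [pq yp xq zq [-> ->]]]]]]].
have [e e0 He] := crossing_near pq.
have [d d0 Hd] := (at_left_ball _ _).1 xq.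
have [f f0 Hf] := (at_right_ball _ _).1 zq.
pose m := Num.min e (Num.min d f) / 2.
have m0 : 0 < Num.min e (Num.min d f) by rewrite !lt_min e0 d0.
have me : Num.min e (Num.min d f) <= e by rewrite ge_min lexx.
have md : Num.min e (Num.min d f) <= d by rewrite !ge_min lexx orbT.
have mf : Num.min e (Num.min d f) <= f by rewrite !ge_min lexx !orbT.
have [vp vq] := crossing_valid pq; have up := over_not_under pq.
have H := He (q.2 - m) (q.2 + m) ltac:(rewrite /m; lra) ltac:(rewrite /m; lra).
have [|vs us0] := H (q.2 - m); first by rewrite /m; lra.
have [|vt ut0] := H (q.2 + m); first by rewrite /m; lra.
have us : ~ under L (q.1, q.2 - m) by move/us0; rewrite /m => ?; lra.
have ut : ~ under L (q.1, q.2 + m) by move/ut0; rewrite /m => ?; lra.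
have cx := @color_of_arcE x _ vs us ltac:(apply: Hd; rewrite /m; lra).
have cz := @color_of_arcE z _ vt ut ltac:(apply: Hf; rewrite /m; lra).
have cy := @color_of_arcE y _ vp up yp.
have := color_cross colc pq _ H; rewrite -cx -cy -cz /= => ->; last by rewrite /m; lra.
by case: positive.
Qed.

Definition coloring_lift : Q -> X := presented_lift color_of_arc.

Lemma coloring_lift_hom : quandle_hom coloring_lift.
Proof. exact/presented_lift_hom/color_of_arc_rel. Qed.

Lemma coloring_lift_gen b : coloring_lift (generator b) = color_of_arc b.
Proof. exact/presented_lift_class/color_of_arc_rel. Qed.

Lemma coloring_liftE p : valid p -> ~ under L p ->
  coloring_lift (arc_coloring p) = c p.
Proof.
move=> vp up; rewrite (@arc_coloringE p (arc_through vp up)) // coloring_lift_gen.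
exact/color_of_arcE/arc_of_self.
Qed.

End Induced.

Lemma arc_generator b : exists p, [/\ valid p, ~ under L p &
  generator b = arc_coloring p].
Proof.
case: (svalP b) => p [vp up E]; exists p; split=> //.
by rewrite (@arc_coloringE p b).
Qed.

Lemma coloring_lift_id (f : Q -> Q) : quandle_hom f ->
  (forall p, valid p -> ~ under L p -> f (arc_coloring p) = arc_coloring p) ->
  f =1 id.
Proof.
move=> fM fid; apply: (presented_hom_unique fM) => // b.
by have [p [vp up E]] := arc_generator b; rewrite -/(generator b) E; exact: fid.
Qed.

Lemma endpoint_valid p : is_endpoint p -> valid p /\ ~ under L p.
Proof.
move=> ep; split; last by move=> [q /crossing_not_endpoint[_]].
case: p ep => [[i|j] t]; rewrite /is_endpoint /valid //= => -[] ->;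
  by rewrite ?lexx ?ler01.
Qed.

Lemma basepoint_coloring (j : 'I_n.*2) :
  basepoint (fundamental_pointed_quandle L) j =
  arc_coloring (inl (Ordinal (half_ord_proof j)), (odd j)%:R).
Proof.
rewrite /=; case: (odd j) => /=;
  [have [vp up] := @endpoint_valid (inl (Ordinal (half_ord_proof j)), 1) (or_intror erefl)
  |have [vp up] := @endpoint_valid (inl (Ordinal (half_ord_proof j)), 0) (or_introl erefl)];
  by apply/esym/arc_coloringE.
Qed.

End ArcColorings.

(** Two diagrams have isomorphic quandles as soon as their colorings correspond
    one to one, naturally in the quandle of colors (Yoneda's argument: each
    quandle receives the coloring that corresponds to the universal coloring of
    the other diagram).  The correspondence is expressed by a relation [S]
    between points that have to receive equal colors; naturality is then
    automatic. *)
Lemma iso_by_transfer (R : realType) (n k : nat) (L L' : diagram R n k)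
    (S : source_pt R n k -> source_pt R n k -> Prop) :
  (forall p, is_endpoint p -> S p p) ->
  (forall p p', S p p' ->
     [/\ valid p, ~ under L p, valid p' & ~ under L' p']) ->
  (forall (X : quandle) (c : source_pt R n k -> X), coloring L c ->
     exists2 c', coloring L' c' & forall p p', S p p' -> c p = c' p') ->
  (forall (X : quandle) (c' : source_pt R n k -> X), coloring L' c' ->
     exists2 c, coloring L c & forall p p', S p p' -> c p = c' p') ->
  (forall (X : quandle) (c d : source_pt R n k -> X),
     coloring L c -> coloring L d -> (forall p p', S p p' -> c p = d p) ->
     forall p, valid p -> ~ under L p -> c p = d p) ->
  (forall (X : quandle) (c d : source_pt R n k -> X),
     coloring L' c -> coloring L' d -> (forall p p', S p p' -> c p' = d p') ->
     forall p, valid p -> ~ under L' p -> c p = d p) ->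
  pointed_isomorphic (fundamental_pointed_quandle L)
    (fundamental_pointed_quandle L').
Proof.
move=> Send Sv T T' U U'.
have [c colc Sc] := T' _ _ (arc_coloringP L').
have [c' colc' Sc'] := T _ _ (arc_coloringP L).
pose f := coloring_lift (L := L) c; pose g := coloring_lift (L := L') c'.
have fM : quandle_hom f by exact: coloring_lift_hom.
have gM : quandle_hom g by exact: coloring_lift_hom.
exists f; split.
  split=> [|j]; first exact: coloring_lift_hom.
  rewrite !basepoint_coloring.
  set p := (_, _); have ep : is_endpoint p.
    by rewrite /p; case: (odd j); [right|left].
  have [vp up] := @endpoint_valid _ _ _ L p ep.
  by rewrite /f (coloring_liftE colc) //; apply/Sc/Send.
exists g.
- apply: (@coloring_lift_id _ _ _ L (g \o f)).
    by move=> x y /=; rewrite fM gM.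
  move=> p vp up /=; rewrite /f (coloring_liftE colc) //.
  apply: (U _ (g \o c)) => //.
  + exact: coloring_hom.
  + exact: arc_coloringP.
  + move=> q q' qq' /=; have [_ _ vq uq] := Sv _ _ qq'.
    by rewrite (Sc _ _ qq') /g (coloring_liftE colc') // (Sc' _ _ qq').
- apply: (@coloring_lift_id _ _ _ L' (f \o g)).
    by move=> x y /=; rewrite gM fM.
  move=> p vp up /=; rewrite /g (coloring_liftE colc') //.
  apply: (U' _ (f \o c')) => //.
  + exact: coloring_hom.
  + exact: arc_coloringP.
  + move=> q q' qq' /=; have [vq uq _ _] := Sv _ _ qq'.
    by rewrite -(Sc' _ _ qq') /f (coloring_liftE colc) // (Sc _ _ qq').
Qed.

(** * Calculus on the sphere *)

Section Coordinates.
Variable R : realType.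

Definition coord m (u : 'rV[R]_m.+1) (i : nat) : R := u 0 (inord i).

Lemma coordE m (u : 'rV[R]_m.+1) i : u 0 i = coord u i.
Proof. by rewrite /coord inord_val. Qed.

Lemma tripleE (u v w : 'rV[R]_3) : triple u v w =
  coord u 0 * (coord v 1 * coord w 2 - coord v 2 * coord w 1)
  - coord u 1 * (coord v 0 * coord w 2 - coord v 2 * coord w 0)
  + coord u 2 * (coord v 0 * coord w 1 - coord v 1 * coord w 0).
Proof.
rewrite /triple (expand_det_row _ 0) !big_ord_recl big_ord0 /cofactor.
rewrite !(expand_det_row _ 0) !big_ord_recl !big_ord0 /cofactor !det_mx11 !mxE /=.
rewrite !coordE /= /bump /=; ring.
Qed.

Lemma dotE3 (u v : 'rV[R]_3) : dot u v =
  coord u 0 * coord v 0 + coord u 1 * coord v 1 + coord u 2 * coord v 2.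
Proof. by rewrite /dot !big_ord_recl big_ord0 !coordE /= /bump /= addr0 !addrA. Qed.

Lemma dotE2 (u v : 'rV[R]_2) : dot u v =
  coord u 0 * coord v 0 + coord u 1 * coord v 1.
Proof. by rewrite /dot !big_ord_recl big_ord0 !coordE /= /bump /= addr0. Qed.

Lemma coord_vec2_0 (x y : R) : coord (vec2 x y) 0 = x.
Proof. by rewrite /coord mxE /= inordK. Qed.

Lemma coord_vec2_1 (x y : R) : coord (vec2 x y) 1 = y.
Proof. by rewrite /coord mxE /= inordK. Qed.

Lemma coordD m (u v : 'rV[R]_m.+1) i : coord (u + v) i = coord u i + coord v i.
Proof. by rewrite /coord mxE. Qed.

Lemma coordZ m a (u : 'rV[R]_m.+1) i : coord (a *: u) i = a * coord u i.
Proof. by rewrite /coord mxE. Qed.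

Lemma coordB m (u v : 'rV[R]_m.+1) i : coord (u - v) i = coord u i - coord v i.
Proof. by rewrite /coord !mxE. Qed.

Lemma coord_eq3 (u v : 'rV[R]_3) : coord u 0 = coord v 0 ->
  coord u 1 = coord v 1 -> coord u 2 = coord v 2 -> u = v.
Proof.
move=> e0 e1 e2; apply/rowP => i; rewrite !coordE.
by case: i => -[|[|[|]]].
Qed.

Lemma triple_congr (u u' v v' w w' : 'rV[R]_3) :
  u = u' -> v = v' -> w = w' -> triple u v w = triple u' v' w'.
Proof. by move=> -> -> ->. Qed.

Lemma triple_comb (a b c d : R) (e f x : 'rV[R]_3) :
  triple (a *: e + b *: f) (c *: e + d *: f) x = (a * d - b * c) * triple e f x.
Proof. rewrite !tripleE !coordD !coordZ; ring. Qed.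

(** If [a] and [b] are tangent to the sphere at [y], their cross product is the
    multiple [triple a b y *: y] of [y]; when that vanishes, so does
    (a x b) x a, which is the difference of the two sides. *)
Lemma tangent_dependent (a b y : 'rV[R]_3) :
  dot y y = 1 -> dot a y = 0 -> dot b y = 0 -> triple a b y = 0 ->
  dot a a *: b = dot a b *: a.
Proof.
move=> yy ay by_ T.
pose A := dot a y; pose B := dot b y; pose N := dot y y; pose U := triple a b y.
have c0 : coord a 1 * coord b 2 - coord a 2 * coord b 1 = 0.
  rewrite -[LHS]mulr1 -yy; transitivity (U * coord y 0
    + coord y 1 * (A * coord b 2 - B * coord a 2)
    - coord y 2 * (A * coord b 1 - B * coord a 1)).
    by rewrite /U /A /B tripleE !dotE3; ring.
  by rewrite /U /A /B T ay by_; ring.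
have c1 : coord a 2 * coord b 0 - coord a 0 * coord b 2 = 0.
  rewrite -[LHS]mulr1 -yy; transitivity (U * coord y 1
    + coord y 2 * (A * coord b 0 - B * coord a 0)
    - coord y 0 * (A * coord b 2 - B * coord a 2)).
    by rewrite /U /A /B tripleE !dotE3; ring.
  by rewrite /U /A /B T ay by_; ring.
have c2 : coord a 0 * coord b 1 - coord a 1 * coord b 0 = 0.
  rewrite -[LHS]mulr1 -yy; transitivity (U * coord y 2
    + coord y 0 * (A * coord b 1 - B * coord a 1)
    - coord y 1 * (A * coord b 0 - B * coord a 0)).
    by rewrite /U /A /B tripleE !dotE3; ring.
  by rewrite /U /A /B T ay by_; ring.
have z x y' z' : x - y' = z' -> z' = 0 -> x = y' :> R.
  by move=> <- /eqP; rewrite subr_eq0 => /eqP.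
apply: coord_eq3; rewrite !coordZ !dotE3; apply: z; try reflexivity.
- transitivity ((coord a 2 * coord b 0 - coord a 0 * coord b 2) * coord a 2
    - (coord a 0 * coord b 1 - coord a 1 * coord b 0) * coord a 1); first by ring.
  by rewrite c1 c2; ring.
- transitivity ((coord a 0 * coord b 1 - coord a 1 * coord b 0) * coord a 0
    - (coord a 1 * coord b 2 - coord a 2 * coord b 1) * coord a 2); first by ring.
  by rewrite c2 c0; ring.
- transitivity ((coord a 1 * coord b 2 - coord a 2 * coord b 1) * coord a 1
    - (coord a 2 * coord b 0 - coord a 0 * coord b 2) * coord a 0); first by ring.
  by rewrite c0 c1; ring.
Qed.

Lemma dot_self_eq0 (a : 'rV[R]_3) : dot a a = 0 -> a = 0.
Proof.
rewrite dotE3 -!expr2 => /eqP.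
rewrite !paddr_eq0 ?addr_ge0 ?sqr_ge0 // !sqrf_eq0.
move=> /andP[/andP[/eqP e0 /eqP e1] /eqP e2].
by apply: coord_eq3; rewrite ?e0 ?e1 ?e2 /coord mxE.
Qed.

(** If the images of [u] and [v] were dependent, a combination of [u] and [v]
    would be a nonzero tangent vector with image 0. *)
Lemma tangent_map_nondegenerate (f : 'rV[R]_3 -> 'rV[R]_3) (x y u v : 'rV[R]_3) :
  (forall a b, f (a *: v - b *: u) = a *: f v - b *: f u) ->
  (forall w, dot w x = 0 -> w != 0 -> f w != 0) ->
  dot u x = 0 -> dot v x = 0 -> triple u v x != 0 ->
  dot y y = 1 -> dot (f u) y = 0 -> dot (f v) y = 0 ->
  triple (f u) (f v) y != 0.
Proof.
move=> fcomb finj ux vx T0 yy fuy fvy; apply/eqP => fT.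
have dep := tangent_dependent yy fuy fvy fT.
pose w := dot (f u) (f u) *: v - dot (f u) (f v) *: u.
have fw : f w = 0 by rewrite /w fcomb dep subrr.
have dotBZ a b : dot (a *: v - b *: u) x = a * dot v x - b * dot u x.
  by rewrite !dotE3 !coordB !coordZ; ring.
have wx : dot w x = 0 by rewrite /w dotBZ ux vx !mulr0 subrr.
have w0 : w = 0.
  by apply/eqP; apply: contrapT => /negP w0; have := finj w wx w0; rewrite fw eqxx.
have u0 : u != 0.
  by apply/eqP => u0; move: T0; rewrite u0 tripleE /coord !mxE !mul0r subrr addr0 eqxx.
have fu0 : dot (f u) (f u) != 0.
  by apply/eqP => /dot_self_eq0 fu0; have := finj u ux u0; rewrite fu0 eqxx.
have tripleBZ a b : triple u (a *: v - b *: u) x = a * triple u v x.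
  by rewrite !tripleE !coordB !coordZ; ring.
have : dot (f u) (f u) * triple u v x = 0.
  by rewrite -(tripleBZ _ (dot (f u) (f v))) -/w w0 tripleE /coord !mxE; ring.
by move/eqP; rewrite mulf_eq0 (negPf fu0) (negPf T0).
Qed.

End Coordinates.

Section Calculus.
Variable R : realType.

Lemma derive1_near (W : normedModType R) (f g : R -> W) t e : 0 < e ->
  (forall s, `|s - t| < e -> f s = g s) -> f^`()%classic t = g^`()%classic t.
Proof.
move=> e0 H; rewrite !derive1E; apply: near_eq_derive.
apply/nbhs_ballP; exists e => //= s; rewrite /ball /= distrC; exact: H.
Qed.

Lemma derive1_chain (V W : normedModType R) (F : V -> W) (g : R -> V) t :
  differentiable F (g t) -> derivable g t 1 ->
  (F \o g)^`()%classic t = 'D_(g^`()%classic t) F (g t).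
Proof.
move=> dF /derivable1_diffP dg; rewrite derive1E'; last exact: differentiable_comp.
by rewrite diff_comp //= deriveE // derive1E'.
Qed.

Lemma derive_snd_comb (V W U : normedModType R) (F : (V * W)%type -> U) z a b v u :
  differentiable F z ->
  'D_((0 : V), a *: v - b *: u) F z = a *: 'D_((0 : V), v) F z - b *: 'D_((0 : V), u) F z.
Proof.
move=> dF; rewrite !deriveE //.
have -> : ((0 : V), a *: v - b *: u) =
    a *: (((0 : V), v) : (V * W)%type) - b *: (((0 : V), u) : (V * W)%type).
  by congr (_, _); rewrite /= !scaler0 subr0.
by rewrite linearB !linearZ.
Qed.

Lemma coord_derive (V : normedModType R) m (f : V -> 'rV[R]_m.+1) x v i :
  derivable f x v -> derivable (fun y => coord (f y) i) x v /\
  'D_v (fun y => coord (f y) i) x = coord ('D_v f x) i.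
Proof.
move=> df; split; first exact: ((derivable_mxP f x v).1 df 0 (inord i)).
by rewrite derive_mx // /coord mxE.
Qed.

Definition sphere_curve (g : R -> 'rV[R]_3) t :=
  derivable g t 1 /\ exists2 e, 0 < e & forall s, `|s - t| < e -> on_sphere (g s).

Lemma sphere_curve_at g t : sphere_curve g t -> on_sphere (g t).
Proof. by move=> [_ [e e0]]; apply; rewrite subrr normr0. Qed.

Lemma sphere_curve_tangent g t : sphere_curve g t -> dot (g^`()%classic t) (g t) = 0.
Proof.
move=> [dg [e e0 H]].
pose c i s : R := coord (g s) i.
have dc i : is_derive t 1 (c i) (coord (g^`()%classic t) i).
  have [d E] := @coord_derive R^o _ _ _ _ i dg; apply: DeriveDef => //.
  by rewrite derive1E.
pose f := c 0 * c 0 + c 1 * c 1 + c 2 * c 2.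
have df := is_deriveD (is_deriveD (is_deriveM (dc 0) (dc 0))
  (is_deriveM (dc 1) (dc 1))) (is_deriveM (dc 2) (dc 2)).
have : f^`()%classic t = (cst 1 : R -> R)^`()%classic t.
  by apply: (derive1_near e0) => s /H; rewrite /on_sphere dotE3.
rewrite derive1_cst derive1E /f (derive_val (is_derive := df)).
rewrite dotE3 /c /GRing.scale /=; lra.
Qed.

Lemma smooth_differentiable (V W : normedModType R) (f : V -> W) x :
  smooth f -> differentiable f x.
Proof. by move=> sf; exact: (sf [::]). Qed.

Lemma smooth_derivable (W : normedModType R) (f : R -> W) t :
  smooth (f : R^o -> W) -> derivable f t 1.
Proof. by move=> sf; apply/derivable1_diffP/smooth_differentiable. Qed.

Lemma smooth_continuous (f : R -> R) (A : set R) :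
  smooth (f : R^o -> R^o) -> {within A, continuous f}.
Proof.
move=> sf; apply: continuous_subspaceT => t.
exact/differentiable_continuous/smooth_differentiable.
Qed.

Lemma smooth_increasing (f : R -> R) a b : smooth (f : R^o -> R^o) ->
  (forall t, a <= t <= b -> 0 < f^`()%classic t) ->
  forall s t, a <= s -> s < t -> t <= b -> f s < f t.
Proof.
move=> sf fp s t as_ st tb; apply: (@gtr0_derive1_lt_cc _ f a b) => //.
- by move=> x _; exact: smooth_derivable.
- by move=> x; rewrite in_itv /= => /andP[ax xb]; apply: fp; rewrite !ltW.
- exact: smooth_continuous.
- by rewrite in_itv /=; lra.
- by rewrite in_itv /=; lra.
Qed.

Lemma smooth_ivt (f : R -> R) a b v : smooth (f : R^o -> R^o) -> a <= b ->
  f a <= v <= f b -> exists2 c, a <= c <= b & f c = v.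
Proof.
move=> sf ab /andP[av vb]; have [||c] := @IVT _ f a b v ab; first exact: smooth_continuous.
  by rewrite ge_min av le_max vb orbT.
by rewrite in_itv /= => cI <-; exists c.
Qed.

Section Isotopy.
Variable Phi : R^o * 'rV[R]_3 -> 'rV[R]_3.
Hypothesis isoPhi : ambient_isotopy Phi.

Let sPhi : smooth Phi. Proof. by case: isoPhi. Qed.

Let dPhi z : differentiable Phi z. Proof. exact: smooth_differentiable. Qed.

Lemma isotopy_slice (tau : R) x u :
  'D_u (fun y => Phi (tau, y)) x = 'D_((0 : R^o), u) Phi (tau, x).
Proof.
rewrite /derive; set f1 := (fun h : R => _); set f2 := (fun h : R => _).
suff -> : f1 = f2 by []; apply/funext => h; rewrite /f1 /f2 /=.
suff -> : h *: ((0 : R^o), u) + ((tau : R^o), x) = ((tau : R^o), h *: u + x) by [].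
by congr (_, _); rewrite /= scaler0 add0r.
Qed.

Lemma isotopy_curve (tau : R) (g : R -> 'rV[R]_3) t : derivable g t 1 ->
  (fun s => Phi (tau, g s))^`()%classic t = 'D_((0 : R^o), g^`()%classic t) Phi (tau, g t).
Proof.
move=> dg; have dg' := (derivable1_diffP _ _).1 dg.
pose h (s : R^o) : R^o * 'rV[R]_3 := (tau : R^o, g s).
have dh : differentiable h t by apply: differentiable_pair => //; exact: differentiable_cst.
have hE : h^`()%classic t = ((0 : R^o), g^`()%classic t).
  by rewrite derive1E' // diff_pair // diff_cst -derive1E'.
rewrite -hE; exact: (derive1_chain (dPhi (h t)) ((derivable1_diffP h t).2 dh)).
Qed.

Lemma isotopy_sphere_curve (tau : R) g t : 0 <= tau <= 1 ->
  sphere_curve g t -> sphere_curve (fun s => Phi (tau, g s)) t.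
Proof.
move=> tauI [dg [e e0 H]]; have dg' := (derivable1_diffP _ _).1 dg; split.
  apply/derivable1_diffP.
  pose h (s : R^o) : R^o * 'rV[R]_3 := (tau : R^o, g s).
  have dh : differentiable h t by apply: differentiable_pair => //; exact: differentiable_cst.
  exact: (@differentiable_comp _ _ _ _ h Phi).
exists e => // s /H gs; case: isoPhi => _ _ /(_ tau tauI)[fPhi _ _] _.
exact: fPhi.
Qed.

(** The tangent frame of two transverse curves, transported to time [tau],
    stays a frame: its orientation is a continuous nonvanishing function of
    [tau], so its sign at time 1 is the one at time 0. *)
Lemma isotopy_orientation g s d t : sphere_curve g s -> sphere_curve d t ->
  g s = d t -> triple (g^`()%classic s) (d^`()%classic t) (g s) != 0 ->
  (0 < triple ((fun r => Phi (1, g r))^`()%classic s)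
     ((fun r => Phi (1, d r))^`()%classic t) (Phi (1, g s)))
  = (0 < triple (g^`()%classic s) (d^`()%classic t) (g s)).
Proof.
move=> cg cd gd; set u := g^`()%classic s; set v := d^`()%classic t; set x := g s => T0.
have [dg _] := cg; have [dd _] := cd.
have ux : dot u x = 0 by exact: sphere_curve_tangent.
have vx : dot v x = 0 by rewrite /x gd; exact: sphere_curve_tangent.
have xS : on_sphere x by exact: sphere_curve_at cg.
pose D w tau := 'D_((0 : R^o), w) Phi ((tau : R^o), x).
pose f (tau : R) := triple (D u tau) (D v tau) (Phi (tau, x)).
have Du tau : (fun r => Phi (tau, g r))^`()%classic s = D u tau by exact: isotopy_curve.
have Dv tau : (fun r => Phi (tau, d r))^`()%classic t = D v tau.
  by rewrite isotopy_curve // -gd.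
have cf : continuous f.
  have cpair : continuous (fun tau : R => ((tau : R^o), x)).
    move=> tau; apply: differentiable_continuous.
    by apply: (@differentiable_pair _ R^o R^o _ id (cst x)).
  have cD w i : continuous (fun tau : R => coord (D w tau) i).
    move=> tau; apply: (@continuous_comp _ _ _ (fun tau : R => D w tau)
      (fun M : 'rV[R]_3 => M 0 (inord i))); last exact: coord_continuous.
    apply: (@continuous_comp _ _ _ (fun tau : R => ((tau : R^o), x))
      (fun z => 'D_((0 : R^o), w) Phi z)); first exact: cpair.
    exact/differentiable_continuous/(sPhi [:: ((0 : R^o), w)]).
  have cP i : continuous (fun tau : R => coord (Phi (tau, x)) i).
    move=> tau; apply: (@continuous_comp _ _ _ (fun tau : R => Phi (tau, x))
      (fun M : 'rV[R]_3 => M 0 (inord i))); last exact: coord_continuous.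
    apply: (@continuous_comp _ _ _ (fun tau : R => ((tau : R^o), x)) Phi); first exact: cpair.
    exact/differentiable_continuous/dPhi.
  have -> : f = fun tau =>
      coord (D u tau) 0 * (coord (D v tau) 1 * coord (Phi (tau, x)) 2
        - coord (D v tau) 2 * coord (Phi (tau, x)) 1)
      - coord (D u tau) 1 * (coord (D v tau) 0 * coord (Phi (tau, x)) 2
        - coord (D v tau) 2 * coord (Phi (tau, x)) 0)
      + coord (D u tau) 2 * (coord (D v tau) 0 * coord (Phi (tau, x)) 1
        - coord (D v tau) 1 * coord (Phi (tau, x)) 0).
    by apply/funext => tau; rewrite /f tripleE.
  move=> tau.
  have minor i j : coord (D v r) i * coord (Phi (r, x)) j
      - coord (D v r) j * coord (Phi (r, x)) i @[r --> tau] -->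
      coord (D v tau) i * coord (Phi (tau, x)) j
      - coord (D v tau) j * coord (Phi (tau, x)) i.
    by apply: cvgB; apply: cvgM; by [exact: cD|exact: cP].
  apply: cvgD; first apply: cvgB; (apply: cvgM; [exact: cD|exact: minor]).
have fN0 tau : 0 <= tau <= 1 -> f tau != 0.
  move=> tauI; apply/eqP => f0.
  have [_ _ _ inj] := isoPhi.
  have cg' := isotopy_sphere_curve tauI cg; have cd' := isotopy_sphere_curve tauI cd.
  have := sphere_curve_tangent cg'; rewrite Du => Duy.
  have := sphere_curve_tangent cd'; rewrite Dv -gd => Dvy.
  have yS := sphere_curve_at cg'.
  have Dcomb a b : D (a *: v - b *: u) tau = a *: D v tau - b *: D u tau.
    exact: derive_snd_comb.
  have Dinj w : dot w x = 0 -> w != 0 -> D w tau != 0.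
    by move=> wx w0; have := inj tau x w tauI xS wx w0; rewrite isotopy_slice.
  have := tangent_map_nondegenerate Dcomb Dinj ux vx T0 yS Duy Dvy.
  by rewrite -/(f tau) f0 eqxx.
have f0 : f 0 = triple u v x.
  have [_ Phi0 _ _] := isoPhi.
  have D0u : D u 0 = u.
    have [_ [e e0 H]] := cg; apply: etrans (esym (Du 0)) _.
    by apply: (derive1_near e0) => r /H /Phi0.
  have D0v : D v 0 = v.
    have [_ [e e0 H]] := cd; apply: etrans (esym (Dv 0)) _.
    by apply: (derive1_near e0) => r /H /Phi0.
  by apply: triple_congr; [exact: D0u|exact: D0v|exact: Phi0].
have -> : triple ((fun r => Phi (1, g r))^`()%classic s)
     ((fun r => Phi (1, d r))^`()%classic t) (Phi (1, x)) = f 1.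
  by apply: triple_congr; [exact: Du|exact: Dv|].
rewrite -f0.
have zI : Num.min (f 0) (f 1) <= 0 <= Num.max (f 0) (f 1) ->
    exists2 z, z \in `[0, 1] & f z = 0.
  by move=> fI; apply: IVT fI; [exact: ler01|exact: continuous_subspaceT].
have f1N0 : f 1 != 0 by apply: fN0; lra.
have [f1|f1|f1] := ltgtP 0 (f 1); have [f0'|f0'|f0'] := ltgtP 0 (f 0) => //;
  try by (move: T0; rewrite -f0 -f0' eqxx).
- case: zI => [|z]; first by rewrite ge_min le_max (ltW f1) (ltW f0') ?orbT.
  by rewrite in_itv /= => /fN0 /eqP fz0 /fz0.
- case: zI => [|z]; first by rewrite ge_min le_max (ltW f1) (ltW f0') ?orbT.
  by rewrite in_itv /= => /fN0 /eqP fz0 /fz0.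
- by move: f1N0; rewrite -f1 eqxx.
Qed.

End Isotopy.

End Calculus.

(** * Reparametrisations and ambient isotopies *)

Section PointIso.
Variables (R : realType) (n k : nat).
Local Notation pt := (source_pt R n k).
Implicit Types (p q : pt) (a : component n k) (s t : R).

Definition map_pt (ren : component n k -> component n k)
  (rho : component n k -> R -> R) (p : pt) : pt := (ren p.1, rho p.1 p.2).

(** The combinatorial content of a reparametrisation.  In contrast to smooth
    reparametrisations, whose inverse would have to be shown to be smooth, these
    identifications are easily inverted. *)
Record point_iso (L1 L : diagram R n k) (ren : component n k -> component n k)
    (rho : component n k -> R -> R) : Prop := PointIso {
  pi_valid : forall p, valid p -> valid (map_pt ren rho p);
  pi_mono : forall a s t, valid (a, s) -> valid (a, t) -> s < t ->
    rho a s < rho a t;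
  pi_surj : forall a u, valid (ren a, u) -> exists2 t, valid (a, t) & rho a t = u;
  pi_end : forall p, is_endpoint p -> map_pt ren rho p = p;
  pi_same : forall p q, valid p -> valid q ->
    same_point p q <-> same_point (map_pt ren rho p) (map_pt ren rho q);
  pi_cross : forall p q, valid p -> valid q ->
    crossing L1 p q <-> crossing L (map_pt ren rho p) (map_pt ren rho q);
  pi_pos : forall p q, crossing L1 p q -> positive L1 p q =
    positive L (map_pt ren rho p) (map_pt ren rho q) }.

Section Transport.
Variables (L1 L : diagram R n k).
Variables (ren ren' : component n k -> component n k) (rho : component n k -> R -> R).
Hypotheses (renK : cancel ren ren') (renK' : cancel ren' ren).
Hypothesis iso : point_iso L1 L ren rho.
Local Notation m := (map_pt ren rho).

Lemma pi_le a s t : valid (a, s) -> valid (a, t) -> s <= t -> rho a s <= rho a t.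
Proof.
move=> vs vt; rewrite le_eqVlt => /orP[/eqP ->//|st].
exact/ltW/(pi_mono iso).
Qed.

Lemma pi_lt a s t : valid (a, s) -> valid (a, t) -> rho a s < rho a t -> s < t.
Proof. by move=> vs vt; apply: contraTT; rewrite -!leNgt; exact: pi_le. Qed.

Lemma pi_inj a s t : valid (a, s) -> valid (a, t) -> rho a s = rho a t -> s = t.
Proof.
move=> vs vt st; case: (ltgtP s t) => // lt.
  by have := pi_mono iso vs vt lt; rewrite st ltxx.
by have := pi_mono iso vt vs lt; rewrite st ltxx.
Qed.

Lemma pi_point_surj q : valid q -> exists2 p, valid p & m p = q.
Proof.
case: q => b u; rewrite -(renK' b) => /(pi_surj iso)[t vt <-].
by exists (ren' b, t).
Qed.

Lemma pi_under p : valid p -> under L1 p <-> under L (m p).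
Proof.
move=> vp; split=> -[q qp].
  have [vq _] := crossing_valid qp.
  by exists (m q); apply/(pi_cross iso).
have [/pi_point_surj[q' vq' E] _] := crossing_valid qp.
by exists q'; apply/(pi_cross iso) => //; rewrite E.
Qed.

Lemma pi_between a s t u : valid (a, s) -> valid (a, t) ->
  rho a s <= u <= rho a t -> exists2 w, s <= w <= t & rho a w = u.
Proof.
move=> vs vt uI; have vu : valid (ren a, u).
  exact: valid_convex (pi_valid iso vs) (pi_valid iso vt) uI.
have [w vw wu] := pi_surj iso vu; exists w => //.
rewrite !leNgt; apply/andP; split; apply/negP.
  by move=> /(pi_mono iso vw vs); rewrite wu; lra.
by move=> /(pi_mono iso vt vw); rewrite wu; lra.
Qed.

Lemma pi_coloring (X : quandle) (c : pt -> X) :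
  coloring L c -> coloring L1 (c \o m).
Proof.
move=> [cs cc cx]; split.
- move=> p q vp up pq /=; have vq := same_point_valid pq vp.
  apply: cs; first exact: (pi_valid iso).
    by move/(pi_under vp).2.
  exact: (pi_same iso vp vq).1 pq.
- move=> a s t st H /=.
  have [|vs _] := H s; first by rewrite lexx.
  have [|vt _] := H t; first by rewrite st lexx.
  apply: cc => [|u uI]; first exact: pi_le.
  have [w wI <-] := pi_between vs vt uI; have [vw uw] := H w wI.
  by split; [exact: (pi_valid iso) vw|move/(pi_under vw)].
- move=> p q s t pq sqt H /=.
  have [vp vq] := crossing_valid pq.
  have [|vs _] := H s; first by lra.
  have [|vt _] := H t; first by lra.
  rewrite (pi_pos iso pq); apply: (cx _ (m q)) => /=.
  + exact: (pi_cross iso vp vq).1 pq.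
  + have /andP[sq qt] := sqt; case: q vq {pq H} vs vt sqt sq qt => b u /= vq vs vt _ sq qt.
    by rewrite !(pi_mono iso).
  + move=> u uI; have [w wI <-] := pi_between vs vt uI; have [vw uw] := H w wI.
    split; first exact: (pi_valid iso) vw.
    by move/(pi_under vw)/uw => ->.
Qed.

Definition pi_inv (b : component n k) (u : R) : R :=
  match pselect (valid (ren (ren' b), u)) with
  | left h => sval (cid2 (pi_surj iso h))
  | right _ => u
  end.

Lemma pi_invP b u : valid (b, u) ->
  valid (ren' b, pi_inv b u) /\ rho (ren' b) (pi_inv b u) = u.
Proof.
by move=> vu; rewrite /pi_inv; case: pselect => [h|]; [case: cid2|rewrite renK'].
Qed.

Lemma pi_invK q : valid q -> m (map_pt ren' pi_inv q) = q.
Proof. by case: q => b u /pi_invP[_ E]; rewrite /map_pt /= E renK'. Qed.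

Lemma pi_Kinv p : valid p -> map_pt ren' pi_inv (m p) = p.
Proof.
case: p => a t vt; have [v E] := pi_invP (pi_valid iso vt).
rewrite /map_pt /= in v E *; rewrite renK in v E *.
by rewrite (pi_inj v vt E).
Qed.

Lemma point_iso_inv : point_iso L L1 ren' pi_inv.
Proof.
split.
- by case=> b u /pi_invP[].
- move=> b s t /pi_invP[vs Es] /pi_invP[vt Et] st.
  by apply: pi_lt vs vt _; rewrite Es Et.
- move=> b u vu; exists (rho (ren' b) u).
    by have := pi_valid iso vu; rewrite /map_pt /= renK'.
  by have [] := pi_Kinv vu; rewrite /map_pt /= renK'.
- move=> p ep; rewrite -[in LHS](pi_end iso ep) pi_Kinv //.
  by have [] := endpoint_valid L ep.
- move=> p q vp vq; rewrite -{1}(pi_invK vp) -{1}(pi_invK vq); apply: iff_sym.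
  by apply: (pi_same iso); [case: p vp => b u /pi_invP[]|case: q vq => b u /pi_invP[]].
- move=> p q vp vq; rewrite -{1}(pi_invK vp) -{1}(pi_invK vq); apply: iff_sym.
  by apply: (pi_cross iso); [case: p vp => b u /pi_invP[]|case: q vq => b u /pi_invP[]].
- move=> p q pq; have [vp vq] := crossing_valid pq.
  rewrite (pi_pos iso) ?pi_invK //; apply/(pi_cross iso); rewrite ?pi_invK //.
    by case: p vp {pq} => b u /pi_invP[].
  by case: q vq {pq} => b u /pi_invP[].
Qed.

End Transport.

Lemma point_iso_isomorphic (L1 L : diagram R n k) ren ren' rho :
  cancel ren ren' -> cancel ren' ren -> point_iso L1 L ren rho ->
  pointed_isomorphic (fundamental_pointed_quandle L)
    (fundamental_pointed_quandle L1).
Proof.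
move=> renK renK' iso; have iso' := point_iso_inv renK renK' iso.
pose S (p p' : pt) := [/\ valid p', ~ under L1 p' & p = map_pt ren rho p'].
apply: (@iso_by_transfer _ _ _ _ _ S).
- move=> p ep; have [vp up] := endpoint_valid L1 ep.
  by split=> //; rewrite (pi_end iso ep).
- move=> p p' [vp' up' ->]; split=> //; first exact: (pi_valid iso).
  by move/(pi_under renK' iso vp').
- move=> X c colc; exists (c \o map_pt ren rho); first exact: (pi_coloring renK' iso).
  by move=> p p' [_ _ ->].
- move=> X c colc; exists (c \o map_pt ren' (pi_inv ren' iso)).
    exact: (pi_coloring renK iso').
  by move=> p p' [vp' _ ->] /=; rewrite pi_Kinv.
- move=> X c d _ _ cd p vp up; have [p' vp' E] := pi_point_surj renK' iso vp.
  apply: (cd _ p'); split=> //.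
  by move/(pi_under renK' iso vp').1; rewrite E.
- move=> X c d _ _ cd p vp up; exact: (cd (map_pt ren rho p)).
Qed.

End PointIso.

Section DiagramIso.
Variables (R : realType) (n k : nat).
Local Notation pt := (source_pt R n k).
Implicit Types (p q : pt) (a : component n k) (s t : R) (L : diagram R n k).

Lemma derive1_reparam (W : normedModType R) (F : R -> W) (g : R -> R) t :
  differentiable (F : R^o -> W) (g t) -> derivable (g : R^o -> R^o) t 1 ->
  (F \o g)^`()%classic t = g^`()%classic t *: F^`()%classic (g t).
Proof.
move=> dF dg; rewrite (@derive1_chain _ R^o W F g t dF dg) deriveE //.
have -> : g^`()%classic t = (g^`()%classic t : R^o) *: (1 : R^o) by rewrite /GRing.scale /= mulr1.
by rewrite linearZ /= -derive1E' // /GRing.scale /= mulr1.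
Qed.

Lemma triple_posZ (r r' : R) (u v x : 'rV[R]_3) : 0 < r -> 0 < r' ->
  (0 < triple (r *: u) (r' *: v) x) = (0 < triple u v x).
Proof.
move=> r0 r'0; have -> : triple (r *: u) (r' *: v) x = (r * r') * triple u v x.
  by rewrite !tripleE !coordZ; ring.
by rewrite pmulr_rgt0 // mulr_gt0.
Qed.

Lemma strand_sphere_curve L p : valid p -> ~ is_endpoint p ->
  sphere_curve (strand L p.1) p.2.
Proof.
move=> vp ep; split; first exact/smooth_derivable/strand_smooth.
have [e e0 H] := valid_near vp ep; exists e => // s /H vs.
exact: (@strand_sphere _ _ _ L (p.1, s)).
Qed.

(** A positive derivative makes the reparametrisation monotone and rescales the
    velocities by positive factors, which do not affect the sign of a crossing. *)
Lemma same_diagram_isomorphic L L1 : same_diagram L L1 ->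
  pointed_isomorphic (fundamental_pointed_quandle L)
    (fundamental_pointed_quandle L1).
Proof.
move=> [pi [rho /= [sm pos ends per [posE overE]]]].
pose ren (a : component n k) : component n k :=
  match a with inl i => inl i | inr j => inr (pi j) end.
pose ren' (a : component n k) : component n k :=
  match a with inl i => inl i | inr j => inr ((pi^-1)%g j) end.
have renK : cancel ren ren' by move=> [i|j] //=; rewrite permK.
have renK' : cancel ren' ren by move=> [i|j] //=; rewrite permKV.
apply: (point_iso_isomorphic renK renK' (rho := rho)).
have mono a s t : valid (a, s) -> valid (a, t) -> s < t -> rho a s < rho a t.
  move=> vs vt st; apply: (@smooth_increasing _ (rho a) s t (sm a)) => //.
  by move=> u uI; apply: (pos (a, u)); exact: valid_convex vs vt uI.
have le a s t : valid (a, s) -> valid (a, t) -> s <= t -> rho a s <= rho a t.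
  by move=> vs vt; rewrite le_eqVlt => /orP[/eqP ->//|/mono H]; apply/ltW/H.
have inj a s t : valid (a, s) -> valid (a, t) -> rho a s = rho a t -> s = t.
  move=> vs vt st; case: (ltgtP s t) => // lt.
    by have := mono a s t vs vt lt; rewrite st ltxx.
  by have := mono a t s vt vs lt; rewrite st ltxx.
have perZ j t (z : int) : rho (inr j) (t + z%:~R) = rho (inr j) t + z%:~R.
  have perN (l : nat) u : rho (inr j) (u + l%:R) = rho (inr j) u + l%:R.
    by elim: l => [|l IH]; rewrite ?addr0 // -natr1 !addrA per IH.
  case: z => l; first exact: perN.
  rewrite NegzE rmorphN /= -pmulrn.
  by have := perN l.+1 (t - l.+1%:R); rewrite subrK => ->; rewrite addrK.
have val p : valid p -> valid (map_pt ren rho p).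
  case: p => -[i|j] t //; rewrite /valid /= => tI.
  have [r0 r1] := ends i; rewrite -{1}r0 -{1}r1.
  by rewrite !le // /valid /=; lra.
have same p q : valid p -> valid q ->
    same_point p q <-> same_point (map_pt ren rho p) (map_pt ren rho q).
  case: p q => [a s] [b t] vs vt; split=> -[/= E].
    rewrite -{b}E in vt *; case: a vs vt => [i|j] vs vt; first by move=> ->.
    by move=> [z ->]; split=> //=; exists z; rewrite perZ.
  have {}E : a = b by rewrite -(renK a) E renK.
  rewrite -{b}E in vt *; case: a vs vt => [i|j] vs vt /=.
    by move=> /(inj _ _ _ vs vt) ->; exact: same_point_refl.
  move=> [z]; rewrite -perZ => E; rewrite (inj (inr j) t (s + z%:~R)) //.
  exact: same_point_inr.
have dbl p q : valid p -> valid q -> double_point (strand L1) p q <->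
    double_point (strand L) (map_pt ren rho p) (map_pt ren rho q).
  move=> vp vq; split=> -[_ _ ns E]; split; try exact: val; try exact: vp;
    try exact: vq.
  - by move=> /(same p q vp vq).2.
  - by have := posE p vp; have := posE q vq; rewrite /position /= => <- <-.
  - by move=> /(same p q vp vq).1.
  - by have := posE p vp; have := posE q vq; rewrite /position /= => -> ->.
split=> //.
- move=> [i|j] u.
    have [r0 r1] := ends i; rewrite /valid /= -{1}r0 -{1}r1 => uI.
    by have [t tI <-] := smooth_ivt (sm (inl i)) ler01 uI; exists t.
  move=> _; pose z := Num.floor (u - rho (inr j) 0).
  have [||t _ <-] := @smooth_ivt _ (rho (inr j)) (z%:~R) (z%:~R + 1) u (sm _).
  + lra.
  + rewrite per -[z%:~R]add0r perZ.
    have := floor_le_tmp (u - rho (inr j) 0); have := floorD1_gt (u - rho (inr j) 0).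
    by rewrite -/z intrD; lra.
  + by exists t.
- case=> -[i|j] t //; rewrite /is_endpoint /map_pt /= => e.
  by have [r0 r1] := ends i; case: e => ->; rewrite ?r0 ?r1.
- move=> p q vp vq; split=> -[d o].
    by split; [exact: (dbl p q vp vq).1 d|exact: (overE p q d).1 o].
  have d' := (dbl p q vp vq).2 d.
  by split=> //; exact: (overE p q d').2 o.
- move=> p q pq; have [vp vq] := crossing_valid pq.
  have vel p' : valid p' -> ~ is_endpoint p' -> velocity L1 p' =
      (rho p'.1)^`()%classic p'.2 *: velocity L (map_pt ren rho p').
    case: p' => a t vt et; have [e e0 He] := valid_near vt et.
    rewrite /velocity /= -derive1_reparam.
    + by apply: (derive1_near e0) => s /He /posE.
    + exact/smooth_differentiable/strand_smooth.
    + exact: smooth_derivable.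
  have [ep eq] := crossing_not_endpoint pq.
  by rewrite /positive !vel // triple_posZ ?posE //; exact: pos.
Qed.

(** The map at time 1 is injective on the sphere, so it neither creates nor
    removes double points, and it preserves the orientation. *)
Lemma carried_by_isomorphic L L' Phi : ambient_isotopy Phi -> carried_by Phi L L' ->
  pointed_isomorphic (fundamental_pointed_quandle L)
    (fundamental_pointed_quandle L').
Proof.
move=> isoPhi [posE overE].
have Phi_inj x y : on_sphere x -> on_sphere y -> Phi (1, x) = Phi (1, y) -> x = y.
  have h01 : 0 <= (1 : R) <= 1 by rewrite ler01 lexx.
  case: isoPhi => _ _ /(_ 1 h01)[_ inj _] _.
  by move=> xS yS; apply: inj; rewrite inE.
have dbl p q : double_point (strand L') p q <-> double_point (strand L) p q.
  split=> -[vp vq ns E]; split=> //.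
    apply: Phi_inj; [exact: strand_sphere|exact: strand_sphere|].
    by rewrite -(posE p) // -(posE q).
  by have := posE p vp; have := posE q vq; rewrite /position E => -> ->.
have cross p q : crossing L' p q <-> crossing L p q.
  split=> -[d o]; first by split; [exact/dbl|exact/overE].
  by have d' := (dbl p q).2 d; split=> //; exact/overE.
apply: (@point_iso_isomorphic _ _ _ L' L id id (fun _ => id)) => //.
split=> //.
- by move=> a u vu; exists u.
- by case.
- by move=> [a s] [b t] _ _; exact: cross.
- move=> p q pq; have [vp vq] := crossing_valid pq.
  have [ep eq] := crossing_not_endpoint pq.
  have [dpq _] := (cross p q).1 pq.
  have vel p' : valid p' -> ~ is_endpoint p' -> velocity L' p' =
      (fun r => Phi (1, strand L p'.1 r))^`()%classic p'.2.
    move=> vp' ep'; have [e e0 He] := valid_near vp' ep'.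
    by apply: (derive1_near e0) => s /He /posE.
  rewrite /positive !vel // posE //.
  have -> : map_pt id (fun=> id) p = p by case: (p).
  have -> : map_pt id (fun=> id) q = q by case: (q).
  apply: (isotopy_orientation isoPhi); try exact: strand_sphere_curve.
    by case: dpq.
  exact: double_transverse.
Qed.

Lemma R0_isomorphic L L' : R0_move L L' ->
  pointed_isomorphic (fundamental_pointed_quandle L)
    (fundamental_pointed_quandle L').
Proof.
move=> [L1 [Phi [LL1 isoPhi L1L']]].
exact: pointed_isomorphic_trans (same_diagram_isomorphic LL1)
  (carried_by_isomorphic isoPhi L1L').
Qed.

End DiagramIso.

(** * Pieces of components *)

Lemma int_small_eq0 (R : realType) (m : int) : -1 < (m%:~R : R) < 1 -> m = 0.
Proof.
move=> /andP[m1 m2].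
have : (-1 < m)%R by rewrite -(ltr_int R) mulrN1z.
have : (m < 1)%R by rewrite -(ltr_int R).
lia.
Qed.

Lemma finite_near (R : realType) r (P : 'I_r -> R -> Prop) :
  (forall i, exists2 e : R, 0 < e & forall x, `|x| < e -> P i x) ->
  exists2 e : R, 0 < e & forall x, `|x| < e -> forall i, P i x.
Proof.
move=> H; have /choice[f Hf] i : exists e : R, 0 < e /\ forall x, `|x| < e -> P i x.
  by have [e e0 He] := H i; exists e.
exists (\big[Num.min/1]_i f i).
  by apply/bigmin_gtP; split=> // i _; have [] := Hf i.
by move=> x /bigmin_gtP[_ xf] i; have [_] := Hf i; apply; apply: xf.
Qed.

Section Pieces.
Variables (R : realType) (n k r : nat).
Local Notation pt := (source_pt R n k).
Variables (cc : 'I_r -> component n k) (lo hi : 'I_r -> R).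
Hypothesis good : good_pieces cc lo hi.
Implicit Types (p q : pt) (i j : 'I_r) (s t u : R).

Definition in_some_piece p := exists i, in_piece cc lo hi i p.

Lemma piece_lt i : lo i < hi i.
Proof. by case: good => /(_ i)[]. Qed.

Lemma piece_disjoint i j p :
  in_piece cc lo hi i p -> in_piece cc lo hi j p -> i = j.
Proof. by case: good => _; apply. Qed.

Lemma in_piece_same i p q :
  same_point p q -> in_piece cc lo hi i p -> in_piece cc lo hi i q.
Proof. by move=> pq [t tI tp]; exists t => //; exact: same_point_trans pq. Qed.

Lemma in_piece_self i t : lo i <= t <= hi i -> in_piece cc lo hi i (cc i, t).
Proof. by exists t => //; exact: same_point_refl. Qed.

Lemma piece_valid i t : lo i <= t <= hi i -> valid (cc i, t).
Proof.
case: good => /(_ i)[_ +] _; rewrite /valid /=; case: (cc i) => [j|j] //=; lra.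
Qed.

Lemma piece_valid_near i t : lo i <= t <= hi i ->
  exists2 e : R, 0 < e & forall u, `|u - t| < e -> valid (cc i, u).
Proof.
move=> tI; apply: (@valid_near _ _ _ (cc i, t)); first exact: piece_valid.
case: good => /(_ i)[_ +] _; rewrite /is_endpoint /=; case: (cc i) => [j|j] /=; last by move=> _ [].
by move=> [l h] [E|E]; rewrite E in tI; lra.
Qed.

(** A piece of a closed component is shorter than the component, so a point has
    only one parameter in it. *)
Lemma piece_param_inj i s t : lo i <= s <= hi i -> lo i <= t <= hi i ->
  same_point (cc i, s) (cc i, t) -> s = t.
Proof.
move=> sI tI [_ /=]; case: good => /(_ i)[_ sh] _; case: (cc i) sh => [//|j sh [m tE]].
by rewrite tE (@int_small_eq0 R m) ?addr0 //; lra.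
Qed.

(** The pieces are closed sets: being outside of one is an open condition. *)
Lemma not_in_piece_near i p : ~ in_piece cc lo hi i p ->
  exists2 e : R, 0 < e & forall x, `|x| < e -> ~ in_piece cc lo hi i (p.1, p.2 + x).
Proof.
case: p => a y /= yi; have lh := piece_lt i.
have [ca|ca] := pselect (cc i = a); last first.
  by exists 1 => // x _ [t _ /same_point_comp].
rewrite -{a}ca in yi *; case: good => /(_ i)[_ +] _.
case E : (cc i) yi => [j|j] yi sh.
  have {}yi : ~ (lo i <= y <= hi i).
    by move=> yI; apply: yi; rewrite -E; exact: in_piece_self.
  have [yl|ly] := ltP y (lo i).
    exists (lo i - y); first lra.
    by move=> x; rewrite ltr_norml => xI [t tI]; rewrite E => -[_ /=]; lra.
  have {}yi : hi i < y by rewrite ltNge; apply/negP => yh; apply: yi; rewrite ly.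
  exists (y - hi i); first lra.
  by move=> x; rewrite ltr_norml => xI [t tI]; rewrite E => -[_ /=]; lra.
pose m := Num.floor (y - lo i).
have m0 := floor_le_tmp (y - lo i); have m1 := floorD1_gt (y - lo i).
rewrite -/m intrD in m0 m1.
have yh : hi i < y - m%:~R.
  rewrite ltNge; apply/negP => yh; apply: yi; exists (y - m%:~R); first lra.
  by rewrite E; split=> //=; exists m; rewrite subrK.
exists (Num.min (y - m%:~R - hi i) (lo i + 1 - (y - m%:~R))).
  by rewrite lt_min; apply/andP; split; lra.
move=> x; rewrite lt_min !ltr_norml => xI [t tI]; rewrite E => -[_ /= [l yE]].
have lm : l - m - 1 = 0 :> int.
  by apply: (@int_small_eq0 R); rewrite !intrB; lra.
have : (l%:~R : R) = m%:~R + 1.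
  by rewrite -[1]/(1%:~R) -intrD; congr (_%:~R); lia.
lra.
Qed.

Lemma not_in_some_piece_near p : ~ in_some_piece p ->
  exists2 e : R, 0 < e & forall t, `|t - p.2| < e -> ~ in_some_piece (p.1, t).
Proof.
move=> op; have [i|e e0 He] := @finite_near R r (fun i x =>
    ~ in_piece cc lo hi i (p.1, p.2 + x)).
  by apply: not_in_piece_near => ip; apply: op; exists i.
exists e => // t te [i it]; apply: (He _ te i).
by rewrite addrC subrK.
Qed.

(** Pieces are closed and disjoint, and a piece of a closed component is not the
    whole component, so a piece can be left through its ends. *)
Lemma before_piece i :
  exists2 e : R, 0 < e & forall t, lo i - e < t < lo i -> ~ in_some_piece (cc i, t).
Proof.
have [j|e e0 He] := @finite_near R r (fun j x => i <> j ->
    ~ in_piece cc lo hi j (cc i, lo i + x)).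
  have [ij|ij] := pselect (i = j); first by exists 1.
  have [|e e0 He] := @not_in_piece_near j (cc i, lo i).
    move=> jl; apply: ij; apply: piece_disjoint jl.
    by apply: in_piece_self; rewrite lexx ltW // piece_lt.
  by exists e => // x xe _; exact: He.
have lh := piece_lt i.
pose d := if cc i is inr _ then lo i + 1 - hi i else 1.
have d0 : 0 < d.
  by rewrite /d; case: good => /(_ i)[_ +] _; case: (cc i) => [j _|j sh] /=; lra.
exists (Num.min e d); first by rewrite lt_min e0.
have me : Num.min e d <= e by rewrite ge_min lexx.
have md : Num.min e d <= d by rewrite ge_min lexx orbT.
move=> t tI [j jt]; have [ij|ij] := pselect (i = j); last first.
  apply: (He (t - lo i) _ j ij); last by rewrite addrC subrK.
  by rewrite ltr_norml; lra.
rewrite -{j}ij in jt; case: jt => u uI [_ /=]; move: (Num.min e d) md tI {me} => M; rewrite /d.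
case: (cc i) => [j|j] /= md tI; first by lra.
move=> [m tE]; have m0 : (m%:~R : R) < 0 by lra.
have : (m <= -1)%R by move: m0; rewrite -[0]/(0%:~R) ltr_int; lia.
by rewrite -(ler_int R) mulrN1z; lra.
Qed.

Lemma after_piece i :
  exists2 e : R, 0 < e & forall t, hi i < t < hi i + e -> ~ in_some_piece (cc i, t).
Proof.
have [j|e e0 He] := @finite_near R r (fun j x => i <> j ->
    ~ in_piece cc lo hi j (cc i, hi i + x)).
  have [ij|ij] := pselect (i = j); first by exists 1.
  have [|e e0 He] := @not_in_piece_near j (cc i, hi i).
    move=> jl; apply: ij; apply: piece_disjoint jl.
    by apply: in_piece_self; rewrite lexx ltW // piece_lt.
  by exists e => // x xe _; exact: He.
have lh := piece_lt i.
pose d := if cc i is inr _ then lo i + 1 - hi i else 1.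
have d0 : 0 < d.
  by rewrite /d; case: good => /(_ i)[_ +] _; case: (cc i) => [j _|j sh] /=; lra.
exists (Num.min e d); first by rewrite lt_min e0.
have me : Num.min e d <= e by rewrite ge_min lexx.
have md : Num.min e d <= d by rewrite ge_min lexx orbT.
move=> t tI [j jt]; have [ij|ij] := pselect (i = j); last first.
  apply: (He (t - hi i) _ j ij); last by rewrite addrC subrK.
  by rewrite ltr_norml; lra.
rewrite -{j}ij in jt; case: jt => u uI [_ /=]; move: (Num.min e d) md tI {me} => M; rewrite /d.
case: (cc i) => [j|j] /= md tI; first by lra.
move=> [m tE]; have m0 : 0 < (m%:~R : R) by lra.
have : (1 <= m)%R by move: m0; rewrite -[0]/(0%:~R) ltr_int; lia.
by rewrite -(ler_int R); lra.
Qed.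

End Pieces.

(** * Tangles in a disc *)

(** [tc j t i u e] says that strand [j] at [t] passes over strand [i] at [u], and
    that following strand [i] in its standard direction the color of strand [j]
    acts with sign [e].  The direction in which [i] is really traversed does not
    enter, because reversing it exchanges the two sides of the undercrossing and
    also changes the sign of the crossing. *)
Definition tangle_crossings (R : realType) r := 'I_r -> R -> 'I_r -> R -> bool -> Prop.

Section TangleColorings.
Variables (R : realType) (r : nat).
Implicit Types (tc : tangle_crossings R r) (i j : 'I_r) (s t u : R).

Definition tangle_under tc i u := exists j t e, tc j t i u e.

Record tangle_coloring (X : quandle) tc (d : 'I_r -> R -> X) : Prop := TangleColoring {
  tcol_const : forall i s s', -1 <= s -> s <= s' -> s' <= 1 ->
    (forall u, s <= u <= s' -> ~ tangle_under tc i u) -> d i s = d i s';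
  tcol_cross : forall j t i u e s s', tc j t i u e ->
    -1 <= s -> s < u -> u < s' -> s' <= 1 ->
    (forall w, s <= w <= s' -> tangle_under tc i w -> w = u) ->
    d i s' = qact e (d i s) (d j t) }.

Definition same_ends (X : quandle) (d d' : 'I_r -> R -> X) :=
  forall i, d i (-1) = d' i (-1) /\ d i 1 = d' i 1.

Definition ends_extend tc tc' := forall (X : quandle) (d : 'I_r -> R -> X),
  tangle_coloring tc d -> exists2 d', tangle_coloring tc' d' & same_ends d d'.

Definition ends_determine tc := forall (X : quandle) (d d' : 'I_r -> R -> X),
  tangle_coloring tc d -> tangle_coloring tc d' -> same_ends d d' ->
  forall i s, -1 <= s <= 1 -> ~ tangle_under tc i s -> d i s = d' i s.

Definition tangle_equivalent tc tc' :=
  [/\ ends_extend tc tc', ends_extend tc' tc, ends_determine tc & ends_determine tc'].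

Lemma tangle_equivalent_sym tc tc' : tangle_equivalent tc tc' -> tangle_equivalent tc' tc.
Proof. by case. Qed.

End TangleColorings.

Section LocalReplacement.
Variables (R : realType) (n k r : nat).
Local Notation pt := (source_pt R n k).
Variables (cc : 'I_r -> component n k) (lo hi : 'I_r -> R) (back : 'I_r -> bool).
Hypothesis good : good_pieces cc lo hi.
Implicit Types (p q : pt) (i j : 'I_r) (s t u : R) (L : diagram R n k).
Local Notation inside := (in_some_piece cc lo hi).

(** [par i] parametrises the i-th piece by [-1, 1], in the standard direction of
    the strand; [th i] is its inverse. *)
Record strand_param L (th par : 'I_r -> R -> R) : Prop := StrandParam {
  sp_par : forall i s, -1 <= s <= 1 -> lo i <= par i s <= hi i;
  sp_th : forall i t, lo i <= t <= hi i -> -1 <= th i t <= 1;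
  sp_thK : forall i s, -1 <= s <= 1 -> th i (par i s) = s;
  sp_parK : forall i t, lo i <= t <= hi i -> par i (th i t) = t;
  sp_mono : forall i s s', -1 <= s -> s < s' -> s' <= 1 ->
    if back i then par i s' < par i s else par i s < par i s';
  sp_cross : forall p q, crossing L p q -> inside p <-> inside q;
  sp_bd : forall i s p, -1 <= s <= 1 ->
    crossing L p (cc i, par i s) \/ crossing L (cc i, par i s) p -> -1 < s < 1 }.

Definition strand_pt (par : 'I_r -> R -> R) i s : pt := (cc i, par i s).

Definition tangle_of L (par : 'I_r -> R -> R) : tangle_crossings R r :=
  fun j t i u e => [/\ -1 <= t <= 1, -1 <= u <= 1,
    crossing L (strand_pt par j t) (strand_pt par i u) &
    e = positive L (strand_pt par j t) (strand_pt par i u) (+) back i].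

Section OneTangle.
Variables (L : diagram R n k) (th par : 'I_r -> R -> R).
Hypothesis sp : strand_param L th par.
Local Notation P := (strand_pt par).
Local Notation tc := (tangle_of L par).

Lemma strand_pt_valid i s : -1 <= s <= 1 -> valid (P i s).
Proof. by move=> sI; exact: (piece_valid good (sp_par sp i sI)). Qed.

Lemma strand_pt_in i s : -1 <= s <= 1 -> in_piece cc lo hi i (P i s).
Proof. by move=> sI; exact: (in_piece_self _ (sp_par sp i sI)). Qed.

Lemma in_piece_strand i p : in_piece cc lo hi i p ->
  exists2 s, -1 <= s <= 1 & same_point (P i s) p.
Proof.
move=> [t tI tp]; exists (th i t); first exact: (sp_th sp).
by rewrite /strand_pt (sp_parK sp).
Qed.

Lemma inside_strand p : inside p -> exists i s, -1 <= s <= 1 /\ same_point (P i s) p.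
Proof. by move=> [i /in_piece_strand[s sI sp']]; exists i, s. Qed.

Lemma strand_pt_inj i j s t : -1 <= s <= 1 -> -1 <= t <= 1 ->
  same_point (P i s) (P j t) -> i = j /\ s = t.
Proof.
move=> sI tI st.
have ij : i = j.
  apply: (piece_disjoint good _ (strand_pt_in j tI)).
  exact: in_piece_same (strand_pt_in i sI).
rewrite -{j}ij in st *; split=> //.
have := piece_param_inj good (sp_par sp i sI) (sp_par sp i tI) st.
by move=> /(congr1 (th i)); rewrite !(sp_thK sp).
Qed.

Lemma strand_under i s : -1 <= s <= 1 -> under L (P i s) -> tangle_under tc i s.
Proof.
move=> sI [p pP].
have [|j [t [tI tp]]] := @inside_strand p.
  by apply/(sp_cross sp pP); exists i; exact: strand_pt_in.
exists j, t; eexists; split; [by []|by []| |by []].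
by apply: crossing_same pP; [exact: same_point_sym|exact: same_point_refl].
Qed.

Lemma strand_le i s s' : -1 <= s -> s <= s' -> s' <= 1 ->
  if back i then par i s' <= par i s else par i s <= par i s'.
Proof.
move=> s1 + s2; rewrite le_eqVlt => /orP[/eqP ->|ss]; first by case: back.
by have := sp_mono sp i s1 ss s2; case: back => /ltW.
Qed.

Lemma strand_end_l i : par i (-1) = if back i then hi i else lo i.
Proof.
have lh := piece_lt good i; have oI : -1 <= (-1 : R) <= 1 by lra.
have parI := sp_par sp i oI.
pose x := if back i then hi i else lo i.
have xI : lo i <= x <= hi i by rewrite /x; case: back; lra.
have /andP[th1 th2] := sp_th sp xI.
have := @strand_le i (-1) (th i x) (lexx _) th1 th2.
by rewrite (sp_parK sp) // /x; case: back; lra.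
Qed.

Lemma strand_end_r i : par i 1 = if back i then lo i else hi i.
Proof.
have lh := piece_lt good i; have oI : -1 <= (1 : R) <= 1 by lra.
have parI := sp_par sp i oI.
pose x := if back i then lo i else hi i.
have xI : lo i <= x <= hi i by rewrite /x; case: back; lra.
have /andP[th1 th2] := sp_th sp xI.
have := @strand_le i (th i x) 1 th1 th2 (lexx _).
by rewrite (sp_parK sp) // /x; case: back; lra.
Qed.

(** Monotone bijections map intervals onto intervals; [back] exchanges the two
    ends. *)
Lemma strand_between i s s' t : -1 <= s -> s <= s' -> s' <= 1 ->
  (if back i then par i s' <= t <= par i s else par i s <= t <= par i s') ->
  exists2 w, s <= w <= s' & par i w = t.
Proof.
move=> s1 ss s2 tI.
have sI : -1 <= s <= 1 by lra.
have sI' : -1 <= s' <= 1 by lra.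
have := sp_par sp i sI; have := sp_par sp i sI' => p1 p2.
have {}tI' : lo i <= t <= hi i by move: tI; case: back; lra.
have /andP[th1 th2] := sp_th sp tI'.
exists (th i t); last by rewrite (sp_parK sp).
have /andP[_ s2'] := sI; have /andP[s1' _] := sI'.
apply/andP; split; rewrite leNgt; apply/negP => lt.
  by have := sp_mono sp i th1 lt s2'; move: tI; rewrite (sp_parK sp) //; case: back; lra.
by have := sp_mono sp i s1' lt th2; move: tI; rewrite (sp_parK sp) //; case: back; lra.
Qed.

Lemma strand_th_lt i s t : lo i <= s -> s < t -> t <= hi i ->
  if back i then th i t < th i s else th i s < th i t.
Proof.
move=> ls st th_; have sI : lo i <= s <= hi i by lra.
have tI : lo i <= t <= hi i by lra.
have [s1 s2] := andP (sp_th sp sI); have [t1 t2] := andP (sp_th sp tI).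
have [lt|le] := ltP (th i s) (th i t).
  have := sp_mono sp i s1 lt t2; rewrite !(sp_parK sp) //.
  by case: (back i) => h //; lra.
have := strand_le i t1 le s2; rewrite !(sp_parK sp) //.
case: (back i) => h; last lra.
rewrite lt_neqAle le andbT; apply/eqP => /(congr1 (par i)).
by rewrite !(sp_parK sp) //; lra.
Qed.

Lemma strand_th_between i s t w : lo i <= s -> s <= t -> t <= hi i ->
  (if back i then th i t <= w <= th i s else th i s <= w <= th i t) ->
  -1 <= w <= 1 /\ s <= par i w <= t.
Proof.
move=> ls st th_; have sI : lo i <= s <= hi i by lra.
have tI : lo i <= t <= hi i by lra.
have [s1 s2] := andP (sp_th sp sI); have [t1 t2] := andP (sp_th sp tI).
case E : (back i) => /andP[w1 w2].
  have w0 : -1 <= w by lra.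
  have w3 : w <= 1 by lra.
  have := strand_le i t1 w1 w3; have := strand_le i w0 w2 s2.
  by rewrite E !(sp_parK sp) // w0 w3 => -> ->.
have w0 : -1 <= w by lra.
have w3 : w <= 1 by lra.
have := strand_le i s1 w1 w3; have := strand_le i w0 w2 t2.
by rewrite E !(sp_parK sp) // w0 w3 => -> ->.
Qed.

Lemma restrict_coloring (X : quandle) (c : pt -> X) :
  coloring L c -> tangle_coloring tc (fun i s => c (P i s)).
Proof.
move=> colc; split.
- move=> i s s' s1 ss s2 H; have le := strand_le i s1 ss s2.
  have clr t : (if back i then par i s' <= t <= par i s else par i s <= t <= par i s') ->
      valid (cc i, t) /\ ~ under L (cc i, t).
    move=> /(strand_between s1 ss s2)[w wI <-].
    have wI' : -1 <= w <= 1 by lra.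
    split; first exact: strand_pt_valid.
    by move/(strand_under wI'); exact: H.
  by case: back le clr => le clr; [apply/esym|]; apply: (color_const colc le).
- move=> j t i u e s s' [tI uI pq eE] s1 su us s2 H.
  have clr x : (if back i then par i s' <= x <= par i s else par i s <= x <= par i s') ->
      valid (cc i, x) /\ (under L (cc i, x) -> x = par i u).
    have ss : s <= s' by lra.
    move=> /(strand_between s1 ss s2)[w wI <-].
    have wI' : -1 <= w <= 1 by lra.
    split; first exact: strand_pt_valid.
    by move/(strand_under wI')/(H w wI) => ->.
  have u1 : -1 <= u by lra.
  have u2 : u <= 1 by lra.
  have := sp_mono sp i s1 su u2; have := sp_mono sp i u1 us s2.
  move: clr eE; case: (back i) => clr -> us' su'.
    rewrite addbT; apply: qact_eqV; apply/esym.
    by apply: (color_cross colc pq _ clr) => /=; rewrite us'.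
  rewrite addbF.
  by apply: (color_cross colc pq _ clr) => /=; rewrite su'.
Qed.

End OneTangle.

End LocalReplacement.

(** ** Gluing *)

(** The names of a point differ by translations, which carry neighbourhoods to
    neighbourhoods, so one name of each point may be chosen. *)
Lemma coloring_local_rep (R : realType) (n k : nat) (L : diagram R n k)
    (X : quandle) (c : source_pt R n k -> X) :
  (forall p q, valid p -> ~ under L p -> same_point p q -> c p = c q) ->
  (forall p, valid p -> ~ under L p -> exists2 p', same_point p p' &
     exists2 e : R, 0 < e &
       forall t, `|t - p'.2| < e -> valid (p'.1, t) -> c (p'.1, t) = c p') ->
  (forall p q, crossing L p q -> exists p' q',
     [/\ same_point p p', same_point q q' & exists2 e : R, 0 < e &
       forall s t, q'.2 - e < s < q'.2 -> q'.2 < t < q'.2 + e ->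
         c (q'.1, t) = qact (positive L p' q') (c (q'.1, s)) (c p')]) ->
  coloring L c.
Proof.
move=> cs cl cx; apply: coloring_local => //.
- move=> p vp up; have [p' pp' [e e0 He]] := cl p vp up.
  have [d d0 Hd] := under_free_near vp up.
  exists (Num.min e d); first by rewrite lt_min e0.
  move=> t; rewrite lt_min => /andP[te td] vt.
  have [|_ ut] := Hd t td vt t; first by rewrite ge_min le_max lexx.
  rewrite (cs _ _ vp up pp') (cs _ _ vt ut (same_point_shift pp' t)).
  apply: He; first by rewrite addrK.
  exact: same_point_valid (same_point_shift pp' t) vt.
- move=> p q pq; have [p' [q' [pp' qq' [e e0 He]]]] := cx p q pq.
  have [vp vq] := crossing_valid pq; have up := over_not_under pq.
  have [d d0 Hd] := crossing_near pq.
  exists (Num.min e d); first by rewrite lt_min e0.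
  have me : Num.min e d <= e by rewrite ge_min lexx.
  have md : Num.min e d <= d by rewrite ge_min lexx orbT.
  move=> s t sq qt.
  have sq' : q.2 - d < s < q.2 by lra.
  have qt' : q.2 < t < q.2 + d by lra.
  have [|vs us] := Hd s t sq' qt' s; first by lra.
  have [|vt ut] := Hd s t sq' qt' t; first by lra.
  have {}us : ~ under L (q.1, s) by move/us => ?; lra.
  have {}ut : ~ under L (q.1, t) by move/ut => ?; lra.
  rewrite (cs _ _ vp up pp') (cs _ _ vt ut (same_point_shift qq' t)).
  rewrite (cs _ _ vs us (same_point_shift qq' s)) (positive_same L pp' qq').
  by apply: He; lra.
Qed.

Section Gluing.
Variables (R : realType) (n k r : nat).
Local Notation pt := (source_pt R n k).
Variables (cc : 'I_r -> component n k) (lo hi : 'I_r -> R) (back : 'I_r -> bool).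
Hypothesis good : good_pieces cc lo hi.
Implicit Types (p q : pt) (i j : 'I_r) (s t u : R).
Local Notation inside := (in_some_piece cc lo hi).

Definition agree_outside (L L' : diagram R n k) := forall p q,
  ~ inside p -> ~ inside q -> (crossing L p q <-> crossing L' p q) /\
  (crossing L p q -> positive L p q = positive L' p q).

Variables (L L' : diagram R n k) (th par th' par' : 'I_r -> R -> R).
Hypothesis sp : strand_param cc lo hi back L th par.
Hypothesis sp' : strand_param cc lo hi back L' th' par'.
Hypothesis out : agree_outside L L'.

Lemma under_outside p : ~ inside p -> under L p -> under L' p.
Proof.
move=> op [q qp]; exists q; have oq : ~ inside q by move=> /(sp_cross sp qp).
exact: ((out oq op).1.1 qp).
Qed.

Section Glue.
Variables (X : quandle) (c : pt -> X) (d : 'I_r -> R -> X).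
Hypotheses (colc : coloring L c) (cold : tangle_coloring (tangle_of cc back L' par') d).
Hypothesis ends : same_ends (fun i s => c (strand_pt cc par i s)) d.

Definition glued p : X :=
  match pselect (inside p) with
  | left h => d (sval (cid h)) (th' (sval (cid h)) (s2val (cid2 (svalP (cid h)))))
  | right _ => c p
  end.

Lemma glued_in i t p : lo i <= t <= hi i -> same_point (cc i, t) p ->
  glued p = d i (th' i t).
Proof.
move=> tI tp; rewrite /glued; case: pselect => [h|[]]; last by exists i, t.
case: cid => j jp /=; case: cid2 => s sI /= sp_.
have ij : j = i by apply: (piece_disjoint good jp); exists t.
rewrite {}ij in jp sI sp_ *; congr (d i (th' i _)).
apply: (piece_param_inj good sI tI).
exact: same_point_trans (same_point_sym tp).
Qed.

Lemma glued_out p : ~ inside p -> glued p = c p.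
Proof. by rewrite /glued; case: pselect. Qed.

Lemma end_not_under i t : t = lo i \/ t = hi i -> ~ under L (cc i, t).
Proof.
move=> tE [p pt].
have : t = par i (-1) \/ t = par i 1.
  rewrite (strand_end_l good sp) (strand_end_r good sp).
  by case: tE => ->; case: back; [right|left|left|right].
case=> E; rewrite E in pt.
  have : -1 < (-1 : R) < 1 by apply: (sp_bd sp (i := i) (p := p)); [lra|left].
  by rewrite ltxx.
have : -1 < (1 : R) < 1 by apply: (sp_bd sp (i := i) (p := p)); [lra|left].
by rewrite ltxx andbF.
Qed.

Lemma glued_end i t : t = lo i \/ t = hi i -> glued (cc i, t) = c (cc i, t).
Proof.
move=> tE; have lh := piece_lt good i.
rewrite (@glued_in i t) //; [|by case: tE => ->; lra|exact: same_point_refl].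
have [E|E] : t = par' i (-1) \/ t = par' i 1.
  rewrite (strand_end_l good sp') (strand_end_r good sp').
  by case: tE => ->; case: back; [right|left|left|right].
- rewrite E (sp_thK sp'); last by lra.
  rewrite -(ends i).1 /strand_pt (strand_end_l good sp) (strand_end_l good sp') //.
- rewrite E (sp_thK sp'); last by lra.
  by rewrite -(ends i).2 /strand_pt (strand_end_r good sp) (strand_end_r good sp').
Qed.

(** The constancy of [d], in terms of the parameter of the component instead of
    the standard direction of the strand. *)
Lemma tangle_const i s t : lo i <= s -> s <= t -> t <= hi i ->
  under_free L' (cc i) s t -> d i (th' i s) = d i (th' i t).
Proof.
move=> ls st th_ H.
have [E|lt] := eqVneq s t; first by rewrite E.
have {}st : s < t by rewrite lt_neqAle lt.
have noun w : (if back i then th' i t <= w <= th' i s else th' i s <= w <= th' i t) ->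
    ~ tangle_under (tangle_of cc back L' par') i w.
  move=> /(strand_th_between sp' ls (ltW st) th_)[_ wI] [j [x [e [_ _ xw _]]]].
  by have [_] := H _ wI; apply; exists (strand_pt cc par' j x).
have sI : lo i <= s <= hi i by lra.
have tI : lo i <= t <= hi i by lra.
have [s1 s2] := andP (sp_th sp' sI); have [t1 t2] := andP (sp_th sp' tI).
have := strand_th_lt sp' ls st th_; case: back noun => noun le;
  [apply/esym|]; by apply: (tcol_const cold) => //; exact: ltW.
Qed.

(** At an end of a piece the two colorings that are glued agree, so that the
    result is locally constant there as well. *)
Lemma glued_coloring : coloring L' glued.
Proof.
apply: coloring_local_rep.
- move=> p q vp up pq; have [[i [t tI tp]]|op] := pselect (inside p).
    rewrite (glued_in tI tp) (glued_in tI) //.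
    exact: same_point_trans pq.
  have oq : ~ inside q.
    by move=> [i iq]; apply: op; exists i; exact: in_piece_same (same_point_sym pq) iq.
  rewrite !glued_out //; apply: (color_same colc) => //.
  by move/(under_outside op).
- move=> p vp up; have [[i [x xI xp]]|op] := pselect (inside p).
    exists (cc i, x); first exact: same_point_sym.
    have lh := piece_lt good i.
    have ux : ~ under L' (cc i, x) by move/(under_same xp).
    have vx := piece_valid good xI.
    have [e e0 He] := under_free_near vx ux.
    have inner t : `|t - x| < e -> lo i <= t <= hi i -> glued (cc i, t) = glued (cc i, x).
      move=> te tI; have vt := piece_valid good tI; have := He t te vt => /=.
      rewrite (glued_in tI (same_point_refl _)) (glued_in xI (same_point_refl _)).
      by case: (leP t x) => tx H; [|apply/esym]; apply: tangle_const => //; lra.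
    have outer y : y = lo i \/ y = hi i -> exists2 e, 0 < e & forall t, 
        `|t - y| < e -> ~ inside (cc i, t) -> glued (cc i, t) = glued (cc i, y).
      move=> yE; have yI : lo i <= y <= hi i by case: yE => ->; lra.
      have [f f0 Hf] := coloring_near colc (piece_valid good yI) (end_not_under yE).
      have [g g0 Hg] := piece_valid_near good yI.
      exists (Num.min f g); first by rewrite lt_min f0.
      move=> t; rewrite lt_min => /andP[tf tg] ot.
      by rewrite glued_out // Hf // ?glued_end //; exact: Hg.
    have [xl|xl] := eqVneq x (lo i).
      have [f f0 Hf] := outer x (or_introl xl).
      have [g g0 Hg] := before_piece good i.
      exists (Num.min (Num.min e f) (Num.min g (hi i - lo i))).
        by rewrite !lt_min e0 f0 g0 subr_gt0.
      move=> t /=; rewrite !lt_min => /andP[/andP[te tf] /andP[tg th_]] vt /=.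
      have := tg; have := th_; rewrite {1 2}xl !ltr_norml => th_' tg'.
      have [tl|tl] := ltP t (lo i); last by apply: inner => //; lra.
      by apply: Hf => //; apply: Hg; lra.
    have [xh|xh] := eqVneq x (hi i).
      have [f f0 Hf] := outer x (or_intror xh).
      have [g g0 Hg] := after_piece good i.
      exists (Num.min (Num.min e f) (Num.min g (hi i - lo i))).
        by rewrite !lt_min e0 f0 g0 subr_gt0.
      move=> t /=; rewrite !lt_min => /andP[/andP[te tf] /andP[tg th_]] vt /=.
      have := tg; have := th_; rewrite {1 2}xh !ltr_norml => th_' tg'.
      have [tl|tl] := ltP (hi i) t; last by apply: inner => //; lra.
      by apply: Hf => //; apply: Hg; lra.
    have {}xl : lo i < x by rewrite lt_neqAle eq_sym xl; case/andP: xI.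
    have {}xh : x < hi i by rewrite lt_neqAle xh; case/andP: xI.
    exists (Num.min e (Num.min (x - lo i) (hi i - x))).
      by rewrite !lt_min e0 !subr_gt0 xl.
    move=> t /=; rewrite !lt_min => /and3P[te]; rewrite ltr_norml => t1.
    by rewrite ltr_norml => t2 vt; apply: inner => //; lra.
  exists p; first exact: same_point_refl.
  have upL : ~ under L p by move/(under_outside op).
  have [e e0 He] := coloring_near colc vp upL.
  have [f f0 Hf] := not_in_some_piece_near good op.
  exists (Num.min e f); first by rewrite lt_min e0.
  move=> t; rewrite lt_min => /andP[te tf] vt.
  by rewrite !glued_out //; [exact: He|exact: Hf].
- move=> p q pq; have [vp vq] := crossing_valid pq.
  have [iq|oq] := pselect (inside q); last first.
    have op : ~ inside p by move=> /(sp_cross sp' pq).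
    have [cr pos] := out op oq.
    have pqL := cr.2 pq.
    exists p, q; split; try exact: same_point_refl.
    have [e e0 He] := crossing_near pqL.
    have [f f0 Hf] := not_in_some_piece_near good oq.
    exists (Num.min e f); first by rewrite lt_min e0.
    have me : Num.min e f <= e by rewrite ge_min lexx.
    have mf : Num.min e f <= f by rewrite ge_min lexx orbT.
    move=> s t sq qt; rewrite !glued_out //; try by apply: Hf; rewrite ltr_norml; lra.
    rewrite -pos //; apply: (color_cross colc pqL); first by lra.
    by apply: He; lra.
  have [i [u [uI uq]]] := inside_strand sp' iq.
  have [j [x [xI xp]]] := inside_strand sp' ((sp_cross sp' pq).2 iq).
  exists (strand_pt cc par' j x), (strand_pt cc par' i u).
  split; try exact: same_point_sym.
  have pq' := crossing_same (same_point_sym xp) (same_point_sym uq) pq.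
  have uI' : -1 < u < 1 by apply: (sp_bd sp' uI); left; exact: pq'.
  have [f f0 Hf] := crossing_near pq'; rewrite /= in Hf.
  have lh : lo i < par' i u /\ par' i u < hi i.
    have [u1 u2] := andP uI'.
    have := sp_mono sp' i (lexx _) u1 (ltW u2).
    have := sp_mono sp' i (ltW u1) u2 (lexx _).
    rewrite (strand_end_l good sp') (strand_end_r good sp').
    by case: (back i).
  exists (Num.min f (Num.min (par' i u - lo i) (hi i - par' i u))).
    by rewrite !lt_min f0 !subr_gt0 lh.1 lh.2.
  set M := Num.min f _.
  have Mf : M <= f by rewrite ge_min lexx.
  have Ml : M <= par' i u - lo i by rewrite !ge_min lexx orbT.
  have Mh : M <= hi i - par' i u by rewrite !ge_min lexx !orbT.
  move=> s t /= su ut.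
  have sI : lo i <= s <= hi i by lra.
  have tI : lo i <= t <= hi i by lra.
  have su' : par' i u - f < s < par' i u by lra.
  have ut' : par' i u < t < par' i u + f by lra.
  rewrite (glued_in sI (same_point_refl _)) (glued_in tI (same_point_refl _)).
  rewrite (@glued_in j (par' j x)); [|exact: (sp_par sp' j xI)|exact: same_point_refl].
  rewrite (sp_thK sp' j xI).
  have ucross : tangle_of cc back L' par' j x i u
      (positive L' (strand_pt cc par' j x) (strand_pt cc par' i u) (+) back i) by [].
  have [ls _] := andP sI; have [_ th_] := andP tI.
  have [s1 s2] := andP (sp_th sp' sI); have [t1 t2] := andP (sp_th sp' tI).
  have [su1 su2] := andP su; have [ut1 ut2] := andP ut.
  have only w : (if back i then th' i t <= w <= th' i s else th' i s <= w <= th' i t) ->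
      tangle_under (tangle_of cc back L' par') i w -> w = u.
    have st : s <= t by lra.
    move=> /(strand_th_between sp' ls st th_)[w1 wI] [y [z [e [_ _ yw _]]]].
    have [_ H] := Hf s t su' ut' _ wI.
    have yw' : under L' (cc i, par' i w) by exists (strand_pt cc par' y z).
    by have := H yw' => /(congr1 (th' i)); rewrite !(sp_thK sp').
  have := strand_th_lt sp' ls su2 (ltW lh.2); have := strand_th_lt sp' (ltW lh.1) ut1 th_.
  rewrite (sp_thK sp') //; move: ucross only; case: (back i) => ucross only ut0 su0.
    rewrite addbT in ucross.
    apply: (@qact_inj _ (~~ positive L' (strand_pt cc par' j x) (strand_pt cc par' i u)) (d j x)).
    by rewrite qactK; apply/esym; apply: (tcol_cross cold ucross).
  rewrite addbF in ucross.
  exact: (tcol_cross cold ucross).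
Qed.

End Glue.

End Gluing.

Section Transfer.
Variables (R : realType) (n k r : nat).
Local Notation pt := (source_pt R n k).
Variables (cc : 'I_r -> component n k) (lo hi : 'I_r -> R) (back : 'I_r -> bool).
Hypothesis good : good_pieces cc lo hi.
Implicit Types (p q : pt) (i j : 'I_r) (s t u : R) (L : diagram R n k).
Local Notation inside := (in_some_piece cc lo hi).

Lemma endpoint_outside p : is_endpoint p -> ~ inside p.
Proof.
move=> ep [i [t tI tp]]; case: p ep tp => b u /=; case: good => /(_ i)[_ +] _.
rewrite /is_endpoint; case: (cc i) => [j|j] /= H; case: b => [l|l] //=.
- by move=> [] -> [] _ /= E; rewrite E in tI; lra.
- by move=> _ [].
Qed.

Lemma agree_outside_sym L L' : agree_outside cc lo hi L L' -> agree_outside cc lo hi L' L.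
Proof.
move=> H p q op oq; have [E pos] := H p q op oq; split; first exact: iff_sym.
by move=> /E/pos.
Qed.

Lemma outside_near_end i y e : y = lo i \/ y = hi i -> 0 < e -> exists t,
  [/\ `|t - y| < e, t != y, valid (cc i, t) & ~ inside (cc i, t)].
Proof.
move=> yE e0; have lh := piece_lt good i.
have [|f f0 Hf] := @piece_valid_near _ _ _ _ _ _ _ good i y.
  by case: yE => ->; lra.
have [g g0 Hg] := before_piece good i; have [h h0 Hh] := after_piece good i.
pose M := Num.min (Num.min e f) (Num.min g h).
have M0 : 0 < M by rewrite !lt_min e0 f0 g0.
have Me : M <= e by rewrite !ge_min lexx.
have Mf : M <= f by rewrite !ge_min lexx orbT.
have Mg : M <= g by rewrite !ge_min lexx !orbT.
have Mh : M <= h by rewrite !ge_min lexx !orbT.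
case: yE => yE; [exists (y - M / 2)|exists (y + M / 2)].
  split; first by rewrite ltr_norml; lra.
  - by apply/eqP; lra.
  - by apply: Hf; rewrite ltr_norml; lra.
  - by apply: Hg; rewrite -yE; lra.
split; first by rewrite ltr_norml; lra.
- by apply/eqP; lra.
- by apply: Hf; rewrite ltr_norml; lra.
- by apply: Hh; rewrite -yE; lra.
Qed.

Section Uniqueness.
Variables (L : diagram R n k) (th par : 'I_r -> R -> R).
Hypothesis sp : strand_param cc lo hi back L th par.
Hypothesis det : ends_determine (tangle_of cc back L par).
Variables (X : quandle) (c d : pt -> X).
Hypotheses (colc : coloring L c) (cold : coloring L d).
Hypothesis cd : forall p, valid p -> ~ under L p -> ~ inside p -> c p = d p.

(** The ends are not undercrossings, so they have the color of the nearby points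
    outside of the pieces. *)
Lemma ends_agree i y : y = lo i \/ y = hi i -> c (cc i, y) = d (cc i, y).
Proof.
move=> yE; have lh := piece_lt good i.
have yI : lo i <= y <= hi i by case: yE => ->; lra.
have vy := piece_valid good yI; have uy := end_not_under good sp yE.
have [e e0 He] := coloring_near colc vy uy.
have [f f0 Hf] := coloring_near cold vy uy.
have [g g0 Hg] := under_isolated L (cc i) y.
have [|t [tM ty vt ot]] :=
    @outside_near_end i y (Num.min e (Num.min f g)) yE.
  by rewrite !lt_min e0 f0 g0.
move: tM; rewrite !lt_min => /and3P[te tf tg].
have t0 : 0 < `|t - y| by rewrite normr_gt0 subr_eq0.
rewrite -(He t) // -(Hf t) //; apply: cd => //.
by apply: Hg; rewrite t0.
Qed.

Lemma coloring_unique p : valid p -> ~ under L p -> c p = d p.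
Proof.
move=> vp up; have [ip|op] := pselect (inside p); last exact: cd.
have [i [s [sI sp_]]] := inside_strand sp ip.
have us : ~ under L (strand_pt cc par i s) by move/(under_same sp_).
have vs := strand_pt_valid good sp i sI.
rewrite -(color_same colc vs us sp_) -(color_same cold vs us sp_).
apply: (det (restrict_coloring good sp colc) (restrict_coloring good sp cold)) => //.
  move=> j; rewrite /strand_pt (strand_end_l good sp) (strand_end_r good sp).
  by split; apply: ends_agree; case: back; [right|left|left|right].
move=> [j [t [e [_ _ pq _]]]]; apply: us; exists (strand_pt cc par j t); exact: pq.
Qed.

End Uniqueness.

(** Replacing a tangle by an equivalent one keeps the quandle: a coloring of one
    diagram restricts to the tangle, is exchanged for a coloring of the other
    tangle with the same ends, and is glued back to the untouched outside. *)
Lemma tangle_replacement_isomorphic L L' (th par th' par' : 'I_r -> R -> R) :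
  strand_param cc lo hi back L th par -> strand_param cc lo hi back L' th' par' ->
  agree_outside cc lo hi L L' ->
  tangle_equivalent (tangle_of cc back L par) (tangle_of cc back L' par') ->
  pointed_isomorphic (fundamental_pointed_quandle L)
    (fundamental_pointed_quandle L').
Proof.
move=> sp sp' out [ext ext' det det'].
have out' := agree_outside_sym out.
pose S p p' := [/\ p = p', valid p, ~ under L p & ~ inside p].
apply: (@iso_by_transfer _ _ _ _ _ S).
- move=> p ep; have [vp up] := endpoint_valid L ep.
  by split=> //; exact: endpoint_outside.
- move=> p p' [<- vp up op]; split=> //.
  by move/(under_outside sp' out' op).
- move=> X c colc; have [d cold ends] := ext X _ (restrict_coloring good sp colc).
  exists (glued cc lo hi th' c d); first exact: (glued_coloring good sp sp' out colc cold ends).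
  by move=> p p' [<- vp up op]; rewrite glued_out.
- move=> X c colc; have [d cold ends] := ext' X _ (restrict_coloring good sp' colc).
  exists (glued cc lo hi th c d); first exact: (glued_coloring good sp' sp out' colc cold ends).
  by move=> p p' [<- vp up op]; rewrite glued_out.
- move=> X c d colc cold cd p vp up.
  by apply: (coloring_unique sp det colc cold) => // q vq uq oq; exact: (cd q q).
- move=> X c d colc cold cd p vp up.
  apply: (coloring_unique sp' det' colc cold) => // q vq uq oq; apply: (cd q q).
  by split=> //; move/(under_outside sp out oq).
Qed.

End Transfer.

(** ** Curves in the disc *)

Section DiscCurves.
Variables (R : realType) (n k r : nat).
Local Notation pt := (source_pt R n k).
Implicit Types (p q : pt) (i j : 'I_r) (s t u : R) (L : diagram R n k).

Definition det2 (a b : 'rV[R]_2) : R := coord a 0 * coord b 1 - coord a 1 * coord b 0.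

(** The last condition keeps the crossings away from the ends of the pieces, where
    the colors are prescribed. *)
Record curve_system (sigma dsigma : 'I_r -> R -> 'rV[R]_2) : Prop := CurveSystem {
  cs_disc : forall i s, -1 <= s <= 1 -> on_disc (sigma i s);
  cs_derivable : forall i s, derivable (sigma i : R -> 'rV[R]_2) s 1;
  cs_derive : forall i s, (sigma i)^`()%classic s = dsigma i s;
  cs_meet : forall i j s t, -1 <= s <= 1 -> -1 <= t <= 1 ->
    sigma i s = sigma j t -> (i = j /\ s = t) \/ (-1 < s < 1 /\ -1 < t < 1) }.

Lemma smooth_decreasing (f : R -> R) a b : smooth (f : R^o -> R^o) ->
  (forall t, a <= t <= b -> f^`()%classic t < 0) ->
  forall s t, a <= s -> s < t -> t <= b -> f t < f s.
Proof.
move=> sf fp s t as_ st tb; apply: (@ltr0_derive1_lt_cc _ f a b) => //.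
- by move=> x _; exact: smooth_derivable.
- by move=> x; rewrite in_itv /= => /andP[ax xb]; apply: fp; rewrite !ltW.
- exact: smooth_continuous.
- by rewrite in_itv /=; lra.
- by rewrite in_itv /=; lra.
Qed.

Lemma derive_vec2 (W : normedModType R) (phi : 'rV[R]_2 -> W) x v :
  differentiable phi x -> 'D_v phi x =
  coord v 0 *: 'D_(delta_mx 0 0) phi x + coord v 1 *: 'D_(delta_mx 0 1) phi x.
Proof.
move=> dphi; rewrite !deriveE //.
have {1}-> : v = coord v 0 *: delta_mx 0 0 + coord v 1 *: delta_mx 0 1.
  apply/rowP => i; rewrite !mxE /= coordE.
  by case: i => -[|[|//]] ? /=; rewrite ?mulr1 ?mulr0 ?addr0 ?add0r.
by rewrite linearD !linearZ.
Qed.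

Lemma triple_frame_sign (a b : 'rV[R]_2) (e f x : 'rV[R]_3) (c c' : R) (bi bj : bool) :
  0 < triple e f x -> 0 < c -> 0 < c' ->
  let T := triple (((-1) ^+ bi * c) *: (coord a 0 *: e + coord a 1 *: f))
    (((-1) ^+ bj * c') *: (coord b 0 *: e + coord b 1 *: f)) x in
  T != 0 -> (0 < T) = (0 < det2 a b) (+) bi (+) bj.
Proof.
move=> K0 c0 c'0; rewrite /= !scalerDr !scalerA triple_comb.
set D := (X in X * _); have -> : D = (-1) ^+ bi * (-1) ^+ bj * (c * c' * det2 a b).
  by rewrite /D /det2; ring.
clear D; set d := det2 a b => TN0.
have {TN0} d0 : d != 0 by apply: contra_neq TN0 => ->; rewrite !mulr0 mul0r.
rewrite pmulr_lgt0 //; have cc0 : 0 < c * c' by rewrite mulr_gt0.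
have cd : (0 < - (c * c' * d)) = ~~ (0 < d).
  by rewrite oppr_gt0 pmulr_rlt0 // -leNgt le_eqVlt (negPf d0).
by case: bi; case: bj; rewrite ?expr1 ?expr0 ?mulrNN ?mul1r ?mulr1 ?mulN1r
  ?addbT ?addbF ?negbK ?cd // pmulr_rgt0.
Qed.

Variables (cc : 'I_r -> component n k) (lo hi : 'I_r -> R) (back : 'I_r -> bool).
Hypothesis good : good_pieces cc lo hi.
Local Notation inside := (in_some_piece cc lo hi).

Section OneDisc.
Variables (L : diagram R n k) (phi : 'rV[R]_2 -> 'rV[R]_3).
Variables (sigma dsigma : 'I_r -> R -> 'rV[R]_2) (height : 'I_r -> nat).
Hypothesis emb : disc_embedding phi.
Hypothesis tan : tangle_in_disc cc lo hi L phi sigma back height.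
Hypothesis sys : curve_system sigma dsigma.

Record disc_param (th par : 'I_r -> R -> R) : Prop := DiscParam {
  dp_strand : strand_param cc lo hi back L th par;
  dp_pos : forall i s, -1 <= s <= 1 ->
    position L (strand_pt cc par i s) = phi (sigma i s);
  dp_vel : forall i s, -1 < s < 1 -> exists2 c : R, 0 < c &
    velocity L (strand_pt cc par i s) =
    ((-1) ^+ back i * c) *: 'D_(dsigma i s) phi (sigma i s) }.

(** Only the pieces enter the disc, so a crossing with a point of a piece is a
    crossing of two pieces. *)
Lemma disc_point_inside p x : valid p -> on_disc x -> position L p = phi x -> inside p.
Proof.
move=> vp xD E; apply: contrapT => op; case: tan => _ /(_ p) H _; apply: H xD E.
by split=> // i ip; apply: op; exists i.
Qed.

Lemma disc_param_exists : exists th par, disc_param th par.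
Proof.
have [/choice[th thP] _ _] := tan; have [sphi _ inj _] := emb.
have thl i : th i (lo i) = - (-1) ^+ back i by have [] := thP i.
have thh i : th i (hi i) = (-1) ^+ back i by have [] := thP i.
have mono i s t : lo i <= s -> s < t -> t <= hi i ->
    if back i then th i t < th i s else th i s < th i t.
  have [sth _ _ dth _] := thP i; case: (back i) dth => dth.
    apply: (smooth_decreasing sth) => u /dth; rewrite expr1; lra.
  by apply: (smooth_increasing sth) => u /dth; rewrite expr0 mul1r.
have mono_le i s t : lo i <= s -> s <= t -> t <= hi i ->
    if back i then th i t <= th i s else th i s <= th i t.
  move=> ls; rewrite le_eqVlt => /orP[/eqP -> _|st th_]; first by case: back.
  by have := mono i s t ls st th_; case: back => /ltW.
have thI i t : lo i <= t <= hi i -> -1 <= th i t <= 1.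
  move=> /andP[lt th_].
  have := mono_le i _ _ (lexx _) lt th_; have := mono_le i _ _ lt th_ (lexx _).
  by rewrite thl thh; case: (back i); rewrite ?expr1 ?expr0; lra.
have thinj i s t : lo i <= s <= hi i -> lo i <= t <= hi i -> th i s = th i t -> s = t.
  move=> /andP[s1 s2] /andP[t1 t2] E; case: (ltgtP s t) => // lt.
    by have := mono i s t s1 lt t2; rewrite E; case: back; rewrite ltxx.
  by have := mono i t s t1 lt s2; rewrite E; case: back; rewrite ltxx.
have /choice[par parP] : forall i, exists g : R -> R, forall s, -1 <= s <= 1 ->
    lo i <= g s <= hi i /\ th i (g s) = s.
  move=> i; suff /choice[g gP] : forall s, exists x,
      -1 <= s <= 1 -> lo i <= x <= hi i /\ th i x = s by exists g.
  move=> s; have [sI|sI] := pselect (-1 <= s <= 1); last by exists 0.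
  have [|||x] := @IVT R (th i) (lo i) (hi i) s.
  - exact/ltW/(piece_lt good).
  - by have [sth _ _ _ _] := thP i; exact: smooth_continuous.
  - by rewrite thl thh ge_min le_max; case: (back i); rewrite ?expr1 ?expr0; lra.
  - by rewrite in_itv /= => xI <-; exists x.
have parI i s : -1 <= s <= 1 -> lo i <= par i s <= hi i by move=> /(parP i)[].
have parK i s : -1 <= s <= 1 -> th i (par i s) = s by move=> /(parP i)[].
have thK i t : lo i <= t <= hi i -> par i (th i t) = t.
  by move=> tI; apply: (thinj i) => //; rewrite ?parK ?parI ?thI.
have pos i s : -1 <= s <= 1 -> position L (strand_pt cc par i s) = phi (sigma i s).
  move=> sI; have [_ _ _ _ E] := thP i.
  by rewrite /position /= E ?parI // parK.
have sp_mono i s s' : -1 <= s -> s < s' -> s' <= 1 ->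
    if back i then par i s' < par i s else par i s < par i s'.
  move=> s1 ss s2; have sI : -1 <= s <= 1 by lra.
  have sI' : -1 <= s' <= 1 by lra.
  have [p1 p2] := andP (parI i s sI); have [q1 q2] := andP (parI i s' sI').
  have le1 := mono_le i _ _ p1 _ q2; have le2 := mono_le i _ _ q1 _ p2.
  rewrite !parK // in le1 le2.
  by case: (back i) le1 le2 => le1 le2; rewrite ltNge; apply/negP;
    [move/le1|move/le2]; lra.
have cross_in p q : double_point (strand L) p q -> inside p -> inside q.
  move=> [vp vq _ E] [i [t tI tp]]; have tI' := thI i t tI.
  apply: (@disc_point_inside q (sigma i (th i t)) vq (cs_disc sys i tI')).
  by rewrite -pos // /strand_pt thK // (position_same L tp) /position E.
have meet p i s : -1 <= s <= 1 -> double_point (strand L) p (strand_pt cc par i s) ->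
    -1 < s < 1.
  move=> sI d; have iP : inside (strand_pt cc par i s).
    by exists i; apply: in_piece_self; exact: parI.
  have [j [t tI tp]] := cross_in _ _ (double_point_sym d) iP.
  have tI' := thI j t tI; have [vp _ ns E] := d.
  have : sigma j (th j t) = sigma i s.
    apply: inj; try exact: (cs_disc sys).
    by rewrite -!pos // /strand_pt thK // (position_same L tp).
  case/(cs_meet sys tI' sI) => [[ji ts]|[]//].
  by exfalso; apply: ns; rewrite /strand_pt -ts -ji thK //; exact: same_point_sym.
exists th, par; split=> //.
- split=> //.
  + by move=> p q [d _]; split; apply: cross_in => //; exact: double_point_sym.
  + by move=> i s p sI [[d _]|[d _]]; [exact: meet d|exact/meet/double_point_sym/d].
- move=> i s sI; have [sth _ _ dth E] := thP i.
  have sI' : -1 <= s <= 1 by lra.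
  have pI := parI i s sI'; have [p1 p2] := andP pI.
  exists ((-1) ^+ back i * (th i)^`()%classic (par i s)); first exact: dth.
  have lh := piece_lt good i.
  have pl : par i s != lo i.
    by apply/eqP => pE; have := parK i s sI'; rewrite pE thl; case: back; rewrite ?expr1 ?expr0; lra.
  have ph : par i s != hi i.
    by apply/eqP => pE; have := parK i s sI'; rewrite pE thh; case: back; rewrite ?expr1 ?expr0; lra.
  have {}pl : lo i < par i s by rewrite lt_neqAle eq_sym pl.
  have {}ph : par i s < hi i by rewrite lt_neqAle ph.
  rewrite mulrA -expr2 sqrr_sign mul1r.
  pose e := Num.min (par i s - lo i) (hi i - par i s).
  have e0 : 0 < e by rewrite lt_min !subr_gt0 pl.
  transitivity ((phi \o (sigma i \o th i))^`()%classic (par i s)).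
    apply: (derive1_near e0) => t /=; rewrite lt_min !ltr_norml => tI.
    by rewrite E //; lra.
  have dsth : derivable (th i : R^o -> R^o) (par i s) 1 by exact: smooth_derivable.
  have dsig : differentiable (sigma i : R^o -> 'rV[R]_2) (th i (par i s)).
    by apply/derivable1_diffP; exact: (cs_derivable sys).
  have dcomp : derivable (sigma i \o th i) (par i s) 1.
    apply/derivable1_diffP; apply: differentiable_comp => //.
    exact: smooth_differentiable.
  have dphi x : differentiable phi x by exact: smooth_differentiable.
  rewrite (derive1_chain (dphi _) dcomp) /=.
  rewrite (derive1_reparam dsig dsth) (cs_derive sys) parK // !deriveE //.
  exact: linearZ.
Qed.

Variables (th par : 'I_r -> R -> R).
Hypothesis dp : disc_param th par.
Local Notation P := (strand_pt cc par).

Lemma disc_same_point i j s t : -1 <= s <= 1 -> -1 <= t <= 1 ->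
  same_point (P i s) (P j t) <-> i = j /\ s = t.
Proof.
move=> sI tI; split; first exact: (strand_pt_inj good (dp_strand dp)).
by move=> [-> ->]; exact: same_point_refl.
Qed.

Lemma disc_double_point i j s t : -1 <= s <= 1 -> -1 <= t <= 1 ->
  double_point (strand L) (P i s) (P j t) <->
  ~ (i = j /\ s = t) /\ sigma i s = sigma j t.
Proof.
move=> sI tI; have [_ _ inj _] := emb.
have vs := strand_pt_valid good (dp_strand dp) i sI.
have vt := strand_pt_valid good (dp_strand dp) j tI.
split=> [[_ _ ns E]|[ns E]]; split=> //.
- by move/(disc_same_point i j sI tI).
- apply: inj; try exact: (cs_disc sys).
  by rewrite -(dp_pos dp i sI) -(dp_pos dp j tI).
- by move/(disc_same_point i j sI tI).
- by rewrite -!/(position L _) (dp_pos dp i sI) (dp_pos dp j tI) E.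
Qed.

(** The disc is embedded with its orientation, so the sign of a crossing can be
    read off from the standard curves, up to the reversal of each strand. *)
Lemma disc_positive i j s t : -1 <= s <= 1 -> -1 <= t <= 1 ->
  double_point (strand L) (P i s) (P j t) ->
  positive L (P i s) (P j t) =
    (0 < det2 (dsigma i s) (dsigma j t)) (+) back i (+) back j.
Proof.
move=> sI tI d; have [sphi _ _ /(_ (sigma i s) (cs_disc sys i sI)) K0] := emb.
have [ns E] := (disc_double_point i j sI tI).1 d.
have [//|[sI' tI']] := cs_meet sys sI tI E.
have [c c0 vs] := dp_vel dp i sI'; have [c' c'0 vt] := dp_vel dp j tI'.
have dphi x : differentiable phi x by exact: smooth_differentiable.
have T0 : triple (velocity L (P i s)) (velocity L (P j t)) (position L (P i s)) != 0.
  exact: double_transverse d.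
rewrite (derive_vec2 _ (dphi _)) in vs; rewrite -E (derive_vec2 _ (dphi _)) in vt.
rewrite /positive; move: T0; rewrite vs vt (dp_pos dp i sI).
exact: triple_frame_sign.
Qed.

Lemma disc_over i j s t : -1 <= s <= 1 -> -1 <= t <= 1 -> i != j ->
  double_point (strand L) (P i s) (P j t) ->
  is_over L (P i s) (P j t) <-> (height j < height i)%N.
Proof.
move=> sI tI /eqP ij d; have [_ _ H] := tan; apply: (H i j _ _ _ _ ij d).
- exact: (strand_pt_in (dp_strand dp)).
- exact: (strand_pt_in (dp_strand dp)).
Qed.

Lemma disc_tangle j t i u e : tangle_of cc back L par j t i u e <->
  [/\ -1 <= t <= 1, -1 <= u <= 1, ~ (j = i /\ t = u) /\ sigma j t = sigma i u,
      is_over L (P j t) (P i u) &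
      e = (0 < det2 (dsigma j t) (dsigma i u)) (+) back j].
Proof.
split=> [[tI uI [d o] eE]|[tI uI d o eE]].
  by split=> //; [exact/disc_double_point|rewrite eE disc_positive // -addbA addbb addbF].
have d' := (disc_double_point j i tI uI).2 d.
by split=> //; rewrite disc_positive // -addbA addbb addbF.
Qed.

End OneDisc.

End DiscCurves.

Section LocalMoves.
Variables (R : realType) (r : nat).
Implicit Types (i j : 'I_r) (s t u : R).

(** What a diagram retains of a system of standard curves: which of the two
    passages at a double point is over, subject to the heights for two different
    curves and arbitrary for a curve crossing itself. *)
Definition curve_tangle (sigma dsigma : 'I_r -> R -> 'rV[R]_2)
    (back : 'I_r -> bool) (height : 'I_r -> nat) (tc : tangle_crossings R r) : Prop :=
  exists ov : 'I_r -> R -> 'I_r -> R -> Prop,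
  [/\ forall i j s t, -1 <= s <= 1 -> -1 <= t <= 1 -> ~ (i = j /\ s = t) ->
        sigma i s = sigma j t -> ov i s j t <-> ~ ov j t i s,
      forall i j s t, -1 <= s <= 1 -> -1 <= t <= 1 -> i != j ->
        sigma i s = sigma j t -> ov i s j t <-> (height j < height i)%N &
      forall j t i u e, tc j t i u e <->
        [/\ -1 <= t <= 1, -1 <= u <= 1, ~ (j = i /\ t = u) /\ sigma j t = sigma i u,
          ov j t i u & e = (0 < det2 (dsigma j t) (dsigma i u)) (+) back j]].

Definition curves_equivalent (sigma dsigma sigma' dsigma' : 'I_r -> R -> 'rV[R]_2) :=
  forall (back : 'I_r -> bool) (height : 'I_r -> nat) (tc tc' : tangle_crossings R r),
  injective height -> curve_tangle sigma dsigma back height tc ->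
  curve_tangle sigma' dsigma' back height tc' -> tangle_equivalent tc tc'.

Lemma curves_equivalent_sym sigma dsigma sigma' dsigma' :
  curves_equivalent sigma dsigma sigma' dsigma' ->
  curves_equivalent sigma' dsigma' sigma dsigma.
Proof.
move=> H back height tc tc' hi ct ct'; apply/tangle_equivalent_sym.
exact: H ct' ct.
Qed.

Variables (n k : nat).
Implicit Types L : diagram R n k.

Lemma outside_agree (cc : 'I_r -> component n k) (lo hi : 'I_r -> R) L L' :
  good_pieces cc lo hi ->
  (forall p, outside cc lo hi p -> position L p = position L' p) ->
  (forall p q, outside cc lo hi p -> outside cc lo hi q ->
     double_point (strand L) p q -> is_over L p q <-> is_over L' p q) ->
  agree_outside cc lo hi L L'.
Proof.
move=> good posE overE p q op oq.
have outP p' : valid p' -> ~ in_some_piece cc lo hi p' -> outside cc lo hi p'.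
  by move=> vp' op'; split=> // i ip'; apply: op'; exists i.
have dbl : valid p -> valid q -> position L p = position L q <-> position L' p = position L' q.
  by move=> vp vq; rewrite !posE //; exact: outP.
split.
  split=> -[d o]; have [vp vq ns E] := d.
    split; first by split=> //; apply/(dbl vp vq).
    by apply/overE => //; exact: outP.
  have d' : double_point (strand L) p q by split=> //; apply/(dbl vp vq).
  by split=> //; apply/overE => //; exact: outP.
move=> pq; have [vp vq] := crossing_valid pq.
have [ep eq] := crossing_not_endpoint pq.
have vel p' : valid p' -> ~ is_endpoint p' -> ~ in_some_piece cc lo hi p' ->
    velocity L p' = velocity L' p'.
  move=> vp' ep' op'; have [e e0 He] := valid_near vp' ep'.
  have [f f0 Hf] := not_in_some_piece_near good op'.
  have m0 : 0 < Num.min e f by rewrite lt_min e0.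
  apply: (derive1_near m0) => t; rewrite lt_min => /andP[te tf].
  by apply: (posE (p'.1, t)); apply: outP; [exact: He|exact: Hf].
by rewrite /positive !vel // posE //; exact: outP.
Qed.

Lemma disc_curve_tangle (cc : 'I_r -> component n k) lo hi back height L phi
    sigma dsigma th par :
  good_pieces cc lo hi -> disc_embedding phi ->
  tangle_in_disc cc lo hi L phi sigma back height -> curve_system sigma dsigma ->
  disc_param cc lo hi back L phi sigma dsigma th par ->
  curve_tangle sigma dsigma back height (tangle_of cc back L par).
Proof.
move=> good emb tan sys dp.
exists (fun i s j t => is_over L (strand_pt cc par i s) (strand_pt cc par j t)); split.
- move=> i j s t sI tI ns E; apply: over_asym.
  exact/(disc_double_point good emb sys dp).
- move=> i j s t sI tI ij E; apply: (disc_over tan dp) => //.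
  by apply/(disc_double_point good emb sys dp) => //; split=> // -[/eqP]; rewrite (negPf ij).
- by move=> j t i u e; exact: (disc_tangle good emb sys dp).
Qed.

Lemma local_replacement_isomorphic sigma dsigma sigma' dsigma' L L' :
  curve_system sigma dsigma -> curve_system sigma' dsigma' ->
  curves_equivalent sigma dsigma sigma' dsigma' ->
  local_replacement sigma sigma' L L' ->
  pointed_isomorphic (fundamental_pointed_quandle L)
    (fundamental_pointed_quandle L').
Proof.
move=> sys sys' eqv [cc [lo [hi [phi [phi' [back [height]]]]]]].
move=> [[good hinj] [emb emb' _ _] tan tan' [posE overE]].
have [th [par dp]] := disc_param_exists good emb tan sys.
have [th' [par' dp']] := disc_param_exists good emb' tan' sys'.
apply: (tangle_replacement_isomorphic good (dp_strand dp) (dp_strand dp')).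
  exact: outside_agree.
exact: eqv hinj (disc_curve_tangle good emb tan sys dp)
  (disc_curve_tangle good emb' tan' sys' dp').
Qed.

Lemma local_move_isomorphic sigma dsigma sigma' dsigma' L L' :
  curve_system sigma dsigma -> curve_system sigma' dsigma' ->
  curves_equivalent sigma dsigma sigma' dsigma' ->
  local_move sigma sigma' L L' \/ local_move sigma' sigma L L' ->
  pointed_isomorphic (fundamental_pointed_quandle L)
    (fundamental_pointed_quandle L').
Proof.
move=> sys sys' eqv [[L1 LL1 rep]|[L1 LL1 rep]];
  apply: pointed_isomorphic_trans (same_diagram_isomorphic LL1) _.
  exact: (local_replacement_isomorphic sys sys' eqv rep).
exact: (local_replacement_isomorphic sys' sys (curves_equivalent_sym eqv) rep).
Qed.

End LocalMoves.

(** * The three moves on colors *)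

Section TangleFacts.
Variables (R : realType) (r : nat) (tc : tangle_crossings R r).
Variables (X : quandle) (d : 'I_r -> R -> X).
Hypothesis cold : tangle_coloring tc d.
Implicit Types (i j : 'I_r) (s t u : R).

Lemma tcol_left i s : -1 <= s <= 1 ->
  (forall u, u <= s -> ~ tangle_under tc i u) -> d i s = d i (-1).
Proof.
move=> sI H; apply/esym; apply: (tcol_const cold); try lra.
by move=> u uI; apply: H; lra.
Qed.

Lemma tcol_right i s : -1 <= s <= 1 ->
  (forall u, s <= u -> ~ tangle_under tc i u) -> d i s = d i 1.
Proof.
move=> sI H; apply: (tcol_const cold); try lra.
by move=> u uI; apply: H; lra.
Qed.

End TangleFacts.

Definition step3 (R : realType) (X : Type) (x y z : X) (u v s : R) :=
  if s < u then x else if s < v then y else z.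

Lemma step3_const (R : realType) (X : Type) (x y z : X) (u v s s' : R) : s <= s' ->
  ~ (s <= u <= s') -> ~ (s <= v <= s') -> step3 x y z u v s = step3 x y z u v s'.
Proof.
move=> ss Hu Hv; rewrite /step3.
have -> : (s < u) = (s' < u).
  by apply/idP/idP => h; [rewrite ltNge; apply/negP => h'; apply: Hu|]; lra.
have -> // : (s < v) = (s' < v).
by apply/idP/idP => h; [rewrite ltNge; apply/negP => h'; apply: Hv|]; lra.
Qed.

Lemma step3_l (R : realType) (X : Type) (x y z : X) (u v s : R) :
  s < u -> step3 x y z u v s = x.
Proof. by rewrite /step3 => ->. Qed.

Lemma step3_m (R : realType) (X : Type) (x y z : X) (u v s : R) :
  u <= s -> s < v -> step3 x y z u v s = y.
Proof. by move=> us sv; rewrite /step3 ltNge us sv. Qed.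

Lemma step3_r (R : realType) (X : Type) (x y z : X) (u v s : R) :
  u <= s -> v <= s -> step3 x y z u v s = z.
Proof. by move=> us vs; rewrite /step3 !ltNge us vs. Qed.

Section NoCrossing.
Variables (R : realType) (r : nat) (tc : tangle_crossings R r).
Hypothesis empty : forall j t i u e, ~ tc j t i u e.

Lemma no_under i u : ~ tangle_under tc i u.
Proof. by move=> [j [t [e]]]; exact: empty. Qed.

Lemma crossingless_const (X : quandle) (d : 'I_r -> R -> X) i s :
  tangle_coloring tc d -> -1 <= s <= 1 -> d i s = d i (-1).
Proof. by move=> cold sI; apply: (tcol_left cold) => // u _; exact: no_under. Qed.

Lemma const_crossingless (X : quandle) (d : 'I_r -> X) :
  tangle_coloring tc (fun i (_ : R) => d i).
Proof. by split=> // j t i u e s s' /empty. Qed.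

Lemma crossingless_determine : ends_determine tc.
Proof.
move=> X d d' cold cold' ends i s sI _.
by rewrite (crossingless_const i cold sI) (crossingless_const i cold' sI) (ends i).1.
Qed.

End NoCrossing.

(** The overpassing point of a kink carries the color of the strand before or
    after its undercrossing; in both cases idempotence makes the two colors
    equal. *)
Lemma kink_equivalent (R : realType) (tc tc' : tangle_crossings R 1) (t0 u0 : R) e0 :
  (forall j t i u e, ~ tc j t i u e) ->
  (forall j t i u e, tc' j t i u e <-> [/\ t = t0, u = u0 & e = e0]) ->
  -1 < u0 < 1 -> -1 < t0 < 1 -> t0 != u0 -> tangle_equivalent tc tc'.
Proof.
move=> empty tcE u0I t0I tu0.
have underE i u : tangle_under tc' i u <-> u = u0.
  split=> [[j [t [e /tcE[]]]]//|->]; exists i, t0, e0; exact/tcE.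
have left (X : quandle) (d : 'I_1 -> R -> X) i s : tangle_coloring tc' d ->
    -1 <= s < u0 -> d i s = d i (-1).
  move=> cold sI; apply: (tcol_left cold); first by lra.
  by move=> u us /underE; lra.
have right (X : quandle) (d : 'I_1 -> R -> X) i s : tangle_coloring tc' d ->
    u0 < s <= 1 -> d i s = d i 1.
  move=> cold sI; apply: (tcol_right cold); first by lra.
  by move=> u us /underE; lra.
have through (X : quandle) (d : 'I_1 -> R -> X) i : tangle_coloring tc' d ->
    d i (-1) = d i 1.
  move=> cold.
  have E : d i 1 = qact e0 (d i (-1)) (d i t0).
    apply: (tcol_cross cold (u := u0)); try lra; first exact/tcE.
    by move=> w _ /underE.
  case: (ltgtP t0 u0) => [lt|lt|/eqP]; last by rewrite (negPf tu0).
    by rewrite E (left X d i t0) ?qact_idem //; lra.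
  rewrite (right X d i t0) // in E; last by lra.
  by rewrite (qact_eqV (esym E)) qact_idem.
split.
- move=> X d cold; exists (fun i _ => d i (-1)).
    split=> // j t i u e s s' /tcE[_ _ _] _ _ _ _ _.
    by rewrite (ord1 i) (ord1 j) qact_idem.
  move=> i; split=> //; apply: (crossingless_const empty _ cold); lra.
- move=> X d cold; exists (fun i _ => d i (-1)).
    exact: (const_crossingless empty (fun i => d i (-1))).
  by move=> i; split=> //; rewrite -through.
- exact: crossingless_determine.
- move=> X d d' cold cold' ends i s sI /underE su.
  case: (ltgtP s u0) => [lt|lt|//].
    by rewrite left ?(left X d') ?(ends i).1 //; lra.
  by rewrite right ?(right X d') ?(ends i).2 //; lra.
Qed.

(** Strand [b] passes under [a] twice, with opposite signs: the second action is
    the inverse of the first, and the color in between is forced. *)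
Lemma overlap_equivalent (R : realType) (tc tc' : tangle_crossings R 2) (a b : 'I_2)
    (v : R) e0 :
  (forall j t i u e, ~ tc j t i u e) ->
  (forall i, i = a \/ i = b) -> a != b -> 0 < v < 1 ->
  (forall j t i u e, tc' j t i u e <-> [/\ j = a, i = b, t = u &
     (u = - v /\ e = e0) \/ (u = v /\ e = ~~ e0)]) ->
  tangle_equivalent tc tc'.
Proof.
move=> empty abP ab vI tcE.
have underE i u : tangle_under tc' i u <-> i = b /\ (u = - v \/ u = v).
  split=> [[j [t [e /tcE[_ -> _ [[-> _]|[-> _]]]]]]|[->]].
  - by split=> //; left.
  - by split=> //; right.
  case=> ->; [exists a, (- v), e0|exists a, v, (~~ e0)]; apply/tcE; split=> //.
    by left.
  by right.
have top (X : quandle) (d : 'I_2 -> R -> X) s : tangle_coloring tc' d ->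
    -1 <= s <= 1 -> d a s = d a (-1).
  by move=> cold sI; apply: (tcol_left cold) => // u _ /underE[/eqP]; rewrite (negPf ab).
have left (X : quandle) (d : 'I_2 -> R -> X) s : tangle_coloring tc' d ->
    -1 <= s < - v -> d b s = d b (-1).
  move=> cold sI; apply: (tcol_left cold); first by lra.
  by move=> u us /underE[_ []]; lra.
have right (X : quandle) (d : 'I_2 -> R -> X) s : tangle_coloring tc' d ->
    v < s <= 1 -> d b s = d b 1.
  move=> cold sI; apply: (tcol_right cold); first by lra.
  by move=> u us /underE[_ []]; lra.
have mid (X : quandle) (d : 'I_2 -> R -> X) s : tangle_coloring tc' d ->
    - v < s < v -> d b s = qact e0 (d b (-1)) (d a (-1)).
  move=> cold sI; rewrite -(top X d (- v) cold); last by lra.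
  apply: (tcol_cross cold (u := - v)); try lra; last by move=> w wI /underE[_ []]; lra.
  by apply/tcE; split=> //; left.
have through (X : quandle) (d : 'I_2 -> R -> X) i : tangle_coloring tc' d ->
    d i 1 = d i (-1).
  move=> cold; case: (abP i) => ->; first by apply: top => //; lra.
  transitivity (qact (~~ e0) (d b 0) (d a v)).
    apply: (tcol_cross cold (u := v)); try lra; last by move=> w wI /underE[_ []]; lra.
    by apply/tcE; split=> //; right.
  by rewrite (top X d v) ?(mid X d 0) ?qactK //; lra.
split.
- move=> X d cold.
  pose B := d b (-1); pose A := d a (-1).
  exists (fun i s => if i == b then step3 B (qact e0 B A) B (- v) v s else A).
    split=> [i s s' s1 ss s2 H|j t i u e s s' /tcE[-> -> -> ue] s1 su us s2 H].
      case: eqP => // ib; apply: step3_const => // uI.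
        by apply: (H (- v) uI); apply/underE; split=> //; left.
      by apply: (H v uI); apply/underE; split=> //; right.
    rewrite eqxx (negPf ab).
    case: ue => [[uE ->]|[uE ->]]; rewrite uE in su us H.
      have vs : s' < v.
        rewrite ltNge; apply/negP => vs; have : v = - v; last by lra.
        by apply: H; [lra|apply/underE; split=> //; right].
      by rewrite (step3_l _ _ _ _ su) (step3_m _ _ _ (ltW us) vs).
    have vs : - v < s.
      rewrite ltNge; apply/negP => vs; have : - v = v; last by lra.
      by apply: H; [lra|apply/underE; split=> //; left].
    by rewrite (step3_m _ _ _ (ltW vs) su) (step3_r _ _ _ (ltW (lt_trans vs (lt_trans su us))) (ltW us)) qactK.
  move=> i; have E : d i 1 = d i (-1) by apply: crossingless_const => //; lra.
  rewrite E; case: (abP i) => ->.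
    by rewrite (negPf ab).
  by rewrite eqxx /B; split; [rewrite step3_l //; lra|rewrite step3_r //; lra].
- move=> X d cold; exists (fun i _ => d i (-1)).
    exact: (const_crossingless empty (fun i => d i (-1))).
  by move=> i; split=> //; rewrite through.
- exact: crossingless_determine.
- move=> X d d' cold cold' ends i s sI; rewrite underE => su.
  case: (abP i) => E; rewrite {i}E in su *.
    by rewrite top // (top X d') // (ends a).1.
  have [lt|le] := ltP s (- v).
    by rewrite left ?(left X d') ?(ends b).1 //; lra.
  have [lt|le'] := ltP v s.
    by rewrite right ?(right X d') ?(ends b).2 //; lra.
  have s1 : s != - v by apply/eqP => E; apply: su; split=> //; left.
  have s2 : s != v by apply/eqP => E; apply: su; split=> //; right.
  have {}le : - v < s by rewrite lt_neqAle eq_sym s1.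
  have {}le' : s < v by rewrite lt_neqAle s2.
  have sv : - v < s < v by rewrite le.
  by rewrite (mid X d s cold sv) (mid X d' s cold' sv) (ends a).1 (ends b).1.
Qed.

(** ** The third move *)

Lemma midpoint (R : realType) (p q : R) : -1 < p -> p < q -> q < 1 ->
  exists z, [/\ -1 <= z /\ z <= 1, p < z /\ z < q, ~ (z <= p <= 1) &
    ~ (-1 <= q <= z)].
Proof.
by move=> p1 pq q1; exists ((p + q) / 2); split; [lra|lra| |];
  move=> /andP[]; lra.
Qed.

Section Triangle.
Variables (R : realType) (r : nat) (T M B : 'I_r).
Hypothesis TMB : forall i, [\/ i = T, i = M | i = B].
Hypotheses (TM : T != M) (TB : T != B) (MB : M != B).
Variable E : 'I_r -> 'I_r -> bool.
Implicit Types (i j : 'I_r) (s t u : R) (A : 'I_r -> 'I_r -> R).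

(** Three strands, [T] over [M] over [B], each two of them crossing once: [A i j]
    is the parameter on strand [i] of its crossing with strand [j]. *)
Definition triangle A (tc : tangle_crossings R r) := forall j t i u e,
  tc j t i u e <-> [/\ [\/ j = T /\ i = M, j = T /\ i = B | j = M /\ i = B],
    t = A j i, u = A i j & e = E j i].

Definition generic A := [/\ forall i j, -1 < A i j < 1, A M T != A M B & A B T != A B M].

Section Reading.
Variables (A : 'I_r -> 'I_r -> R) (tc : tangle_crossings R r).
Hypotheses (triA : triangle A tc) (genA : generic A).
Local Notation m := (A M T).
Local Notation k := (A M B).
Local Notation p := (A B T).
Local Notation q := (A B M).

Lemma triangle_under_T u : ~ tangle_under tc T u.
Proof.
move=> [j [t [e /triA[H _ _ _]]]].
by case: H => -[_ /eqP]; rewrite ?(negPf TM) ?(negPf TB).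
Qed.

Lemma triangle_under_M u : tangle_under tc M u <-> u = m.
Proof.
split=> [[j [t [e /triA[H _ -> _]]]]|->].
  by case: H => -[-> /eqP]; rewrite ?(negPf MB).
by exists T, (A T M), (E T M); apply/triA; split=> //; constructor 1.
Qed.

Lemma triangle_under_B u : tangle_under tc B u <-> u = p \/ u = q.
Proof.
split=> [[j [t [e /triA[H _ -> _]]]]|[->|->]].
- case: H => -[-> /eqP]; rewrite ?[B == M]eq_sym ?(negPf MB) //; first by left.
  by right.
- by exists T, (A T B), (E T B); apply/triA; split=> //; constructor 2.
- by exists M, (A M B), (E M B); apply/triA; split=> //; constructor 3.
Qed.

Variables (X : quandle) (d : 'I_r -> R -> X).
Hypothesis cold : tangle_coloring tc d.

Lemma triangle_T s : -1 <= s <= 1 -> d T s = d T (-1).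
Proof. by move=> sI; apply: (tcol_left cold) => // u _ /triangle_under_T. Qed.

Lemma triangle_Ml s : -1 <= s -> s < m -> d M s = d M (-1).
Proof.
have [AI _ _] := genA; have mI := AI M T; move=> s1 sm.
apply: (tcol_left cold); first by lra.
by move=> u us /triangle_under_M; lra.
Qed.

Lemma triangle_Mr s : m < s -> s <= 1 -> d M s = d M 1.
Proof.
have [AI _ _] := genA; have mI := AI M T; move=> s1 sm.
apply: (tcol_right cold); first by lra.
by move=> u us /triangle_under_M; lra.
Qed.

Lemma triangle_M : d M 1 = qact (E T M) (d M (-1)) (d T (-1)).
Proof.
have [AI _ _] := genA; have mI := AI M T; have tI := AI T M.
rewrite -(triangle_T (s := A T M)); last by lra.
apply: (tcol_cross cold (u := m)); try lra; last by move=> w _ /triangle_under_M.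
by apply/triA; split=> //; constructor 1.
Qed.

Lemma triangle_Mk : d M k = if k < m then d M (-1) else d M 1.
Proof.
have [AI mk _] := genA; have kI := AI M B.
case: ltP => [km|]; first by apply: triangle_Ml => //; lra.
rewrite le_eqVlt (negPf mk) /= => mk'; apply: triangle_Mr => //; lra.
Qed.

Lemma triangle_Bl s : -1 <= s -> s < p -> s < q -> d B s = d B (-1).
Proof.
have [AI _ _] := genA; have pI := AI B T; move=> s1 sp sq.
apply: (tcol_left cold); first by lra.
by move=> u us /triangle_under_B; case; lra.
Qed.

Lemma triangle_Br s : p < s -> q < s -> s <= 1 -> d B s = d B 1.
Proof.
have [AI _ _] := genA; have pI := AI B T; move=> s1 sp sq.
apply: (tcol_right cold); first by lra.
by move=> u us /triangle_under_B; case; lra.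
Qed.

Lemma triangle_B_T s s' : -1 <= s -> s < p -> p < s' -> s' <= 1 ->
  ~ (s <= q <= s') -> d B s' = qact (E T B) (d B s) (d T (-1)).
Proof.
have [AI _ _] := genA; have tI := AI T B => s1 sp ps s2 nq.
rewrite -(triangle_T (s := A T B)); last by lra.
apply: (tcol_cross cold (u := p)) => //.
  by apply/triA; split=> //; constructor 2.
by move=> w wI /triangle_under_B[//|wq]; case: nq; rewrite -wq.
Qed.

Lemma triangle_B_M s s' : -1 <= s -> s < q -> q < s' -> s' <= 1 ->
  ~ (s <= p <= s') -> d B s' = qact (E M B) (d B s) (d M k).
Proof.
move=> s1 sp ps s2 nq; apply: (tcol_cross cold (u := q)) => //.
  by apply/triA; split=> //; constructor 3.
by move=> w wI /triangle_under_B[wq|//]; case: nq; rewrite -wq.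
Qed.

End Reading.

Lemma triangle_determine A tc : triangle A tc -> generic A -> ends_determine tc.
Proof.
move=> triA genA X d d' cold cold' ends i s sI us.
have [s1 s2] := andP sI; have [AI mk pq] := genA.
have pI := AI B T; have qI := AI B M.
case: (TMB i) us => -> us {i}.
- by rewrite (triangle_T triA cold) // (triangle_T triA cold') // (ends T).1.
- case: (ltgtP s (A M T)) => [lt|lt|su]; last by case: us; apply/(triangle_under_M triA).
    by rewrite (triangle_Ml triA genA cold) // (triangle_Ml triA genA cold') // (ends M).1.
  by rewrite (triangle_Mr triA genA cold) // (triangle_Mr triA genA cold') // (ends M).2.
- have Mk : d M (A M B) = d' M (A M B).
    by rewrite (triangle_Mk triA genA cold) (triangle_Mk triA genA cold') (ends M).1 (ends M).2.
  have sp : s != A B T by apply/eqP => sp; apply: us; apply/(triangle_under_B triA); left.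
  have sq : s != A B M by apply/eqP => sq; apply: us; apply/(triangle_under_B triA); right.
  have l1 : -1 <= (-1 : R) by [].
  case: (ltgtP s (A B T)) sp => // sp _; case: (ltgtP s (A B M)) sq => // sq _.
  + by rewrite (triangle_Bl triA genA cold) // (triangle_Bl triA genA cold') // (ends B).1.
  + rewrite (triangle_B_M triA cold l1 _ sq s2); [|lra|lra].
    by rewrite (triangle_B_M triA cold' l1 _ sq s2); [|lra|lra]; rewrite Mk (ends B).1.
  + rewrite (triangle_B_T triA genA cold l1 _ sp s2); [|lra|lra].
    rewrite (triangle_B_T triA genA cold' l1 _ sp s2); [|lra|lra].
    by rewrite (ends B).1 (ends T).1.
  + by rewrite (triangle_Br triA genA cold) // (triangle_Br triA genA cold') // (ends B).2.
Qed.

(** The colors after the move are forced.  On [B] they come out right by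
    distributivity, as the colors of [M] that [B] meets before and after the move
    differ exactly by the action of [T]; [signs] says that the three strands
    really bound a triangle. *)
Lemma triangle_extend A A' tc tc' :
  triangle A tc -> triangle A' tc' -> generic A -> generic A' ->
  (A' M T < A' M B) = ~~ (A M T < A M B) ->
  (A' B T < A' B M) = ~~ (A B T < A B M) ->
  ((A B T < A B M) == (A M T < A M B)) = (E T B == E T M) ->
  ends_extend tc tc'.
Proof.
move=> triA triA' genA genA' revM revB signs X d cold.
have [AI mk pq] := genA; have [AI' mk' pq'] := genA'.
pose a := d T (-1); pose b := d M (-1); pose b1 := d M 1; pose c := d B (-1).
pose y' := if A' M B < A' M T then b else b1.
pose c1 := if A' B T < A' B M then qact (E T B) c a else qact (E M B) c y'.
pose lo := Num.min (A' B T) (A' B M); pose hi := Num.max (A' B T) (A' B M).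
have b1E : b1 = qact (E T M) b a by exact: (triangle_M triA genA cold).
have l1 : -1 <= (-1 : R) by [].
have r1 : (1 : R) <= 1 by [].
have c2E : d B 1 = if A' B T < A' B M then qact (E M B) c1 y' else qact (E T B) c1 a.
  pose y := d M (A M B).
  have yE : y = if A M B < A M T then b else b1 by exact: (triangle_Mk triA genA cold).
  have y'E : y' = if A M T < A M B then b else b1.
    by rewrite /y' -[A M T < A M B]negbK -revM -leNgt le_eqVlt eq_sym (negPf mk').
  have bE : b = qact (~~ E T M) b1 a by rewrite b1E qactK.
  have pI := AI B T; have qI := AI B M.
  have [p1 p2] := andP pI; have [q1 q2] := andP qI.
  rewrite /c1 revB; move: signs.
  case: (ltgtP (A B T) (A B M)) pq => //= pq _ signs.
    have -> : d B 1 = qact (E M B) (qact (E T B) c a) y.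
      have [z [[z1 z2] [zp zq] H1 H2]] := midpoint p1 pq q2.
      by rewrite (triangle_B_M triA cold z1 zq q2 r1 H1) (triangle_B_T triA genA cold l1 p1 zp z2 H2).
    rewrite [RHS]qactD; congr (qact _ _ _); rewrite yE y'E.
    case: (ltgtP (A M T) (A M B)) mk signs => //= _ _ /esym/eqP tb; first by rewrite tb.
    by rewrite bE; congr (qact _ _ _); case: (E T B) tb; case: (E T M).
  have -> : d B 1 = qact (E T B) (qact (E M B) c y) a.
    have [z [[z1 z2] [zp zq] H1 H2]] := midpoint q1 pq p2.
    by rewrite (triangle_B_T triA genA cold z1 zq p2 r1 H1) (triangle_B_M triA cold l1 q1 zp z2 H2).
  rewrite qactD; congr (qact _ _ _); rewrite yE y'E.
  case: (ltgtP (A M T) (A M B)) mk signs => //= _ _ /esym/eqP tb; last by rewrite tb.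
  by rewrite {1}bE; congr (qact _ _ _); case: (E T B) tb; case: (E T M).
pose d' i s := if i == T then a else if i == M then step3 b b1 b1 (A' M T) (A' M T) s
   else step3 c c1 (d B 1) lo hi s.
have d'T s : d' T s = a by rewrite /d' eqxx.
have d'M s : d' M s = step3 b b1 b1 (A' M T) (A' M T) s.
  by rewrite /d' eqxx eq_sym (negPf TM).
have d'B s : d' B s = step3 c c1 (d B 1) lo hi s.
  by rewrite /d' eq_sym (negPf TB) eq_sym (negPf MB).
have d'y : d' M (A' M B) = y'.
  rewrite d'M /y'; case: (ltgtP (A' M B) (A' M T)) mk' => [h|h|//].
    by rewrite step3_l.
  by move=> _; rewrite step3_r // ltW.
exists d'.
  split=> [i s s' s1 ss s2 H|j t i u e s s' /triA'[ji -> -> ->] s1 su us s2 H].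
    case: (TMB i) H => -> H.
    - by rewrite !d'T.
    - by rewrite !d'M; apply: step3_const => // /H; apply; apply/(triangle_under_M triA').
    - rewrite !d'B; apply: step3_const => // /H; apply; apply/(triangle_under_B triA').
        by rewrite /lo; case: ltP; [left|right].
      by rewrite /hi; case: ltP; [right|left].
  case: ji su us H => -[-> ->] su us H.
  - by rewrite !d'M d'T (step3_l _ _ _ _ su) (step3_r _ _ _ (ltW us) (ltW us)).
  - have nq : ~ (s <= A' B M <= s').
      by move=> /H h; move: pq'; rewrite h ?eqxx //; apply/(triangle_under_B triA'); right.
    rewrite !d'B d'T /lo /hi; move: c2E; rewrite /c1.
    case: (ltgtP (A' B T) (A' B M)) pq' => //= pq' _ c2E.
      have sq : s' < A' B M by rewrite ltNge; apply/negP => h; apply: nq; lra.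
      by rewrite (step3_l _ _ _ _ su) (step3_m _ _ _ (ltW us) sq).
    have sq : A' B M < s by rewrite ltNge; apply/negP => h; apply: nq; lra.
    rewrite (step3_m _ _ _ (ltW sq) su) (step3_r _ _ _ _ (ltW us)) //.
    by rewrite ltW // (lt_trans pq').
  - have nq : ~ (s <= A' B T <= s').
      by move=> /H h; move: pq'; rewrite h ?eqxx //; apply/(triangle_under_B triA'); left.
    rewrite !d'B d'y /lo /hi; move: c2E; rewrite /c1.
    case: (ltgtP (A' B T) (A' B M)) pq' => //= pq' _ c2E.
      have sq : A' B T < s by rewrite ltNge; apply/negP => h; apply: nq; lra.
      rewrite (step3_m _ _ _ (ltW sq) su) (step3_r _ _ _ _ (ltW us)) //.
      by rewrite ltW // (lt_trans pq').
    have sq : s' < A' B T by rewrite ltNge; apply/negP => h; apply: nq; lra.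
    by rewrite (step3_l _ _ _ _ su) (step3_m _ _ _ (ltW us) sq).
have pI := AI' B T; have qI := AI' B M; have mI := AI' M T.
move=> i; case: (TMB i) => ->.
- by rewrite !d'T; split=> //; apply: (triangle_T triA cold); lra.
- rewrite !d'M step3_l; last by lra.
  by rewrite step3_r //; lra.
- rewrite !d'B step3_l; last by rewrite lt_min; lra.
  by rewrite step3_r // ?ge_min ?ge_max; lra.
Qed.

Lemma triangle_equivalent A A' tc tc' :
  triangle A tc -> triangle A' tc' -> generic A -> generic A' ->
  (A' M T < A' M B) = ~~ (A M T < A M B) ->
  (A' B T < A' B M) = ~~ (A B T < A B M) ->
  ((A B T < A B M) == (A M T < A M B)) = (E T B == E T M) ->
  tangle_equivalent tc tc'.
Proof.
move=> triA triA' genA genA' revM revB signs; split.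
- exact: (triangle_extend triA triA').
- apply: (triangle_extend triA' triA) => //; rewrite ?revM ?revB ?negbK //.
  by rewrite -signs; case: (_ < _); case: (_ < _).
- exact: triangle_determine genA.
- exact: triangle_determine genA'.
Qed.

End Triangle.

(** * The standard curves *)

Section StandardCurves.
Variable R : realType.
Implicit Types (s t u : R).

Lemma vec2_eq (x y x' y' : R) : vec2 x y = vec2 x' y' <-> x = x' /\ y = y'.
Proof.
split=> [E|[-> ->]//]; split.
  by rewrite -(coord_vec2_0 x y) E coord_vec2_0.
by rewrite -(coord_vec2_1 x y) E coord_vec2_1.
Qed.

Lemma det2_vec2 (x y x' y' : R) : det2 (vec2 x y) (vec2 x' y') = x * y' - y * x'.
Proof. by rewrite /det2 !coord_vec2_0 !coord_vec2_1. Qed.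

Lemma on_disc_vec2 (x y : R) : x ^+ 2 + y ^+ 2 <= 1 -> on_disc (vec2 x y).
Proof. by rewrite /on_disc dotE2 !coord_vec2_0 !coord_vec2_1 -!expr2. Qed.

Lemma cubic_derive (a b c d t : R) (f : R -> R) :
  (forall s, f s = a + b * s + c * s ^+ 2 + d * s ^+ 3) ->
  derivable f t 1 /\ f^`()%classic t = b + 2 * c * t + 3 * d * t ^+ 2.
Proof.
move=> fE; pose p : {poly R} := a%:P + b *: 'X + c *: 'X^2 + d *: 'X^3.
have -> : f = horner p by apply/funext => s; rewrite fE /p !hornerE; ring.
split; first exact: derivable_horner.
by rewrite -derivE /p !poly.derivE !hornerE /=; ring.
Qed.

Lemma cubic_curve (a b c d a' b' c' d' t : R) (g : R -> 'rV[R]_2) :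
  (forall s, g s = vec2 (a + b * s + c * s ^+ 2 + d * s ^+ 3)
                        (a' + b' * s + c' * s ^+ 2 + d' * s ^+ 3)) ->
  derivable g t 1 /\ g^`()%classic t =
    vec2 (b + 2 * c * t + 3 * d * t ^+ 2) (b' + 2 * c' * t + 3 * d' * t ^+ 2).
Proof.
move=> gE; pose f (i : 'I_2) s : R := g s 0 i.
have [d0 E0] := @cubic_derive a b c d t (f 0) ltac:(by move=> s; rewrite /f gE mxE).
have [d1 E1] := @cubic_derive a' b' c' d' t (f 1) ltac:(by move=> s; rewrite /f gE mxE).
have dg : derivable (g : R^o -> 'rV[R]_2) t 1.
  apply/derivable_mxP => i j; rewrite (ord1 i).
  by case: j => -[|[|//]] lt; [rewrite (_ : Ordinal lt = 0)|rewrite (_ : Ordinal lt = 1)];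
    rewrite //; apply/val_inj.
split=> //; rewrite derive1E derive_mx //; apply/rowP => j; rewrite !mxE.
rewrite -derive1E; case: j => -[|[|//]] lt /=.
  by rewrite -E0; congr (derive1 _ t); apply/funext => s; congr (g s _ _); apply/val_inj.
by rewrite -E1; congr (derive1 _ t); apply/funext => s; congr (g s _ _); apply/val_inj.
Qed.

Lemma eq_sqrD (s t : R) : s ^+ 2 = t ^+ 2 -> s = t \/ s = - t.
Proof.
move=> /eqP; rewrite -subr_eq0 subr_sqr mulf_eq0 => /orP[/eqP E|/eqP E].
  by left; apply/eqP; rewrite -subr_eq0 E.
by right; apply/eqP; rewrite -subr_eq0 opprK E.
Qed.

(** ** Kinks *)

(** A prime on the name of a standard curve denotes its velocity. *)
Definition R1_line' (i : 'I_1) s : 'rV[R]_2 := vec2 1 0.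

Definition R1_kink' (i : 'I_1) s : 'rV[R]_2 := vec2 ((12 * s ^+ 2 - 1) / 3) (- s).

Lemma R1_line_system : curve_system (@R1_line R) R1_line'.
Proof.
have der i s := @cubic_curve 0 1 0 0 0 0 0 0 s (@R1_line R i)
  ltac:(by move=> u; rewrite /R1_line; congr vec2; ring).
split.
- by move=> i s sI; apply: on_disc_vec2; nra.
- by move=> i s; have [] := der i s.
- by move=> i s; have [_ ->] := der i s; congr vec2; ring.
- by move=> i j s t sI tI /vec2_eq[st _]; left; rewrite (ord1 i) (ord1 j).
Qed.

Lemma R1_kink_meet i j s t : R1_kink i s = R1_kink j t :> 'rV[R]_2 ->
  [\/ s = t, s = - (1 / 2) /\ t = 1 / 2 | s = 1 / 2 /\ t = - (1 / 2)].
Proof.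
move=> /vec2_eq[E1 E2].
have /eq_sqrD[->|st] : s ^+ 2 = t ^+ 2 by lra.
  by constructor 1.
rewrite {}st in E1 *; have : t * (2 * t - 1) * (2 * t + 1) = 0 by lra.
move=> /eqP; rewrite !mulf_eq0 => /orP[/orP[]|] /eqP t0.
- by constructor 1; lra.
- by constructor 2; split; lra.
- by constructor 3; split; lra.
Qed.

Lemma R1_kink_system : curve_system (@R1_kink R) R1_kink'.
Proof.
have der i s := @cubic_curve 0 (- (1 / 3)) 0 (4 / 3) (1 / 2) 0 (- (1 / 2)) 0 s (@R1_kink R i)
  ltac:(by move=> u; rewrite /R1_kink; congr vec2; field).
split.
- move=> i s sI; apply: on_disc_vec2.
  have s2 : 0 <= s ^+ 2 <= 1 by nra.
  (* One minus the squared norm has the factor 1 - s ^ 2, as the ends lie on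
     the circle; the other factor is positive. *)
  have {}s2 : 0 <= (1 - s ^+ 2) * (27 + 41 * s ^+ 2 + 64 * (s ^+ 2) ^+ 2).
    by apply: mulr_ge0; nra.
  rewrite -subr_ge0; have -> : 1 - ((s * (4 * s ^+ 2 - 1) / 3) ^+ 2 +
      ((1 - s ^+ 2) / 2) ^+ 2) =
    (1 - s ^+ 2) * (27 + 41 * s ^+ 2 + 64 * (s ^+ 2) ^+ 2) / 36 by field.
  by rewrite divr_ge0.
- by move=> i s; have [] := der i s.
- by move=> i s; have [_ ->] := der i s; congr vec2; field.
- move=> i j s t sI tI /R1_kink_meet[->|[-> ->]|[-> ->]]; last 2 first.
  + by right; split; lra.
  + by right; split; lra.
  + by left; rewrite (ord1 i) (ord1 j).
Qed.

Lemma R1_equivalent : curves_equivalent (@R1_line R) R1_line' (@R1_kink R) R1_kink'.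
Proof.
move=> back height tc tc' _ [ov [_ _ tcE]] [ov' [anti _ tcE']].
have empty j t i u e : ~ tc j t i u e.
  by move=> /tcE[_ _ [ns /vec2_eq[tu _]] _ _]; apply: ns; rewrite (ord1 i) (ord1 j).
have hI : -1 <= - (1 / 2 : R) <= 1 by lra.
have hI' : -1 <= (1 / 2 : R) <= 1 by lra.
have node : R1_kink 0 (- (1 / 2)) = R1_kink 0 (1 / 2) :> 'rV[R]_2.
  by apply/vec2_eq; split; field.
have nsame : ~ ((0 : 'I_1) = 0 /\ - (1 / 2) = 1 / 2 :> R) by move=> [_]; lra.
have A := anti 0 0 _ _ hI hI' nsame node.
have [w|w] := pselect (ov' 0 (- (1 / 2)) 0 (1 / 2)).
  apply: (@kink_equivalent _ tc tc' (- (1 / 2)) (1 / 2)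
    ((0 < det2 (R1_kink' 0 (- (1 / 2))) (R1_kink' 0 (1 / 2))) (+) back 0) empty);
    [|lra|lra|by apply/eqP; lra].
  move=> j t i u e; rewrite tcE' (ord1 i) (ord1 j); split.
    move=> [_ _ [ns' /R1_kink_meet[E|[-> ->]|[tE uE]]] w' ->] //; first by case: ns'.
    by case: (A.1 w); rewrite tE uE in w'.
  by move=> [-> -> ->].
have {}w : ov' 0 (1 / 2) 0 (- (1 / 2)).
  by apply: contrapT => w'; apply: w; apply/A.
apply: (@kink_equivalent _ tc tc' (1 / 2) (- (1 / 2))
    ((0 < det2 (R1_kink' 0 (1 / 2)) (R1_kink' 0 (- (1 / 2)))) (+) back 0) empty);
    [|lra|lra|by apply/eqP; lra].
move=> j t i u e; rewrite tcE' (ord1 i) (ord1 j); split.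
  move=> [_ _ [ns' /R1_kink_meet[E|[tE uE]|[-> ->]]] w' ->] //; first by case: ns'.
  by rewrite tE uE in w'; case: (A.1 w').
by move=> [-> -> ->]; split=> //; split=> // -[_]; lra.
Qed.

End StandardCurves.

(** ** Overlaps *)

Section Overlap.
Variable R : realType.
Implicit Types (s t u : R).

Definition R2_apart' (i : 'I_2) s : 'rV[R]_2 := vec2 (4 / 5) 0.

Definition R2_overlap' (i : 'I_2) s : 'rV[R]_2 :=
  vec2 (4 / 5) (if i == 0 then - (8 / 5) * s else 8 / 5 * s).

Lemma ord2P (i : 'I_2) : i = 0 \/ i = 1.
Proof. by case: i => -[|[|//]] lt; [left|right]; apply: val_inj. Qed.

Lemma R2_apart_meet i j s t : R2_apart i s = R2_apart j t :> 'rV[R]_2 -> i = j /\ s = t.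
Proof.
move=> /vec2_eq[E1]; have -> : s = t by lra.
by case: (ord2P i) => ->; case: (ord2P j) => -> //=; lra.
Qed.

Lemma R2_overlap_meet i j s t : R2_overlap i s = R2_overlap j t :> 'rV[R]_2 <->
  s = t /\ (i != j -> s = - (1 / 2) \/ s = 1 / 2).
Proof.
split=> [/vec2_eq[E1]|[->]].
  have -> : s = t by lra.
  move=> E2; split=> // ij.
  have /eq_sqrD[] : t ^+ 2 = (1 / 2) ^+ 2; [|by right|by left].
  by case: (ord2P i) (ord2P j) ij E2 => -> [] -> //= _; lra.
rewrite /R2_overlap; case: (ord2P i) => ->; case: (ord2P j) => -> //= [//|->|->];
  by congr vec2; field.
Qed.

Lemma R2_apart_system : curve_system (@R2_apart R) R2_apart'.
Proof.
have der i s := @cubic_curve R 0 (4 / 5) 0 0 (if i == 0 then - (3 / 5) else 3 / 5) 0 0 0 s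
  (@R2_apart R i) ltac:(by move=> u; rewrite /R2_apart; congr vec2; [ring|case: eqP => _; ring]).
split.
- by move=> i s sI; apply: on_disc_vec2; case: eqP => _; nra.
- by move=> i s; have [] := der i s.
- by move=> i s; have [_ ->] := der i s; congr vec2; ring.
- by move=> i j s t sI tI /R2_apart_meet; left.
Qed.

Lemma R2_overlap_system : curve_system (@R2_overlap R) R2_overlap'.
Proof.
have der i s := @cubic_curve R 0 (4 / 5) 0 0 (if i == 0 then 1 / 5 else - (1 / 5)) 0
  (if i == 0 then - (4 / 5) else 4 / 5) 0 s (@R2_overlap R i)
  ltac:(by move=> u; rewrite /R2_overlap; congr vec2; [ring|case: eqP => _; field]).
split.
- move=> i s sI; apply: on_disc_vec2.
  have s2 : 0 <= s ^+ 2 <= 1 by nra.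
  have -> : (if i == 0 then (1 - 4 * s ^+ 2) / 5 else - ((1 - 4 * s ^+ 2) / 5)) ^+ 2 =
    ((1 - 4 * s ^+ 2) / 5) ^+ 2 by case: eqP => _ //; rewrite sqrrN.
  nra.
- by move=> i s; have [] := der i s.
- move=> i s; have [_ ->] := der i s; congr vec2; first by ring.
  by case: eqP => _; field.
- move=> i j s t sI tI /R2_overlap_meet[-> H].
  have [ij|ij] := eqVneq i j; [by left|right].
  by case: (H ij); lra.
Qed.

Lemma R2_equivalent : curves_equivalent (@R2_apart R) R2_apart' (@R2_overlap R) R2_overlap'.
Proof.
move=> back height tc tc' hinj [ov [_ _ tcE]] [ov' [_ hov tcE']].
have empty j t i u e : ~ tc j t i u e.
  by move=> /tcE[_ _ [ns /R2_apart_meet]].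
have [a [b [abP ab hab]]] : exists a b : 'I_2,
    [/\ forall i, i = a \/ i = b, a != b & (height b < height a)%N].
  have ne : height 0 != height 1 by apply/eqP => /hinj.
  case: (ltngtP (height 0) (height 1)) ne => // h _.
    by exists 1, 0; split=> // i; case: (ord2P i); [right|left].
  by exists 0, 1; split=> // i; case: (ord2P i); [left|right].
pose sign u := (0 < det2 (R2_overlap' a u) (R2_overlap' b u)) (+) back a.
have signN : sign (1 / 2) = ~~ sign (- (1 / 2)).
  rewrite /sign /R2_overlap' !det2_vec2 -addNb; congr (_ (+) _).
  case: (ord2P a) (ord2P b) ab => -> [] -> //= _.
    have -> : (0 < 4 / 5 * (8 / 5 * (1 / 2)) - - (8 / 5) * (1 / 2) * (4 / 5) :> R) by lra.
    by apply/esym; rewrite -leNgt; lra.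
  have -> : (0 < 4 / 5 * (- (8 / 5) * - (1 / 2)) - 8 / 5 * - (1 / 2) * (4 / 5) :> R) by lra.
  by apply/negbTE; rewrite -leNgt; lra.
apply: (@overlap_equivalent _ tc tc' a b (1 / 2) (sign (- (1 / 2))) empty abP ab); first lra.
move=> j t i u e; rewrite tcE'; split.
  move=> [tI uI [ns E] w ->]; have [tu uE] := (R2_overlap_meet _ _ _ _).1 E.
  have ji : j != i by apply/eqP => ji; apply: ns.
  have tE := uE ji; have := (hov _ _ _ _ tI uI ji E).1 w.
  case: (abP j) (abP i) ji => -> [] ->; rewrite ?eqxx // => _ hh.
    split=> //; rewrite -tu; case: tE => ->; [left|right]; split=> //.
  by move: hab; rewrite ltnNge (ltnW hh).
move=> [-> -> -> ue].
have E : R2_overlap a u = R2_overlap b u.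
  by apply/R2_overlap_meet; split=> // _; case: ue => -[-> _]; [left|right].
have uI : -1 <= u <= 1 by case: ue => -[-> _]; lra.
split=> //.
- by split=> // -[/eqP]; rewrite (negPf ab).
- exact: (hov _ _ _ _ uI uI ab E).2.
- by case: ue => -[-> ->] //; rewrite -signN.
Qed.

End Overlap.

(** ** Triangles *)

Section TriangleCurves.
Variable R : realType.
Implicit Types (i j : 'I_3) (s t u : R).

Definition R3_below' i s : 'rV[R]_2 :=
  match val i with
  | 0%N => vec2 1 s
  | 1%N => vec2 (3 / 5) (4 / 5)
  | _ => vec2 (3 / 5) (- (4 / 5))
  end.

Definition R3_above' i s : 'rV[R]_2 := R3_below' i (- s).

(** The parameter on strand [i] of its crossing with strand [j]. *)
Definition R3_node i j : R :=
  match val i, val j with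
  | 0%N, 1%N => - (1 / 3)
  | 0%N, 2%N => 1 / 3
  | 1%N, 0%N => - (5 / 9)
  | 2%N, 0%N => 5 / 9
  | _, _ => 0
  end.

Lemma ord3P i : [\/ i = 0, i = 1 | i = 2%:R].
Proof.
by case: i => -[|[|[|//]]] lt; [constructor 1|constructor 2|constructor 3]; apply: val_inj.
Qed.

(** The two sides of the move are exchanged by a half-turn. *)
Lemma R3_above_below i s : R3_above i s = - R3_below i (- s) :> 'rV[R]_2.
Proof.
have vec2N (x y : R) : - vec2 x y = vec2 (- x) (- y).
  by apply/rowP => -[[|[|//]] ?]; rewrite !mxE.
by rewrite /R3_above /R3_below; case: (ord3P i) => -> /=; rewrite vec2N;
  congr vec2; ring.
Qed.

Lemma R3_below_meet i j s t : -1 <= s <= 1 -> -1 <= t <= 1 ->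
  R3_below i s = R3_below j t :> 'rV[R]_2 <->
  (i = j /\ s = t) \/ (i != j /\ s = R3_node i j /\ t = R3_node j i).
Proof.
move=> sI tI.
split; last first.
  move=> [[-> ->]//|[ij [-> ->]]].
  by case: (ord3P i) (ord3P j) ij => -> [] -> //= _; rewrite /R3_below /R3_node /=;
    congr vec2; field.
(* The parabola meets the line of a diameter in two points, one of which is
   outside of the disc. *)
have root (x y : R) : -1 <= x <= 1 -> x = 3 / 5 * y -> - ((1 - x ^+ 2) / 2) = 4 / 5 * y ->
    x = - (1 / 3) /\ y = - (5 / 9).
  move=> xI E1 E2; have yE : y = 5 / 3 * x by lra.
  rewrite yE in E2; have : (x - 3) * (3 * x + 1) = 0 by lra.
  move/eqP; rewrite mulf_eq0 => /orP[/eqP|/eqP]; first by lra.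
  by split; lra.
case: (ord3P i) (ord3P j) => -> [] ->; rewrite /R3_below /= => /vec2_eq[E1 E2].
- by left.
- by right; split=> //; rewrite /R3_node /=; apply: root.
- right; split=> //; rewrite /R3_node /=.
  have [|||e1 e2] := root (- s) (- t); [lra|lra|by rewrite sqrrN; lra|by split; lra].
- right; split=> //; rewrite /R3_node /=.
  by have [] := root t s tI (esym E1) (esym E2).
- by left; split=> //; lra.
- by right; split=> //; rewrite /R3_node /=; lra.
- right; split=> //; rewrite /R3_node /=.
  have [|||e1 e2] := root (- t) (- s); [lra|lra|by rewrite sqrrN; lra|by split; lra].
- by right; split=> //; rewrite /R3_node /=; lra.
- by left; split=> //; lra.
Qed.

Lemma R3_node_lt1 i j : -1 < R3_node i j < 1.
Proof. by case: (ord3P i) => ->; case: (ord3P j) => ->; rewrite /R3_node /=; lra. Qed.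

Lemma R3_below_system : curve_system (@R3_below R) R3_below'.
Proof.
have der i s : derivable (@R3_below R i) s 1 /\
    (@R3_below R i)^`()%classic s = R3_below' i s.
  case: (ord3P i) => ->.
  - have [d E] := @cubic_curve R 0 1 0 0 (- (1 / 2)) 0 (1 / 2) 0 s (@R3_below R 0)
      ltac:(by move=> u; rewrite /R3_below /=; congr vec2; field).
    by split=> //; rewrite E /R3_below' /=; congr vec2; field.
  - have [d E] := @cubic_curve R 0 (3 / 5) 0 0 0 (4 / 5) 0 0 s (@R3_below R 1)
      ltac:(by move=> u; rewrite /R3_below /=; congr vec2; field).
    by split=> //; rewrite E /R3_below' /=; congr vec2; field.
  - have [d E] := @cubic_curve R 0 (3 / 5) 0 0 0 (- (4 / 5)) 0 0 s (@R3_below R 2%:R)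
      ltac:(by move=> u; rewrite /R3_below /=; congr vec2; field).
    by split=> //; rewrite E /R3_below' /=; congr vec2; field.
split.
- move=> i s sI; have s2 : 0 <= s ^+ 2 <= 1 by nra.
  rewrite /R3_below; case: (ord3P i) => -> /=; apply: on_disc_vec2; last 2 first.
  + by nra.
  + by nra.
  + have : 0 <= (1 - s ^+ 2) * (3 + s ^+ 2) by apply: mulr_ge0; lra.
    by nra.
- by move=> i s; have [] := der i s.
- by move=> i s; have [] := der i s.
- move=> i j s t sI tI /(R3_below_meet i j sI tI)[|[_ [-> ->]]]; first by left.
  by right; split; exact: R3_node_lt1.
Qed.

Lemma R3_above_system : curve_system (@R3_above R) R3_above'.
Proof.
have sys := R3_below_system.
have der i s : derivable (@R3_above R i) s 1 /\
    (@R3_above R i)^`()%classic s = R3_above' i s.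
  case: (ord3P i) => ->.
  - have [d E] := @cubic_curve R 0 1 0 0 (1 / 2) 0 (- (1 / 2)) 0 s (@R3_above R 0)
      ltac:(by move=> u; rewrite /R3_above /=; congr vec2; field).
    by split=> //; rewrite E /R3_above' /R3_below' /=; congr vec2; field.
  - have [d E] := @cubic_curve R 0 (3 / 5) 0 0 0 (4 / 5) 0 0 s (@R3_above R 1)
      ltac:(by move=> u; rewrite /R3_above /=; congr vec2; field).
    by split=> //; rewrite E /R3_above' /R3_below' /=; congr vec2; field.
  - have [d E] := @cubic_curve R 0 (3 / 5) 0 0 0 (- (4 / 5)) 0 0 s (@R3_above R 2%:R)
      ltac:(by move=> u; rewrite /R3_above /=; congr vec2; field).
    by split=> //; rewrite E /R3_above' /R3_below' /=; congr vec2; field.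
split.
- move=> i s sI; rewrite R3_above_below; have sI' : -1 <= - s <= 1 by lra.
  have := cs_disc sys i sI'; rewrite /on_disc !dotE2 /coord !mxE; nra.
- by move=> i s; have [] := der i s.
- by move=> i s; have [] := der i s.
- move=> i j s t sI tI; rewrite !R3_above_below => /oppr_inj E.
  have sI' : -1 <= - s <= 1 by lra.
  have tI' : -1 <= - t <= 1 by lra.
  by case: (cs_meet sys sI' tI' E) => [[ij st]|[sI2 tI2]]; [left|right]; split=> //; lra.
Qed.

End TriangleCurves.

Section TriangleMove.
Variable R : realType.
Implicit Types (i j : 'I_3) (s t u : R).

Lemma heights_sorted (height : 'I_3 -> nat) : injective height ->
  exists T M B : 'I_3, [/\ forall i, [\/ i = T, i = M | i = B],
    [/\ T != M, T != B & M != B], (height B < height M)%N & (height M < height T)%N].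
Proof.
move=> hinj; have ne i j : i != j -> height i != height j.
  by apply: contra_neq => /hinj.
have wit T M B : [/\ T != M, T != B & M != B] -> (height B < height M)%N ->
    (height M < height T)%N -> exists T M B : 'I_3, [/\ forall i, [\/ i = T, i = M | i = B],
    [/\ T != M, T != B & M != B], (height B < height M)%N & (height M < height T)%N].
  move=> [TM TB MB] h1 h2; exists T, M, B; split=> // i; move: TM TB MB.
  case: (ord3P i) => ->; case: (ord3P T) => ->; case: (ord3P M) => -> //;
  case: (ord3P B) => -> // _ _ _; by [constructor 1|constructor 2|constructor 3].
have := ne 0 1 isT; have := ne 0 2%:R isT; have := ne 1 2%:R isT.
case: (ltngtP (height 1) (height 2%:R)) => // h12 _;
case: (ltngtP (height 0) (height 2%:R)) => // h02 _;
case: (ltngtP (height 0) (height 1)) => // h01 _.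
- exact: (wit 2%:R 1 0).
- exact: (wit 2%:R 0 1).
- by have := ltn_trans h12 (ltn_trans h02 h01); rewrite ltnn.
- exact: (wit 0 2%:R 1).
- exact: (wit 1 2%:R 0).
- by have := ltn_trans h12 (ltn_trans h01 h02); rewrite ltnn.
- exact: (wit 1 0 2%:R).
- exact: (wit 0 1 2%:R).
Qed.

Lemma curve_triangle (sigma dsigma : 'I_3 -> R -> 'rV[R]_2) (N : 'I_3 -> 'I_3 -> R)
    back height tc (T M B : 'I_3) :
  (forall i j s t, -1 <= s <= 1 -> -1 <= t <= 1 -> sigma i s = sigma j t <->
     (i = j /\ s = t) \/ (i != j /\ s = N i j /\ t = N j i)) ->
  (forall i j, -1 < N i j < 1) ->
  (forall i, [\/ i = T, i = M | i = B]) ->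
  [/\ T != M, T != B & M != B] -> (height B < height M)%N -> (height M < height T)%N ->
  curve_tangle sigma dsigma back height tc ->
  triangle T M B (fun j i =>
    (0 < det2 (dsigma j (N j i)) (dsigma i (N i j))) (+) back j) N tc.
Proof.
move=> meet NI TMB [TM TB MB] hBM hMT [ov [_ hov tcE]] j t i u e.
have hBT := ltn_trans hBM hMT.
have NI' i' j' : -1 <= N i' j' <= 1 by have := NI i' j'; lra.
rewrite tcE; split.
  move=> [tI uI [ns E] w ->]; case: ((meet j i t u tI uI).1 E) => [//|[ji [tE uE]]].
  have h := (hov j i t u tI uI ji E).1 w.
  split=> //; last by rewrite tE uE.
  case: (TMB j) (TMB i) ji h => -> [] ->; rewrite ?eqxx // => _ h.
  - by constructor 1.
  - by constructor 2.
  - by have := ltn_trans h hMT; rewrite ltnn.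
  - by constructor 3.
  - by have := ltn_trans h hBT; rewrite ltnn.
  - by have := ltn_trans h hBM; rewrite ltnn.
move=> [jiE -> -> ->].
have [ji h] : j != i /\ (height i < height j)%N by case: jiE => -[-> ->].
have E : sigma j (N j i) = sigma i (N i j) by apply/meet => //; right.
split=> //; first by split=> // -[/eqP]; rewrite (negPf ji).
exact: (hov _ _ _ _ (NI' j i) (NI' i j) ji E).2.
Qed.

Lemma R3_above_meet i j s t : -1 <= s <= 1 -> -1 <= t <= 1 ->
  R3_above i s = R3_above j t :> 'rV[R]_2 <->
  (i = j /\ s = t) \/ (i != j /\ s = - R3_node R i j /\ t = - R3_node R j i).
Proof.
move=> sI tI; rewrite !R3_above_below.
have sI' : -1 <= - s <= 1 by lra.
have tI' : -1 <= - t <= 1 by lra.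
split.
  move=> /oppr_inj /(R3_below_meet i j sI' tI')[[-> /oppr_inj ->]|[ij [E1 E2]]]; first by left.
  by right; rewrite -E1 -E2 !opprK.
move=> H; congr (- _); apply/(R3_below_meet i j sI' tI').
by case: H => [[-> ->]|[ij [-> ->]]]; [left|right; rewrite !opprK].
Qed.

(** Numerically, the six orders of heights all satisfy the compatibility between
    the orders of the crossings and their signs that [triangle_extend] requires. *)
Lemma R3_node_lt i j l : i != j -> i != l -> j != l ->
  (R3_node R i j < R3_node R i l) = (if i == 2%:R then l < j else j < l)%N.
Proof.
case: (ord3P i) (ord3P j) (ord3P l) => -> [] -> [] -> //= _ _ _;
  rewrite /R3_node /=; first [rewrite [RHS](_ : _ = true) //; lra|
    rewrite [RHS](_ : _ = false) //; apply/negbTE; rewrite -leNgt; lra].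
Qed.

Lemma R3_sign i j : i != j ->
  (0 < det2 (R3_below' i (R3_node R i j)) (R3_below' j (R3_node R j i)))
  = (if (i + j)%N == 1%N then i < j else j < i)%N.
Proof.
case: (ord3P i) (ord3P j) => -> [] -> //= _;
  rewrite /R3_node /R3_below' /= det2_vec2; first [rewrite [RHS](_ : _ = true) //; lra|
    rewrite [RHS](_ : _ = false) //; apply/negbTE; rewrite -leNgt; lra].
Qed.

Lemma R3_equivalent : curves_equivalent (@R3_below R) (@R3_below' R)
  (@R3_above R) (@R3_above' R).
Proof.
move=> back height tc tc' hinj ct ct'.
have [T [M [B [TMB dist hBM hMT]]]] := heights_sorted hinj.
have [TM TB MB] := dist.
have tri := curve_triangle (@R3_below_meet R) (@R3_node_lt1 R) TMB dist hBM hMT ct.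
have NI i j : -1 < - R3_node R i j < 1 by have := R3_node_lt1 R i j; lra.
have := curve_triangle R3_above_meet NI TMB dist hBM hMT ct'.
set signs' := (fun j i => _ (+) _) => tri'.
have signsE : signs' = fun j i =>
    (0 < det2 (R3_below' j (R3_node R j i)) (R3_below' i (R3_node R i j))) (+) back j.
  by apply/funext => j; apply/funext => i; rewrite /signs' /R3_above' !opprK.
rewrite signsE in tri'; clear signs' signsE.
have MT : M != T by rewrite eq_sym.
have BT : B != T by rewrite eq_sym.
have BM : B != M by rewrite eq_sym.
have neq i j l : i != j -> i != l -> j != l -> R3_node R i j != R3_node R i l.
  move=> ij il jl; rewrite neq_lt !R3_node_lt //; last by rewrite eq_sym.
  by move: jl; rewrite -(inj_eq val_inj) /= neq_ltn orbC; case: (i == _); rewrite ?orbT // orbC.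
apply: (triangle_equivalent TMB TM TB MB tri tri').
- split; [exact: R3_node_lt1|exact: neq|exact: neq].
- by split; [exact: NI|rewrite eqr_opp neq|rewrite eqr_opp neq].
- by rewrite ltrN2 ltNge le_eqVlt (negPf (neq _ _ _ MT MB TB)).
- by rewrite ltrN2 ltNge le_eqVlt (negPf (neq _ _ _ BT BM TM)).
- rewrite !R3_node_lt // !R3_sign //.
  move: TM TB MB {MT BT BM hBM hMT TMB dist tri tri'}.
  case: (ord3P T) => ->; case: (ord3P M) => ->; case: (ord3P B) => -> //= _ _ _;
    by case: (back _).
Qed.

End TriangleMove.

Theorem theorem4p6 (R : realType) (n k : nat) (L L' : diagram R n k) :
  reidemeister_move L L' \/ spherical_move L L' ->
  pointed_isomorphic (fundamental_pointed_quandle L)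
    (fundamental_pointed_quandle L').
Proof.
move=> [[m|m|m|m]|[_ _ [L1 [Phi [LL1 isoPhi L1L' _]]]]].
- exact: R0_isomorphic.
- exact: (local_move_isomorphic (R1_line_system R) (R1_kink_system R) (@R1_equivalent R)).
- exact: (local_move_isomorphic (R2_apart_system R) (R2_overlap_system R) (@R2_equivalent R)).
- exact: (local_move_isomorphic (R3_below_system R) (R3_above_system R) (@R3_equivalent R)).
- by apply: R0_isomorphic; exists L1, Phi.
Qed.
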